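(* Let $(\mathcal{V},Y,T,|0\rangle)$ be a $\mathbf{Z}$-graded vertex algebra and let $\mu_Y$ be the associated multiplication maps. Then $\mu_Y$ satisfies associativity: for all $m,n\ge0$, $a_1,\dots,a_m,b_1,\dots,b_n\in\mathcal{V}$ and $l\in\mathbf{Z}$, on the set of $(z,w)\in(\mathbf{C}^{m+1}\setminus\Delta)\times(\mathbf{C}^n\setminus\Delta)$ with $\max_i|w_i|<\min_{1\le j\le m}|z_j-z_{m+1}|$ (no condition if $m=0$ or $n=0$), $$\sum_{k\in\mathbf{Z}}p_l\mu_Y(a_1,z_1,\dots,a_m,z_m,p_k\mu_Y(b_1,w_1,\dots,b_n,w_n),z_{m+1})=p_l\mu_Y(a_1,z_1,\dots,a_m,z_m,b_1,w_1+z_{m+1},\dots,b_n,w_n+z_{m+1}),$$ where the sum of $\mathcal{V}_l$-valued functions of $(z,w)$ is normally convergent.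
   Context: All vector spaces are over $\mathbf{C}$. For $n\ge 0$, $\Delta=\Delta_n=\{(z_1,\dots,z_n)\in\mathbf{C}^n\mid z_i=z_j\text{ for some } i\ne j\}$. For a $\mathbf{Z}$-graded vector space $\mathcal{V}=\bigoplus_{k}\mathcal{V}_k$ put $\overline{\mathcal{V}}=\prod_{k\in\mathbf{Z}}\mathcal{V}_k\supseteq\mathcal{V}$, with projections $p_k:\overline{\mathcal{V}}\to\mathcal{V}_k$; $|v|$ is the degree of a homogeneous $v$. Let $U\subseteq\mathbf{C}^n$ be open and $X$ a vector space. A map $f:U\to X$ is holomorphic if every $p\in U$ has an open neighborhood $W$ and a finite-dimensional subspace $Y\subseteq X$ with $f(W)\subseteq Y$ and $f|_W:W\to Y$ holomorphic. A function $U\to\overline{\mathcal{V}}$ is holomorphic if all its components are. A sum $\sum_{i\in I}f_i$ of holomorphic functions $U\to X$ is normally convergent if for all compact $K\subseteq U$ there is a finite-dimensional subspace $Y\subseteq X$ with $f_i(K)\subseteq Y$ for all $i$ and $\sum_i\sup_{x\in K}\|f_i(x)\|_Y<\infty$ for a norm on $Y$. $\mathbf{Z}$-graded vertex algebra $(\mathcal{V},Y,T,|0\rangle)$: a $\mathbf{Z}$-graded vector space $\mathcal{V}$; a linear map $Y:\mathcal{V}\to\mathrm{End}(\mathcal{V})[[x^{\pm1}]]$, $a\mapsto Y(a,x)=\sum_{k\in\mathbf{Z}}a_{(k)}x^{-k-1}$, where the mode $a_{(k)}$ is homogeneous of degree $|a|-k-1$ for homogeneous $a$; a degree $1$ endomorphism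 $T$ of $\mathcal{V}$; a vector $|0\rangle\in\mathcal{V}_0$; such that: (locality) for all $a,b$ there is $N\in\mathbf{N}$ with $(x-y)^N[Y(a,x),Y(b,y)]=0$ in $\mathrm{End}(\mathcal{V})[[x^{\pm1},y^{\pm1}]]$; (translation) $T|0\rangle=0$ and $[T,Y(a,x)]=\partial_xY(a,x)$; (creation) $Y(a,x)|0\rangle\in a+x\mathcal{V}[[x]]$; (vacuum) $Y(|0\rangle,x)=\mathrm{id}_{\mathcal{V}}$. Definition of $\mu_Y$: for $a_1,\dots,a_m\in\mathcal{V}$, $z\mapsto\mu_Y(a_1,z_1,\dots,a_m,z_m)$ is the unique holomorphic $\overline{\mathcal{V}}$-valued function on $\mathbf{C}^m\setminus\Delta$ which for $|z_1|>\dots>|z_m|$ equals $$Y(a_1,z_1)\cdots Y(a_m,z_m)|0\rangle=\sum_{k\in\mathbf{Z}^m}{a_1}_{(k_1)}\cdots{a_m}_{(k_m)}|0\rangle\,z_1^{-k_1-1}\cdots z_m^{-k_m-1},$$ the sum converging normally in each component of $\overline{\mathcal{V}}$ (only non-negative powers of $z_m$ occur, by creation). Existence and uniqueness of $\mu_Y$, and its multilinearity in the $a_i$, are part of the paper's theory. For $m=0$, $\mu_Y(\emptyset)=|0\rangle$. *)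

(* Defs.v *)
From HB Require Import structures.
From mathcomp Require Import all_boot all_order all_algebra finmap.
From mathcomp Require Import complex.
From mathcomp Require Import all_classical all_reals all_analysis.
From mathcomp.analysis.showcase Require summability.

Set Implicit Arguments.
Unset Strict Implicit.
Unset Printing Implicit Defensive.

Import Order.TTheory GRing.Theory Num.Theory.
Import numFieldNormedType.Exports.

#[global] Open Scope classical_set_scope.
#[global] Open Scope complex_scope.
#[global] Open Scope ring_scope.

(** * Holomorphic functions and normal convergence

    The target [X] is a complex vector space without topology, possibly of
    infinite dimension; the domain [E] is a normed space, in practice [C^m] or
    [C^m * C^n]. *)

Section FiniteDimensional.
Variables (R : realType) (X : lmodType R[i]).

Definition lin_span (d : nat) (e : 'I_d -> X) : set X :=
  [set v | exists c : 'I_d -> R[i], v = \sum_i c i *: e i].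

Definition lin_indep (d : nat) (e : 'I_d -> X) : Prop :=
  forall c : 'I_d -> R[i], \sum_i c i *: e i = 0 -> forall i, c i = 0.

Definition findim_subspace (Y : set X) : Prop :=
  exists (d : nat) (e : 'I_d -> X), Y = lin_span e.

Definition norm_on (Y : set X) (N : X -> R) : Prop :=
  [/\ forall v, Y v -> 0 <= N v,
      forall v, Y v -> N v = 0 -> v = 0,
      forall (c : R[i]) v, Y v -> N (c *: v) = Normc.normc c * N v
    & forall u v, Y u -> Y v -> N (u + v) <= N u + N v].

(* Unordered summation in a finite-dimensional subspace; neither the subspace
   nor the norm on it matters. *)
Definition has_sum (I : choiceType) (g : I -> X) (s : X) : Prop :=
  exists (Y : set X) (N : X -> R),
    [/\ findim_subspace Y, norm_on Y N, forall i, Y (g i), Y s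
      & N (summability.partial_sum g A - s) @[A --> @summability.totally I]
          --> (0 : R)].

End FiniteDimensional.

Section Holomorphic.
Variables (R : realType) (E : normedModType R[i]) (X : lmodType R[i]).

(* [e] is a basis of the finite-dimensional subspace and [h] gives the
   coordinates of [f] in it; [R[i]^o] is [R[i]] as a normed space over itself,
   so that [differentiable] means complex differentiable. *)
Definition holomorphic (U : set E) (f : E -> X) : Prop :=
  forall p, U p -> exists W : set E,
    [/\ open W, W p, W `<=` U
      & exists (d : nat) (e : 'I_d -> X) (h : 'I_d -> E -> R[i]^o),
        [/\ lin_indep e,
            forall i x, W x -> differentiable (h i) x
          & forall x, W x -> f x = \sum_i h i x *: e i]].

(* For [K = set0] the suprema are [-oo], the [\esum] is [0] and the condition
   is void. *)
Definition normally_convergent (I : choiceType) (U : set E) (f : I -> E -> X) :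
    Prop :=
  (forall i, holomorphic U (f i)) /\
  forall K : set E, compact K -> K `<=` U ->
    exists (Y : set X) (N : X -> R),
      [/\ findim_subspace Y, norm_on Y N, forall i x, K x -> Y (f i x)
        & (\esum_(i in [set: I])
              ereal_sup [set (N (f i x))%:E | x in K] < +oo)%E].

Definition sums_normally_to (I : choiceType) (U : set E) (f : I -> E -> X)
    (F : E -> X) : Prop :=
  normally_convergent U f /\ forall x, U x -> has_sum (f ^~ x) (F x).

End Holomorphic.

(** * Graded vector spaces *)

(* The direct sum decomposition is given by the injections of the homogeneous
   components and the projections onto them. *)
Record gradedSpace (R : realType) := GradedSpace {
  gr_sort :> lmodType R[i];
  gr_comp : int -> lmodType R[i];
  gr_inj : forall k, {linear gr_comp k -> gr_sort};
  gr_proj : forall k, {linear gr_sort -> gr_comp k};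
  gr_projK : forall k x, gr_proj k (gr_inj k x) = x;
  gr_proj0 : forall k l x, k != l -> gr_proj k (gr_inj l x) = 0;
  gr_sum : forall v, exists s : {fset int},
    v = \sum_(k <- s) gr_inj k (gr_proj k v)
}.

Definition homogeneous (R : realType) (V : gradedSpace R) (k : int) (v : V) :
    Prop :=
  exists x : gr_comp V k, v = gr_inj V k x.

(* The product of the homogeneous components; the projection [p_k] is
   evaluation at [k]. *)
Definition completion (R : realType) (V : gradedSpace R) : Type :=
  forall k : int, gr_comp V k.

(** * Vertex algebras *)

(* [F p q] is the coefficient of [x^p y^q] in a formal distribution. *)
Definition mul_x_sub_y (M : zmodType) (F : int -> int -> M) (p q : int) : M :=
  F (p - 1) q - F p (q - 1).

(* [va_mode a k] is the mode [a_(k)], the coefficient of [x^(-k-1)] in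
   [Y(a,x)]; hence the coefficient of [x^p] is [va_mode a (- p - 1)], and that
   of [x^(-k-1)] in the derivative of [Y(a,x)] is [- k a_(k-1)]. *)
Record vertexAlgebra (R : realType) := VertexAlgebra {
  va_space :> gradedSpace R;
  va_mode : va_space -> int -> {linear va_space -> va_space};
  va_T : {linear va_space -> va_space};
  va_vac : va_space;
  va_mode_linear : forall (c : R[i]) a b k v,
    va_mode (c *: a + b) k v = c *: va_mode a k v + va_mode b k v;
  va_mode_degree : forall (d k e : int) (a b : va_space),
    homogeneous d a -> homogeneous e b ->
    homogeneous (e + (d - k - 1)) (va_mode a k b);
  va_T_degree : forall (k : int) (a : va_space),
    homogeneous k a -> homogeneous (k + 1) (va_T a);
  va_vac_degree : homogeneous 0 va_vac;
  va_locality : forall a b, exists N : nat, forall (v : va_space) (p q : int),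
    iter N (@mul_x_sub_y va_space)
      (fun p q => va_mode a (- p - 1) (va_mode b (- q - 1) v)
                  - va_mode b (- q - 1) (va_mode a (- p - 1) v)) p q = 0;
  va_T_vac : va_T va_vac = 0;
  va_translation : forall a k v,
    va_T (va_mode a k v) - va_mode a k (va_T v)
    = (- k)%:~R *: va_mode a (k - 1) v;
  va_creation : forall a,
    va_mode a (- 1) va_vac = a /\
    forall k : int, 0 <= k -> va_mode a k va_vac = 0;
  va_vacuum : forall k v,
    va_mode va_vac k v = if k == - 1 then v else 0
}.

(** * Multiplication maps *)

Section Multiplication.
Variable R : realType.

Definition fat_diagonal (n : nat) : set 'rV[R[i]]_n :=
  [set z | exists i j, i != j /\ z 0 i = z 0 j].

Definition radially_ordered (n : nat) : set 'rV[R[i]]_n :=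
  [set z | forall i j : 'I_n, (i < j)%N -> `|z 0 j| < `|z 0 i|].

Variable V : vertexAlgebra R.

Definition iterated_modes (m : nat) (a : 'rV[V]_m) (k : {ffun 'I_m -> int}) : V :=
  foldr (fun i v => va_mode (a 0 i) (k i) v) (va_vac V) (enum 'I_m).

(* The last variable may vanish on [radially_ordered]; since [0 ^ j = 0] for
   negative [j], and by creation the coefficient is [0] as well, such terms
   are [0] there. *)
Definition mode_term (m : nat) (a : 'rV[V]_m) (l : int)
    (k : {ffun 'I_m -> int}) (z : 'rV[R[i]]_m) : gr_comp V l :=
  (\prod_i z 0 i ^ (- k i - 1)) *: gr_proj V l (iterated_modes a k).

(* [mu m a z] stands for [mu_Y(a_1,z_1,...,a_m,z_m)]; only its values for [z]
   off the fat diagonal are meaningful. *)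
Definition is_multiplication
    (mu : forall m : nat, 'rV[V]_m -> 'rV[R[i]]_m -> completion V) : Prop :=
  forall (m : nat) (a : 'rV[V]_m) (l : int),
    holomorphic (~` @fat_diagonal m) (fun z => mu m a z l) /\
    sums_normally_to (@radially_ordered m) (mode_term a l)
      (fun z => mu m a z l).

(* The base point [z_(m+1)] is the last entry [z 0 (rshift m 0)]. *)
Definition assoc_domain (m n : nat) : set ('rV[R[i]]_(m + 1) * 'rV[R[i]]_n) :=
  [set p | [/\ ~ fat_diagonal p.1, ~ fat_diagonal p.2
    & forall (i : 'I_n) (j : 'I_m),
        `|p.2 0 i| < `|p.1 0 (lshift 1 j) - p.1 0 (rshift m 0)| ]].

End Multiplication.
Arguments assoc_domain : clear implicits.

(* Main.v *)
(** By locality, multiplication by a high power of [prod_(i < j) (x_i - x_j)] removes all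
    negative powers of the [x_i] from [Y(a_1, x_1) ... Y(a_m, x_m) vac]. So each component of
    [mu] is a polynomial divided by a power of [prod_(i < j) (z_i - z_j)], first for radially
    ordered points and then, by an identity theorem along segments, wherever the [z_i] are
    distinct. In particular [mu] is multilinear, and a Taylor expansion gives
    [mu (a, z + c) = exp (c T) mu (a, z)], which moves the base point [z_(m+1)] to [0]. There,
    for homogeneous [b_j], the sum over [k] is the expansion in powers of the [w_j / z_i] of the
    factors [(z_i - w_j)^(-N)], and this expansion converges normally where [|w_j| < |z_i|]. *)

Require Import Defs.
From HB Require Import structures.
From mathcomp Require Import all_boot all_order all_algebra finmap.
From mathcomp Require Import complex.
From mathcomp Require Import all_classical all_reals all_analysis.
From mathcomp Require Import ring lra zify.

Set Implicit Arguments.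
Unset Strict Implicit.
Unset Printing Implicit Defensive.

Import Order.TTheory GRing.Theory Num.Theory.
Import numFieldNormedType.Exports.

Local Open Scope classical_set_scope.
Local Open Scope complex_scope.
Local Open Scope ring_scope.

(** * Complex analysis in one variable *)

Section ComplexModulus.
Variable R : realType.
Implicit Types (x y z : R[i]) (e r : R).

(** [holomorphic] gives complex differentiability at each point and says nothing about continuity of
    the derivative, so the identity theorem starts from Goursat's theorem. Cauchy's formula is then
    bypassed: a primitive has a second order expansion at every point, this property survives
    products, and it suffices for a maximum principle. The obstacle on the algebraic side is
    uniformity. The inserted vector [p_k mu (b, w)] varies with [k] and [w], and so does the
    exponent that its locality with the [a_i] requires, whereas the denominator and the finite set
    of monomials should be the same for all [k]. Both are therefore taken from the concatenated list
    [a, b]: its numerator is divided by the mixed factors [z_i - w_j] alone, degree by degree in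
    [w], and the surplus exponent caused by the inserted vector is cancelled afterwards. Homogeneity
    of the [b_j] turns [p_k] into the selection of the terms of one total degree in [w];
    multilinearity reduces the general case to this one. *)

Definition cmod (x : R[i]) : R := Normc.normc x.

Lemma normr_cmod x : `|x| = (cmod x)%:C.
Proof. by []. Qed.

Lemma cmod_ge0 x : 0 <= cmod x.
Proof. by case: x => a b; exact: sqrtr_ge0. Qed.

Lemma cmod0 : cmod 0 = 0.
Proof. exact: Normc.normc0. Qed.

Lemma cmod1 : cmod 1 = 1.
Proof. exact: Normc.normc1. Qed.

Lemma cmod_eq0 x : (cmod x == 0) = (x == 0).
Proof.
by apply/eqP/eqP => [/Normc.eq0_normc//|->]; exact: Normc.normc0.
Qed.

Lemma cmod_gt0 x : (0 < cmod x) = (x != 0).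
Proof. by rewrite lt_def cmod_ge0 andbT cmod_eq0. Qed.

Lemma cmodM x y : cmod (x * y) = cmod x * cmod y.
Proof. exact: Normc.normcM. Qed.

Lemma cmodV x : cmod x^-1 = (cmod x)^-1.
Proof. exact: Normc.normcV. Qed.

Lemma cmodX x n : cmod (x ^+ n) = cmod x ^+ n.
Proof. by elim: n => [|n IH]; rewrite ?expr0 ?cmod1// !exprS cmodM IH. Qed.

Lemma cmodN x : cmod (- x) = cmod x.
Proof. exact: normcN. Qed.

Lemma cmodD x y : cmod (x + y) <= cmod x + cmod y.
Proof. exact: le_normcD. Qed.

Lemma cmodBC x y : cmod (x - y) = cmod (y - x).
Proof. by rewrite -cmodN opprB. Qed.

Lemma cmodB x y : cmod (x - y) <= cmod x + cmod y.
Proof. by rewrite -(cmodN y) cmodD. Qed.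

Lemma cmod_dist x y z : cmod (x - z) <= cmod (x - y) + cmod (y - z).
Proof. by apply: le_trans (cmodD _ _); rewrite addrA subrK. Qed.

Lemma cmod_real r : cmod r%:C = `|r|.
Proof. by rewrite /cmod /= expr0n addr0 sqrtr_sqr. Qed.

Lemma cmod_nat n : cmod n%:R = n%:R.
Proof. by rewrite -(rmorph_nat (real_complex R)) cmod_real normr_nat. Qed.

Lemma cmod_sqr x : cmod x ^+ 2 = complex.Re x ^+ 2 + complex.Im x ^+ 2.
Proof. by case: x => a b; rewrite /cmod /= sqr_sqrtr// addr_ge0// sqr_ge0. Qed.

Lemma abs_Re_le x : `|complex.Re x| <= cmod x.
Proof.
rewrite -(ler_pXn2r (n := 2)) ?nnegrE ?cmod_ge0//.
by rewrite cmod_sqr real_normK ?num_real// lerDl sqr_ge0.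
Qed.

Lemma abs_Im_le x : `|complex.Im x| <= cmod x.
Proof.
rewrite -(ler_pXn2r (n := 2)) ?nnegrE ?cmod_ge0//.
by rewrite cmod_sqr real_normK ?num_real// lerDr sqr_ge0.
Qed.

Lemma cmod_le_ReIm x : cmod x <= `|complex.Re x| + `|complex.Im x|.
Proof.
rewrite -(ler_pXn2r (n := 2)) ?nnegrE ?cmod_ge0 ?addr_ge0//.
rewrite cmod_sqr sqrrD !real_normK ?num_real// lerD2r lerDl.
by rewrite mulrn_wge0// mulr_ge0.
Qed.

Lemma cmod_sum (I : Type) (s : seq I) (P : pred I) (F : I -> R[i]) :
  cmod (\sum_(i <- s | P i) F i) <= \sum_(i <- s | P i) cmod (F i).
Proof.
elim/big_rec2: _ => [|i x y _ h]; first by rewrite cmod0.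
by rewrite (le_trans (cmodD _ _))// lerD2l.
Qed.

Lemma lt_cmod x y : (`|x| < `|y|) = (cmod x < cmod y).
Proof. by rewrite !normr_cmod ltcR. Qed.

Lemma cmod_half x : cmod (x / 2) = cmod x / 2.
Proof. by rewrite cmodM cmodV cmod_nat. Qed.

Lemma ler_eps_mul (a b c : R) :
  (forall e, 0 < e -> a <= b + c * e) -> a <= b.
Proof.
move=> h; apply/ler_addgt0Pr => e e0.
have c0 : 0 < `|c| + 1 by rewrite ltr_wpDl.
have := h (e / (`|c| + 1)) (divr_gt0 e0 c0); move/le_trans; apply.
rewrite lerD2l mulrA ler_pdivrMr// mulrC ler_pM2l//.
by rewrite (le_trans (ler_norm c))// lerDl ler01.
Qed.

Lemma pow2_small (C e : R) : 0 < e -> exists n, C / 2 ^+ n <= e.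
Proof.
move=> e0; have /ltW hn := archi_boundP (normr_ge0 (C / e)).
exists (Num.bound `|C / e|); set N := Num.bound _ in hn *.
have hN : (N%:R : R) <= 2 ^+ N by rewrite -natrX ler_nat ltnW// ltn_expl.
rewrite ler_pdivrMr ?exprn_gt0// mulrC -ler_pdivrMr//.
exact: le_trans (ler_norm _) (le_trans hn hN).
Qed.

(** The lower limit serves as [w]: every closed interval that contains a tail of [u] contains it.
    For a Cauchy sequence it is the limit, so this is completeness in a form ready for estimates. *)
Lemma real_pseudolimit (u : nat -> R) (M : R) : (forall n, `|u n| <= M) ->
  exists w : R, forall c e n0, (forall n, (n0 <= n)%N -> `|u n - c| <= e) ->
    `|w - c| <= e.
Proof.
move=> hM; pose E := [set x : R | exists n0, forall n, (n0 <= n)%N -> x <= u n].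
have hE : has_sup E.
  split; first by exists (- M), 0%N => n _; have := hM n; rewrite ler_norml => /andP[].
  exists M => x [n0 /(_ n0 (leqnn _)) /le_trans]; apply.
  by have := hM n0; rewrite ler_norml => /andP[].
exists (sup E) => c e n0 h; rewrite ler_distl; apply/andP; split.
- apply: ub_le_sup; first by case: hE.
  by exists n0 => n /h; rewrite ler_distl => /andP[].
- apply: ge_sup; first by case: hE.
  move=> x [n1 hx].
  apply: le_trans (hx (maxn n0 n1) (leq_maxr _ _)) _.
  by have := h _ (leq_maxl n0 n1); rewrite ler_distl => /andP[].
Qed.

(** The factor 2 is the price of treating real and imaginary parts separately. *)
Lemma pseudolimit (u : nat -> R[i]) (M : R) : (forall n, cmod (u n) <= M) ->
  exists w : R[i], forall c e n0,
    (forall n, (n0 <= n)%N -> cmod (u n - c) <= e) -> cmod (w - c) <= e *+ 2.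
Proof.
move=> hM.
have [a ha] := @real_pseudolimit (fun n => complex.Re (u n)) M
  (fun n => le_trans (abs_Re_le _) (hM n)).
have [b hb] := @real_pseudolimit (fun n => complex.Im (u n)) M
  (fun n => le_trans (abs_Im_le _) (hM n)).
exists (a +i* b) => c e n0 h; apply: le_trans (cmod_le_ReIm _) _.
rewrite mulr2n lerD//=.
- case: c h => c1 c2 h; apply: (ha _ _ n0) => n /h.
  by apply: le_trans; case: (u n) => u1 u2; exact: (abs_Re_le ((u1 +i* u2) - (c1 +i* c2))).
- case: c h => c1 c2 h; apply: (hb _ _ n0) => n /h.
  by apply: le_trans; case: (u n) => u1 u2; exact: (abs_Im_le ((u1 +i* u2) - (c1 +i* c2))).
Qed.

(* A sequence with steps at most [C / 2 ^ n], as produced by bisection. *)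
Lemma bisection_limit (u : nat -> R[i]) (C : R) :
  (forall n, cmod (u n.+1 - u n) <= C / 2 ^+ n) ->
  exists w, forall n, cmod (w - u n) <= 4 * C / 2 ^+ n.
Proof.
move=> h; have C0 : 0 <= C by have := h 0%N; rewrite expr0 divr1; apply: le_trans (cmod_ge0 _).
have hk k n : cmod (u (n + k)%N - u n) <= 2 * C / 2 ^+ n - 2 * C / 2 ^+ (n + k).
  elim: k => [|k IH]; first by rewrite addn0 !subrr cmod0.
  rewrite addnS; apply: le_trans (cmod_dist _ (u (n + k)%N) _) _.
  apply: le_trans (lerD (h _) IH) _; rewrite exprS.
  have e0 : (2 : R) ^+ (n + k) != 0 by rewrite expf_neq0.
  have -> : 2 * C / (2 * 2 ^+ (n + k)) = C / 2 ^+ (n + k) by field.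
  by lra.
have hk' n m : (n <= m)%N -> cmod (u m - u n) <= 2 * C / 2 ^+ n.
  move=> nm; rewrite -(subnKC nm); apply: le_trans (hk _ _) _.
  by rewrite gerBl divr_ge0 ?mulr_ge0 ?exprn_ge0.
have [|w hw] := @pseudolimit u (cmod (u 0%N) + 2 * C).
  move=> n; have := hk' 0%N n isT; rewrite expr0 divr1 => hn.
  by rewrite -[u n](subrK (u 0%N)) addrC (le_trans (cmodD _ _))// lerD2l.
exists w => n; rewrite (le_trans (hw _ _ n (hk' n)))// le_eqVlt; apply/orP; left.
by apply/eqP; ring.
Qed.

End ComplexModulus.

(** * Integration along segments by the dyadic midpoint rule *)

Section DyadicIntegral.
Variable R : realType.
Implicit Types (a b c z w : R[i]) (f : R[i] -> R[i]) (e r M : R).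

Definition cder f z (d : R[i]) : Prop := forall e : R, 0 < e ->
  exists2 r : R, 0 < r & forall h, cmod h < r ->
    cmod (f (z + h) - f z - d * h) <= e * cmod h.

(** The midpoint rule with [2^n] equal pieces. Recursion by halving makes additivity at the midpoint
    of a segment hold by definition, which is the only subdivision that Goursat's argument uses. *)
Fixpoint midsum (n : nat) f a b : R[i] :=
  if n is n'.+1 then midsum n' f a ((a + b) / 2) + midsum n' f ((a + b) / 2) b
  else f ((a + b) / 2) * (b - a).

Lemma midsum_rev n f a b : midsum n f b a = - midsum n f a b.
Proof.
elim: n a b => [|n IH] a b /=; first by rewrite (addrC b) -mulrN opprB.
by rewrite (addrC b) (IH a) (IH _ b) opprD [LHS]addrC.
Qed.

Lemma ball_mid c r a b : cmod (a - c) <= r -> cmod (b - c) <= r ->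
  cmod ((a + b) / 2 - c) <= r.
Proof.
move=> ha hb; have -> : (a + b) / 2 - c = (a - c) / 2 + (b - c) / 2 by field.
by apply: le_trans (cmodD _ _) _; rewrite !cmod_half; lra.
Qed.

(* The midpoint rule is exact on affine functions. *)
Lemma midsum_near_affine n f a b c r (p q : R[i]) M :
  cmod (a - c) <= r -> cmod (b - c) <= r ->
  (forall z, cmod (z - c) <= r -> cmod (f z - (p + q * z)) <= M) ->
  cmod (midsum n f a b - (p * (b - a) + q * (b ^+ 2 - a ^+ 2) / 2))
    <= M * cmod (b - a).
Proof.
move=> ha hb hf; elim: n a b ha hb => [|n IH] a b ha hb /=.
  have -> : f ((a + b) / 2) * (b - a) - (p * (b - a) + q * (b ^+ 2 - a ^+ 2) / 2)
     = (f ((a + b) / 2) - (p + q * ((a + b) / 2))) * (b - a) by field.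
  by rewrite cmodM ler_wpM2r ?cmod_ge0// hf// ball_mid.
set m := (a + b) / 2; have hm : cmod (m - c) <= r by exact: ball_mid.
have -> : midsum n f a m + midsum n f m b
       - (p * (b - a) + q * (b ^+ 2 - a ^+ 2) / 2)
  = (midsum n f a m - (p * (m - a) + q * (m ^+ 2 - a ^+ 2) / 2))
    + (midsum n f m b - (p * (b - m) + q * (b ^+ 2 - m ^+ 2) / 2)) by field.
apply: le_trans (cmodD _ _) _; apply: le_trans (lerD (IH _ _ ha hm) (IH _ _ hm hb)) _.
have -> : m - a = (b - a) / 2 by rewrite /m; field.
have -> : b - m = (b - a) / 2 by rewrite /m; field.
by rewrite cmod_half -mulrDr -splitr.
Qed.

Lemma midsum_near_cst n f a b c r (p : R[i]) M :
  cmod (a - c) <= r -> cmod (b - c) <= r ->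
  (forall z, cmod (z - c) <= r -> cmod (f z - p) <= M) ->
  cmod (midsum n f a b - p * (b - a)) <= M * cmod (b - a).
Proof.
move=> ha hb hf.
have := @midsum_near_affine n f a b c r p 0 M ha hb; rewrite !mul0r addr0; apply.
by move=> z; rewrite mul0r addr0; exact: hf.
Qed.

(** A Cauchy condition with error proportional to the length of the segment, so that it passes from
    the two halves to the whole without loss. *)
Definition mid_good f e (s : R[i] * R[i]) : Prop := exists n0, forall n m,
  (n0 <= n)%N -> (n0 <= m)%N ->
  cmod (midsum n f s.1 s.2 - midsum m f s.1 s.2) <= e * cmod (s.2 - s.1).

Lemma mid_good_split f e a b : mid_good f e (a, (a + b) / 2) ->
  mid_good f e ((a + b) / 2, b) -> mid_good f e (a, b).
Proof.
move=> [n1 h1] [n2 h2]; exists (maxn n1 n2).+1 => -[//|n] [//|m].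
rewrite !ltnS !geq_max => /andP[n1n n2n] /andP[n1m n2m] /=.
rewrite opprD addrACA; apply: le_trans (cmodD _ _) _.
apply: le_trans (lerD (h1 _ _ n1n n1m) (h2 _ _ n2n n2m)) _ => /=.
have -> : (a + b) / 2 - a = (b - a) / 2 by field.
have -> : b - (a + b) / 2 = (b - a) / 2 by field.
by rewrite cmod_half -mulrDr -splitr.
Qed.

Definition contin f z : Prop := forall e, 0 < e ->
  exists2 r, 0 < r & forall h, cmod h < r -> cmod (f (z + h) - f z) <= e.

Lemma cder_contin f z d : cder f z d -> contin f z.
Proof.
move=> hd e e0; have [r r0 hr] := hd 1 ltr01.
have D0 : 0 < 1 + cmod d by rewrite ltr_pwDl// cmod_ge0.
exists (Num.min r (e / (1 + cmod d))); first by rewrite lt_min r0 divr_gt0.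
move=> h; rewrite lt_min => /andP[h1 h2].
rewrite -[_ - f z](subrK (d * h)); apply: le_trans (cmodD _ _) _.
apply: le_trans (lerD (hr _ h1) (lexx _)) _.
by rewrite cmodM -mulrDl mulrC -ler_pdivlMr// ltW.
Qed.

(** Bisection replaces uniform continuity: a bad segment has a bad half, and the bad halves shrink
    to a point [w]. Near [w] continuity keeps [f] within [e / 2] of [f w], which makes small
    segments good. *)
Lemma mid_good_contin f c r e a b : 0 < e ->
  (forall z, cmod (z - c) <= r -> contin f z) ->
  cmod (a - c) <= r -> cmod (b - c) <= r -> mid_good f e (a, b).
Proof.
move=> e0 hf ha hb; apply: contrapT => bad.
pose step (s : R[i] * R[i]) := let m := (s.1 + s.2) / 2 in
  if `[< mid_good f e (s.1, m) >] then (m, s.2) else (s.1, m).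
pose u n := iter n step (a, b).
have hu n : ~ mid_good f e (u n) /\ cmod ((u n).1 - c) <= r /\
   cmod ((u n).2 - c) <= r /\ cmod ((u n).2 - (u n).1) <= cmod (b - a) / 2 ^+ n.
  elim: n => [|n [IH1 [IH2 [IH3 IH4]]]]; first by rewrite expr0 divr1.
  rewrite /u iterS -/(u n); case: (u n) IH1 IH2 IH3 IH4 => x y /= h1 h2 h3 h4.
  have hm := ball_mid h2 h3.
  have e2 : cmod (b - a) / 2 ^+ n / 2 = cmod (b - a) / 2 ^+ n.+1.
    by rewrite exprS; field; rewrite expf_neq0.
  rewrite /step /=; case: asboolP => h5 /=; repeat split => //.
  - by move=> h6; apply: h1; apply: mid_good_split.
  - have -> : y - (x + y) / 2 = (y - x) / 2 by field.
    by rewrite cmod_half -e2 ler_pM2r.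
  - have -> : (x + y) / 2 - x = (y - x) / 2 by field.
    by rewrite cmod_half -e2 ler_pM2r.
have [|w hw] := @bisection_limit R (fun n => (u n).1) (cmod (b - a)).
  move=> n; have [_ [_ [_ h4]]] := hu n.
  apply: (le_trans _ h4); rewrite /u iterS -/(u n); case: (u n) => x y /=.
  rewrite /step /=; case: asboolP => _ /=; last by rewrite subrr cmod0 cmod_ge0.
  have -> : (x + y) / 2 - x = (y - x) / 2 by field.
  by rewrite cmod_half ler_pdivrMr// ler_peMr ?cmod_ge0// ler1n.
have hwr : cmod (w - c) <= r.
  apply/ler_addgt0Pr => d d0.
  have [n hn] := pow2_small (4 * cmod (b - a)) d0.
  have [_ [h2 _]] := hu n.
  apply: le_trans (cmod_dist _ (u n).1 _) _; rewrite addrC lerD//.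
  exact: le_trans (hw n) hn.
have [d d0 hd] := hf w hwr _ (divr_gt0 e0 (ltr0Sn R 1)).
have d20 : 0 < d / 2 by lra.
(* [5 = 4 + 1]: the left end is within [4 |b - a| / 2^n] of [w], and the segment has length at most
   [|b - a| / 2^n]. *)
have [n hn] := pow2_small (5 * cmod (b - a)) d20.
have [h1 [h2 [h3 h4]]] := hu n.
apply: h1; exists 0%N => k m _ _.
have hB : forall z, cmod (z - w) <= d / 2 -> cmod (f z - f w) <= e / 2.
  by move=> z hz; rewrite -[in f z](subrKC w z); apply: hd; lra.
have c0 : 0 <= cmod (b - a) / 2 ^+ n by rewrite divr_ge0 ?cmod_ge0 ?exprn_ge0.
have hn5 : 5 * (cmod (b - a) / 2 ^+ n) <= d / 2 by rewrite mulrA.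
have hwn : cmod ((u n).1 - w) <= 4 * (cmod (b - a) / 2 ^+ n).
  by rewrite cmodBC mulrA; exact: hw.
have hA1 : cmod ((u n).1 - w) <= d / 2 by lra.
have hA2 : cmod ((u n).2 - w) <= d / 2.
  by apply: le_trans (cmod_dist _ (u n).1 _) _; lra.
have hk := midsum_near_cst k hA1 hA2 hB.
have hm := midsum_near_cst m hA1 hA2 hB.
apply: le_trans (cmod_dist _ (f w * ((u n).2 - (u n).1)) _) _.
rewrite [X in _ + X]cmodBC; apply: le_trans (lerD hk hm) _.
by rewrite -mulrDl -splitr.
Qed.

Definition is_cint f a b w : Prop := forall e, 0 < e ->
  exists n0, forall n, (n0 <= n)%N -> cmod (midsum n f a b - w) <= e.

Lemma is_cint_exists f c r a b :
  (forall z, cmod (z - c) <= r -> contin f z) ->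
  cmod (a - c) <= r -> cmod (b - c) <= r -> exists w, is_cint f a b w.
Proof.
move=> hf ha hb.
have hgood e : 0 < e -> mid_good f e (a, b) by move=> e0; apply: mid_good_contin hf ha hb.
have [N hN] := hgood 1 ltr01.
have [|w hw] := @pseudolimit R (fun n => midsum (N + n) f a b)
   (cmod (b - a) + cmod (midsum N f a b)).
  move=> n; rewrite -[midsum (N + n) f a b](subrK (midsum N f a b)).
  apply: le_trans (cmodD _ _) _; rewrite lerD2r.
  by have := hN _ _ (leq_addr n N) (leqnn N); rewrite mul1r.
exists w => e e0.
have D0 : 0 < 1 + 3 * cmod (b - a) by rewrite ltr_pwDl// mulr_ge0 ?cmod_ge0.
have [n0 hn0] := hgood _ (divr_gt0 e0 D0).
set d := e / _ in hn0.
have d0 : 0 < d by rewrite divr_gt0.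
have dE : d * (1 + 3 * cmod (b - a)) = e by rewrite mulfVK// gt_eqF.
exists n0 => n hn.
have := hw (midsum n f a b) _ n0 (fun k hk => hn0 _ _ (leq_trans hk (leq_addl _ _)) hn).
rewrite cmodBC => /le_trans; apply => /=; rewrite mulr2n.
have := mulr_ge0 (ltW d0) (cmod_ge0 (b - a)).
by rewrite -dE mulrDr mulr1 mulrCA => ?; lra.
Qed.

Lemma is_cint_unique f a b w w' : is_cint f a b w -> is_cint f a b w' -> w = w'.
Proof.
move=> h h'; apply/eqP; rewrite -subr_eq0 -cmod_eq0 eq_le cmod_ge0 andbT.
apply: (@ler_eps_mul _ _ _ 2) => e e0; rewrite add0r.
have [n hn] := h e e0; have [m hm] := h' e e0.
have h1 := hn _ (leq_maxl n m); have h2 := hm _ (leq_maxr n m).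
apply: le_trans (cmod_dist _ (midsum (maxn n m) f a b) _) _.
by rewrite cmodBC; apply: le_trans (lerD h1 h2) _; rewrite mulr_natl mulr2n.
Qed.

Lemma is_cint_rev f a b w : is_cint f a b w -> is_cint f b a (- w).
Proof.
move=> h e /h[n hn]; exists n => m /hn.
by rewrite (midsum_rev _ _ a b) -opprD cmodN.
Qed.

Lemma is_cint_split f a b w1 w2 : is_cint f a ((a + b) / 2) w1 ->
  is_cint f ((a + b) / 2) b w2 -> is_cint f a b (w1 + w2).
Proof.
move=> h1 h2 e e0; have e20 : 0 < e / 2 by lra.
have [n hn] := h1 _ e20; have [m hm] := h2 _ e20.
exists (maxn n m).+1 => -[//|k]; rewrite ltnS geq_max => /andP[nk mk] /=.
rewrite opprD addrACA; apply: le_trans (cmodD _ _) _.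
by apply: le_trans (lerD (hn _ nk) (hm _ mk)) _; rewrite -splitr.
Qed.

Lemma is_cint_near_affine f a b w c r (p q : R[i]) M :
  is_cint f a b w ->
  cmod (a - c) <= r -> cmod (b - c) <= r ->
  (forall z, cmod (z - c) <= r -> cmod (f z - (p + q * z)) <= M) ->
  cmod (w - (p * (b - a) + q * (b ^+ 2 - a ^+ 2) / 2)) <= M * cmod (b - a).
Proof.
move=> hw ha hb hf; apply/ler_addgt0Pl => e /hw[n /(_ n (leqnn n)) hn].
apply: le_trans (cmod_dist _ (midsum n f a b) _) _; rewrite cmodBC lerD//.
exact: midsum_near_affine ha hb hf.
Qed.

End DyadicIntegral.

(** * Goursat's theorem, primitives and second order expansions *)

Section Primitive.
Variable R : realType.
Implicit Types (a b c s z w : R[i]) (f g : R[i] -> R[i]) (e r M : R).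

Definition cint f a b : R[i] := xget 0 [set w | is_cint f a b w].

Definition cder_on_ball f s r : Prop :=
  forall z, cmod (z - s) <= r -> exists d, cder f z d.

Lemma cder_on_ball_contin f s r : cder_on_ball f s r ->
  forall z, cmod (z - s) <= r -> contin f z.
Proof. by move=> hf z /hf[d]; exact: cder_contin. Qed.

Lemma cintP f s r a b : cder_on_ball f s r ->
  cmod (a - s) <= r -> cmod (b - s) <= r -> is_cint f a b (cint f a b).
Proof.
move=> hf ha hb; rewrite /cint; case: xgetP => [y _ //|h].
by have [w hw] := is_cint_exists (cder_on_ball_contin hf) ha hb; have := h w.
Qed.

Lemma cint_rev f s r a b : cder_on_ball f s r ->
  cmod (a - s) <= r -> cmod (b - s) <= r -> cint f b a = - cint f a b.
Proof.
move=> hf ha hb; apply: is_cint_unique (cintP hf hb ha) _.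
exact: is_cint_rev (cintP hf ha hb).
Qed.

Lemma cint_split f s r a b : cder_on_ball f s r ->
  cmod (a - s) <= r -> cmod (b - s) <= r ->
  cint f a b = cint f a ((a + b) / 2) + cint f ((a + b) / 2) b.
Proof.
move=> hf ha hb; have hm := ball_mid ha hb.
apply: is_cint_unique (cintP hf ha hb) _.
exact: is_cint_split (cintP hf ha hm) (cintP hf hm hb).
Qed.

Lemma four_max (x1 x2 x3 x4 x : R[i]) : x = x1 + x2 + x3 + x4 ->
  [\/ cmod x <= 4 * cmod x1, cmod x <= 4 * cmod x2,
      cmod x <= 4 * cmod x3 | cmod x <= 4 * cmod x4].
Proof.
move=> ->; have h : cmod (x1 + x2 + x3 + x4) <= cmod x1 + cmod x2 + cmod x3 + cmod x4.
  by do 2! (apply: le_trans (cmodD _ _) _; rewrite lerD2r); exact: cmodD.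
case: (lerP (cmod (x1 + x2 + x3 + x4)) (4 * cmod x1)) => h1; first exact: Or41.
case: (lerP (cmod (x1 + x2 + x3 + x4)) (4 * cmod x2)) => h2; first exact: Or42.
case: (lerP (cmod (x1 + x2 + x3 + x4)) (4 * cmod x3)) => h3; first exact: Or43.
by apply: Or44; lra.
Qed.

(** One of four subtriangles keeps at least a quarter of the integral, while near the limit point
    [w] the function is affine up to [o(q)] on triangles of size [q]. The midpoint rule is exact on
    affine functions, and their integrals cancel around a triangle. *)
Lemma goursat f s r a b c : cder_on_ball f s r ->
  cmod (a - s) <= r -> cmod (b - s) <= r -> cmod (c - s) <= r ->
  cint f a b + cint f b c + cint f c a = 0.
Proof.
move=> hf ha hb hc.
pose T (t : R[i] * R[i] * R[i]) := cint f t.1.1 t.1.2 + cint f t.1.2 t.2 + cint f t.2 t.1.1.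
pose t1 (t : R[i] * R[i] * R[i]) := (t.1.1, (t.1.1 + t.1.2) / 2, (t.2 + t.1.1) / 2).
pose t2 (t : R[i] * R[i] * R[i]) := ((t.1.1 + t.1.2) / 2, t.1.2, (t.1.2 + t.2) / 2).
pose t3 (t : R[i] * R[i] * R[i]) := ((t.2 + t.1.1) / 2, (t.1.2 + t.2) / 2, t.2).
pose t4 (t : R[i] * R[i] * R[i]) :=
  ((t.1.1 + t.1.2) / 2, (t.1.2 + t.2) / 2, (t.2 + t.1.1) / 2).
pose inb (t : R[i] * R[i] * R[i]) :=
  [/\ cmod (t.1.1 - s) <= r, cmod (t.1.2 - s) <= r & cmod (t.2 - s) <= r].
have Tsplit t : inb t -> T t = T (t1 t) + T (t2 t) + T (t3 t) + T (t4 t).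
  case: t => [[x y] z] [/= hx hy hz]; rewrite /T /=.
  have hxy := ball_mid hx hy; have hyz := ball_mid hy hz; have hzx := ball_mid hz hx.
  rewrite (cint_split hf hx hy) (cint_split hf hy hz) (cint_split hf hz hx).
  rewrite (cint_rev hf hxy hyz) (cint_rev hf hyz hzx) (cint_rev hf hzx hxy).
  ring.
pose step t := if cmod (T t) <= 4 * cmod (T (t1 t)) then t1 t
  else if cmod (T t) <= 4 * cmod (T (t2 t)) then t2 t
  else if cmod (T t) <= 4 * cmod (T (t3 t)) then t3 t else t4 t.
have stepP t : inb t -> cmod (T t) <= 4 * cmod (T (step t)).
  move=> /Tsplit/four_max; rewrite /step.
  by case: ifP => // _; case: ifP => // _; case: ifP => // _ [].
have step_in t : inb t -> inb (step t).
  move=> [h1 h2 h3]; rewrite /step.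
  have := ball_mid h1 h2; have := ball_mid h2 h3; have := ball_mid h3 h1.
  by case: ifP => // _; last case: ifP => // _; last case: ifP.
pose small (L : R) (t : R[i] * R[i] * R[i]) :=
  [/\ cmod (t.1.2 - t.1.1) <= L, cmod (t.2 - t.1.2) <= L & cmod (t.1.1 - t.2) <= L].
have step_small L t : small L t -> small (L / 2) (step t).
  case: t => [[x y] z] [/= h1 h2 h3].
  have half u v q : cmod (u - v) <= L -> q = (u - v) / 2 -> cmod q <= L / 2.
    by move=> ? ->; rewrite cmod_half ler_pM2r.
  have halfN u v q : cmod (u - v) <= L -> q = (v - u) / 2 -> cmod q <= L / 2.
    by rewrite cmodBC; exact: half.
  rewrite /step; case: ifP => _; last case: ifP => _; last case: ifP => _;
    split => /=;
    do [ by apply: half h1 _; field | by apply: half h2 _; field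
       | by apply: half h3 _; field | by apply: halfN h1 _; field
       | by apply: halfN h2 _; field | by apply: halfN h3 _; field ].
pose L := cmod (b - a) + cmod (c - b) + cmod (a - c).
have L0 : 0 <= L by rewrite !addr_ge0 ?cmod_ge0.
pose u n := iter n step (a, b, c).
have hu n : [/\ inb (u n), small (L / 2 ^+ n) (u n) &
    cmod (T (a, b, c)) <= 4 ^+ n * cmod (T (u n))].
  elim: n => [|n [IH1 IH2 IH3]].
    split; [by [] | | by rewrite mul1r].
    rewrite expr0 divr1; have := cmod_ge0 (b - a); have := cmod_ge0 (c - b).
    by have := cmod_ge0 (a - c); rewrite /small /L; split => /=; lra.
  rewrite /u iterS -/(u n); split; first exact: step_in.
  - have -> : L / 2 ^+ n.+1 = L / 2 ^+ n / 2.
      by rewrite exprS; field; rewrite expf_neq0.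
    exact: step_small.
  - apply: (le_trans IH3); rewrite exprSr -mulrA ler_wpM2l ?exprn_ge0//.
    exact: stepP.
have [|w hw] := @bisection_limit R (fun n => (u n).1.1) L.
  move=> n; have [_ [h1 h2 h3] _] := hu n.
  have L2 : 0 <= L / 2 ^+ n by rewrite divr_ge0 ?exprn_ge0.
  rewrite /u iterS -/(u n); case: (u n) h1 h2 h3 => [[x y] z] /= h1 h2 h3.
  rewrite /step /=; case: ifP => _; last case: ifP => _; last case: ifP => _ /=.
  - by rewrite subrr cmod0.
  - have -> : (x + y) / 2 - x = (y - x) / 2 by field.
    by rewrite cmod_half; lra.
  - have -> : (z + x) / 2 - x = - ((x - z) / 2) by field.
    by rewrite cmodN cmod_half; lra.
  - have -> : (x + y) / 2 - x = (y - x) / 2 by field.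
    by rewrite cmod_half; lra.
have hwr : cmod (w - s) <= r.
  apply/ler_addgt0Pr => d d0.
  have [n hn] := pow2_small (4 * L) d0.
  have [[h2 _ _] _ _] := hu n.
  apply: le_trans (cmod_dist _ (u n).1.1 _) _; rewrite addrC lerD//.
  exact: le_trans (hw n) hn.
have [d hd] := hf _ hwr.
suff T0 : cmod (T (a, b, c)) <= 0.
  by apply/eqP; rewrite -cmod_eq0 eq_le cmod_ge0 T0.
(* [15 = 3 * 5]: each of the three sides has length at most [q = L / 2^n] and stays within [5 q] of
   [w], where [f] is affine up to [5 e q]. The factor [4^n] turns [q^2] into [L^2]. *)
apply: (@ler_eps_mul _ _ _ (15 * L ^+ 2)) => e e0; rewrite add0r.
have [dl dl0 hdl] := hd _ e0.
have dl20 : 0 < dl / 2 by lra.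
have [n hn] := pow2_small (5 * L) dl20.
have [[i1 i2 i3] [s1 s2 s3] hT] := hu n.
have q0 : 0 <= L / 2 ^+ n by rewrite divr_ge0 ?exprn_ge0.
set q := L / 2 ^+ n in s1 s2 s3 q0.
have hn5 : 5 * q <= dl / 2 by rewrite mulrA.
have hA : cmod ((u n).1.1 - w) <= 5 * q.
  by rewrite cmodBC; apply: le_trans (hw n) _; rewrite -mulrA -/q; lra.
have hB : cmod ((u n).1.2 - w) <= 5 * q.
  apply: le_trans (cmod_dist _ (u n).1.1 _) _; rewrite (cmodBC _ w).
  by have := hw n; rewrite -mulrA -/q; lra.
have hC : cmod ((u n).2 - w) <= 5 * q.
  apply: le_trans (cmod_dist _ (u n).1.1 _) _; rewrite (cmodBC _ w) (cmodBC (u n).2).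
  by have := hw n; rewrite -mulrA -/q; lra.
have hM z : cmod (z - w) <= 5 * q -> cmod (f z - ((f w - d * w) + d * z)) <= e * (5 * q).
  move=> hz; have -> : f z - ((f w - d * w) + d * z) = f (w + (z - w)) - f w - d * (z - w).
    by rewrite subrKC; ring.
  by apply: le_trans (hdl _ _) _; [lra | rewrite ler_wpM2l// ltW].
have I1 := is_cint_near_affine (cintP hf i1 i2) hA hB hM.
have I2 := is_cint_near_affine (cintP hf i2 i3) hB hC hM.
have I3 := is_cint_near_affine (cintP hf i3 i1) hC hA hM.
have hTn : cmod (T (u n)) <= 3 * (e * (5 * q)) * q.
  have e5 : 0 <= e * (5 * q) by rewrite mulr_ge0 ?mulr_ge0// ltW.
  rewrite /T; set J1 := cint _ _ _ in I1 *; set J2 := cint _ _ _ in I2 *.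
  set J3 := cint _ _ _ in I3 *.
  set A1 := (X in J1 - X) in I1; set A2 := (X in J2 - X) in I2; set A3 := (X in J3 - X) in I3.
  have -> : J1 + J2 + J3 = (J1 - A1) + (J2 - A2) + (J3 - A3).
    by rewrite /A1 /A2 /A3; field.
  apply: le_trans (cmodD _ _) _; apply: le_trans (lerD (cmodD _ _) (lexx _)) _.
  have := ler_wpM2l e5 s1; have := ler_wpM2l e5 s2; have := ler_wpM2l e5 s3.
  by lra.
apply: (le_trans hT); apply: le_trans (ler_wpM2l (exprn_ge0 n _) hTn) _ => //.
have -> : 4 ^+ n = 2 ^+ n * 2 ^+ n :> R by rewrite -exprMn -natrM.
by rewrite le_eqVlt; apply/orP; left; apply/eqP; rewrite /q; field; rewrite expf_neq0.
Qed.

Lemma cint_triangle f s r a b c : cder_on_ball f s r ->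
  cmod (a - s) <= r -> cmod (b - s) <= r -> cmod (c - s) <= r ->
  cint f a c - cint f a b = cint f b c.
Proof.
move=> hf ha hb hc; have := goursat hf ha hb hc.
by rewrite (cint_rev hf ha hc) => /eqP; rewrite subr_eq0 => /eqP <-; ring.
Qed.

Lemma cint_near_affine f s r a b c r' (p q : R[i]) M : cder_on_ball f s r ->
  cmod (a - s) <= r -> cmod (b - s) <= r ->
  cmod (a - c) <= r' -> cmod (b - c) <= r' ->
  (forall z, cmod (z - c) <= r' -> cmod (f z - (p + q * z)) <= M) ->
  cmod (cint f a b - (p * (b - a) + q * (b ^+ 2 - a ^+ 2) / 2)) <= M * cmod (b - a).
Proof. by move=> hf ha hb; exact: is_cint_near_affine (cintP hf ha hb). Qed.

(** Weaker than being twice differentiable, and enough for the maximum principle. A primitive of a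
    merely differentiable function has such an expansion, so regularity of derivatives never has to
    be discussed. *)
Definition peano2 g z : Prop := exists c1 c2, forall e, 0 < e ->
  exists2 d, 0 < d & forall h, cmod h < d ->
    cmod (g (z + h) - (g z + c1 * h + c2 * h ^+ 2)) <= e * cmod h ^+ 2.

(** The first order expansion of [f] at [z] is integrated from [z] to [z + h]; path independence
    identifies this integral with the increment of the primitive. *)
Lemma primitive_peano2 f s r z : cder_on_ball f s r -> cmod (z - s) < r ->
  peano2 (cint f s) z.
Proof.
move=> hf hz; have [d hd] := hf z (ltW hz).
exists (f z), (d / 2) => e e0; have [dl dl0 hdl] := hd e e0.
exists (Num.min dl (r - cmod (z - s))); first by rewrite lt_min dl0 subr_gt0.
move=> h; rewrite lt_min => /andP[h1 h2].
have hs : cmod (s - s) <= r by rewrite subrr cmod0 (le_trans (cmod_ge0 _) (ltW hz)).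
have hzh : cmod (z + h - s) <= r.
  by rewrite addrAC (le_trans (cmodD _ _))//; lra.
have -> : cint f s (z + h) - (cint f s z + f z * h + d / 2 * h ^+ 2)
   = cint f z (z + h) - ((f z - d * z) * (z + h - z)
        + d * ((z + h) ^+ 2 - z ^+ 2) / 2).
  by rewrite -(cint_triangle hf hs (ltW hz) hzh); field.
have hzz : cmod (z - z) <= cmod h by rewrite subrr cmod0 cmod_ge0.
have hzhz : cmod (z + h - z) <= cmod h by rewrite addrC addKr.
apply: le_trans (cint_near_affine (M := e * cmod h) hf (ltW hz) hzh hzz hzhz _) _.
  move=> y hy.
  have -> : f y - ((f z - d * z) + d * y) = f (z + (y - z)) - f z - d * (y - z).
    by rewrite subrKC; ring.
  apply: le_trans (hdl _ _) _; first exact: le_lt_trans hy h1.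
  by rewrite ler_wpM2l// ltW.
by rewrite expr2 mulrA [z + h]addrC addrK.
Qed.

Lemma peano2_contin g z : peano2 g z -> contin g z.
Proof.
move=> [c1 [c2 hg]] e e0; have [d d0 hd] := hg 1 ltr01.
have D0 : 0 < 1 + cmod c1 + cmod c2.
  by rewrite -addrA ltr_pwDl// addr_ge0 ?cmod_ge0.
exists (Num.min (Num.min d 1) (e / (1 + cmod c1 + cmod c2))).
  by rewrite !lt_min d0 ltr01 divr_gt0.
move=> h; rewrite 2!lt_min => /andP[/andP[h1 h2] h3].
have -> : g (z + h) - g z = (g (z + h) - (g z + c1 * h + c2 * h ^+ 2)) + c1 * h + c2 * h ^+ 2.
  by ring.
apply: le_trans (cmodD _ _) _; apply: le_trans (lerD (cmodD _ _) (lexx _)) _.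
apply: le_trans (lerD (lerD (hd _ h1) (lexx _)) (lexx _)) _.
rewrite !cmodM -?expr2 mul1r; move: h3; rewrite ltr_pdivlMr// => h3.
have hx : cmod h ^+ 2 <= cmod h by rewrite expr2 ler_piMl ?cmod_ge0// ltW.
have := ler_wpM2l (cmod_ge0 c2) hx; lra.
Qed.

Lemma peano2M g1 g2 z : peano2 g1 z -> peano2 g2 z -> peano2 (fun x => g1 x * g2 x) z.
Proof.
move=> [c1 [c2 hg]] [k1 [k2 hk]].
exists (g1 z * k1 + c1 * g2 z), (g1 z * k2 + c1 * k1 + c2 * g2 z) => e e0.
(* [P1] and [P2] bound the two quadratic polynomials for [|h| <= 1]; [A] bounds the coefficients of
   degree 3 and 4 in their product. *)
pose P1 := cmod (g1 z) + cmod c1 + cmod c2; pose P2 := cmod (g2 z) + cmod k1 + cmod k2.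
pose A := cmod (c1 * k2 + c2 * k1) + cmod (c2 * k2).
have P10 : 0 <= P1 by rewrite /P1 !addr_ge0 ?cmod_ge0.
have P20 : 0 <= P2 by rewrite /P2 !addr_ge0 ?cmod_ge0.
have A0 : 0 <= A by rewrite /A !addr_ge0 ?cmod_ge0.
have D0 : 0 < A + P1 + P2 + 1 by rewrite ltr_wpDl// !addr_ge0 ?cmod_ge0.
pose t := Num.min 1 (e / (A + P1 + P2 + 1)).
have t0 : 0 < t by rewrite lt_min ltr01 divr_gt0.
have t1 : t <= 1 by rewrite ge_min lexx.
have te : t * (A + P1 + P2 + 1) <= e by rewrite -ler_pdivlMr// ge_min lexx orbT.
have [d d0 hd] := hg t t0; have [d' d'0 hd'] := hk t t0.
exists (Num.min (Num.min d d') t); first by rewrite 2!lt_min d0 d'0 t0.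
move=> h; rewrite 2!lt_min => /andP[/andP[h1 h2] h3].
have {hd h1} := hd h h1; have {hd' h2} := hd' h h2.
set r1 := g1 _ - _; set r2 := g2 _ - _ => R2 R1.
have -> : g1 (z + h) * g2 (z + h) - (g1 z * g2 z + (g1 z * k1 + c1 * g2 z) * h +
   (g1 z * k2 + c1 * k1 + c2 * g2 z) * h ^+ 2) =
   ((c1 * k2 + c2 * k1) + (c2 * k2) * h) * h * h ^+ 2
   + (g1 z + c1 * h + c2 * h ^+ 2) * r2 + r1 * (g2 z + k1 * h + k2 * h ^+ 2) + r1 * r2.
  by rewrite /r1 /r2; ring.
have hh0 := cmod_ge0 h.
have hl1 : cmod h <= 1 by lra.
have poly (x y w : R[i]) : cmod (x + y * h + w * h ^+ 2) <= cmod x + cmod y + cmod w.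
  apply: le_trans (cmodD _ _) _; apply: le_trans (lerD (cmodD _ _) (lexx _)) _.
  rewrite !cmodM -?expr2 !lerD// ler_piMr ?cmod_ge0//.
  by rewrite expr_le1.
have hlin : cmod (c1 * k2 + c2 * k1 + c2 * k2 * h) <= A.
  apply: le_trans (cmodD _ _) _; rewrite lerD2l cmodM ler_piMr ?cmod_ge0//.
set H := cmod h ^+ 2 in R1 R2 *.
have H0 : 0 <= H by rewrite exprn_ge0.
have H1 : H <= 1 by rewrite expr_le1.
have b1 : cmod ((c1 * k2 + c2 * k1 + c2 * k2 * h) * h * h ^+ 2) <= A * t * H.
  by rewrite !cmodM -?expr2 -/H ler_wpM2r// ler_pM ?cmod_ge0// ltW.
have b2 : cmod ((g1 z + c1 * h + c2 * h ^+ 2) * r2) <= P1 * (t * H).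
  by rewrite cmodM ler_pM ?cmod_ge0//; exact: poly.
have b3 : cmod (r1 * (g2 z + k1 * h + k2 * h ^+ 2)) <= (t * H) * P2.
  by rewrite cmodM ler_pM ?cmod_ge0//; exact: poly.
have b4 : cmod (r1 * r2) <= t * H * 1.
  rewrite cmodM ler_pM ?cmod_ge0//; apply: (le_trans R2).
  by rewrite mulr_ile1// ltW.
apply: le_trans (cmodD _ _) _; apply: le_trans (lerD (cmodD _ _) (lexx _)) _.
apply: le_trans (lerD (lerD (cmodD _ _) (lexx _)) (lexx _)) _.
apply: le_trans (lerD (lerD (lerD b1 b2) b3) b4) _.
have -> : A * t * H + P1 * (t * H) + t * H * P2 + t * H * 1 = t * (A + P1 + P2 + 1) * H.
  by ring.
by rewrite ler_wpM2r.
Qed.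

Lemma peano2_ext g1 g2 z r : 0 < r -> (forall x, cmod (x - z) < r -> g1 x = g2 x) ->
  peano2 g1 z -> peano2 g2 z.
Proof.
move=> r0 hg [c1 [c2 h]]; exists c1, c2 => e e0; have [d d0 hd] := h e e0.
exists (Num.min d r); first by rewrite lt_min d0.
move=> k; rewrite lt_min => /andP[k1 k2]; rewrite -!hg ?hd// ?subrr ?cmod0//.
by rewrite [z + k]addrC addrK.
Qed.

Lemma peano2_cst (k : R[i]) z : peano2 (fun=> k) z.
Proof.
exists 0, 0 => e e0; exists 1 => // h _.
by rewrite !mul0r !addr0 subrr cmod0 mulr_ge0 ?exprn_ge0 ?cmod_ge0// ltW.
Qed.

Lemma peano2_inv s z : z != s -> peano2 (fun x => (x - s)^-1) z.
Proof.
move=> zs; have zs0 : z - s != 0 by rewrite subr_eq0.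
set y := z - s in zs0; have y0 : 0 < cmod y by rewrite cmod_gt0.
exists (- y ^- 2), (y ^- 3) => e e0.
exists (Num.min (cmod y / 2) (e * (cmod y ^+ 4 / 2))).
  by rewrite lt_min divr_gt0// mulr_gt0// divr_gt0// exprn_gt0.
move=> h; rewrite lt_min => /andP[h1 h2].
have yh : cmod y / 2 <= cmod (y + h).
  have := cmodB (y + h) h; rewrite addrK; lra.
have yh0 : y + h != 0 by rewrite -cmod_gt0; lra.
have -> : z + h - s = y + h by rewrite addrAC.
have -> : (y + h)^-1 - (y^-1 + - y ^- 2 * h + y ^- 3 * h ^+ 2)
   = - (h * h ^+ 2 / (y ^+ 3 * (y + h))) by field; rewrite yh0 zs0.
rewrite cmodN !cmodM cmodV cmodM !cmodX.
rewrite -mulrA [_ ^+ 2 / _]mulrC mulrA ler_wpM2r ?exprn_ge0 ?cmod_ge0//.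
rewrite ler_pdivrMr ?mulr_gt0 ?exprn_gt0 ?cmod_gt0//.
apply: (le_trans (ltW h2)); rewrite ler_wpM2l ?(ltW e0)// exprSr -mulrA.
by rewrite ler_wpM2l ?exprn_ge0 ?cmod_ge0.
Qed.

End Primitive.

(** * The maximum principle and the local identity theorem *)

Section MaximumPrinciple.
Variable R : realType.
Implicit Types (s z w : R[i]) (f g : R[i] -> R[i]) (e r M : R).

Lemma ler_cmod_dist z w : `|cmod z - cmod w| <= cmod (z - w).
Proof.
rewrite ler_norml; apply/andP; split.
  by have := cmodD (w - z) z; rewrite subrK cmodBC; lra.
by have := cmodD (z - w) w; rewrite subrK; lra.
Qed.

Lemma contin_cmod_plane g s (p : R * R) : contin g (s + (p.1 +i* p.2)) ->
  {for p, continuous (fun q : R * R => cmod (g (s + (q.1 +i* q.2))))}.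
Proof.
move=> hg; apply/cvgrPdist_le => e e0.
have [d d0 hd] := hg e e0; have d20 : 0 < d / 2 by lra.
near=> q.
have [h1 h2] : `|p.1 - q.1| < d / 2 /\ `|p.2 - q.2| < d / 2.
  by near: q; exists (ball p.1 (d / 2), ball p.2 (d / 2)) => /=;
   [split; exact: nbhsx_ballx | move=> [x y] [/= hx hy]; split].
apply: le_trans (ler_cmod_dist _ _) _; rewrite cmodBC.
have -> : s + (q.1 +i* q.2) = s + (p.1 +i* p.2) + ((q.1 - p.1) +i* (q.2 - p.2)).
  by apply/eqP; rewrite eq_complex /=; apply/andP; split; apply/eqP; case: (s) => a b /=; ring.
apply: hd; apply: le_lt_trans (cmod_le_ReIm _) _ => /=.
by rewrite (distrC q.1) (distrC q.2); lra.
Unshelve. all: by end_near. Qed.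

(* The second order terms of [|g|^2] cancel over the four points [z +- t], [z +- i t], leaving
   [4 |g' z|^2 t^2 >= 0] up to [o(t^2)]. *)
Lemma peano2_four_points g z e : 0 < e -> peano2 g z ->
  exists2 d : R, 0 < d & forall t : R, 0 < t -> t < d ->
    4 * cmod (g z) ^+ 2 - e * t ^+ 2 <=
      cmod (g (z + t%:C)) ^+ 2 + cmod (g (z - t%:C)) ^+ 2
      + cmod (g (z + t%:C * 'i)) ^+ 2 + cmod (g (z - t%:C * 'i)) ^+ 2.
Proof.
move=> e0 [c1 [c2 hg]].
pose A := cmod (g z) + cmod c1 + cmod c2.
have A0 : 0 <= A by rewrite /A !addr_ge0 ?cmod_ge0.
have D0 : 0 < 8 * A + 1 by lra.
have [d d0 hd] := hg _ (divr_gt0 e0 D0); set k := e / _ in hd.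
have k0 : 0 < k by rewrite divr_gt0.
have kE : k * (8 * A + 1) = e by rewrite mulfVK// gt_eqF.
exists (Num.min d 1); first by rewrite lt_min d0 ltr01.
move=> t t0; rewrite lt_min => /andP[td t1].
have key (v : R[i]) : cmod v = 1 ->
   cmod (g z + c1 * (t%:C * v) + c2 * (t%:C * v) ^+ 2) ^+ 2 - 2 * A * k * t ^+ 2
     <= cmod (g (z + t%:C * v)) ^+ 2.
  move=> v1; have tv : cmod (t%:C * v) = t by rewrite cmodM v1 mulr1 cmod_real gtr0_norm.
  have := hd (t%:C * v); rewrite tv => /(_ td).
  set P := g z + _ + _ => hP.
  have PA : cmod P <= A.
    apply: le_trans (cmodD _ _) _; rewrite lerD//.
      apply: le_trans (cmodD _ _) _; rewrite lerD2l cmodM tv ler_piMr ?cmod_ge0//.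
      exact: ltW.
    by rewrite cmodM cmodX tv ler_piMr ?cmod_ge0// expr_le1// ltW.
  have h1 : cmod P - k * t ^+ 2 <= cmod (g (z + t%:C * v)).
    by have := ler_cmod_dist P (g (z + t%:C * v)); rewrite cmodBC ler_norml; lra.
  have kt : 0 <= k * t ^+ 2 by rewrite mulr_ge0 ?exprn_ge0// ltW.
  have P0 := cmod_ge0 P.
  have h3 : cmod P * (k * t ^+ 2) <= A * (k * t ^+ 2) by rewrite ler_wpM2r.
  have -> : 2 * A * k * t ^+ 2 = 2 * (A * (k * t ^+ 2)) by ring.
  case: (lerP 0 (cmod P - k * t ^+ 2)) => h2.
    have := ler_pM h2 h2 h1 h1; rewrite -!expr2; apply: le_trans.
    by move: h3; move: kt; move: (k * t ^+ 2) => x x0 hx; rewrite !expr2; nra.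
  apply: le_trans (sqr_ge0 _).
  by move: h3 h2 kt; move: (k * t ^+ 2) => x x0 hx; nra.
have := key 1 (cmod1 R); have := key (-1); rewrite cmodN cmod1 => /(_ erefl).
have i1 : cmod ('i : R[i]) = 1 by rewrite /cmod /= expr0n expr1n add0r sqrtr1.
have := key 'i i1; have := key (- 'i); rewrite cmodN => /(_ i1).
rewrite mulr1 !mulrN mulr1.
(* The parallelogram law. Applied to opposite points it separates off the terms with [c1]; applied
   once more, as [t] and [i t] have opposite squares, it separates off those with [c2]. *)
have sum4 (a b c : R[i]) :
   cmod (a - b + c) ^+ 2 + cmod (a + b + c) ^+ 2 =
   2 * cmod (a + c) ^+ 2 + 2 * cmod b ^+ 2.
  rewrite !cmod_sqr; case: a b c => [a1 a2] [b1 b2] [c1' c2'] /=; ring.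
set a1 := cmod (g (z - t%:C * 'i)); set a2 := cmod (g (z + t%:C * 'i)).
set a3 := cmod (g (z - t%:C)); set a4 := cmod (g (z + t%:C)).
rewrite !sqrrN => h1 h2 h3 h4.
have s1 := sum4 (g z) (c1 * (t%:C * 'i)) (c2 * (t%:C * 'i) ^+ 2).
have s2 := sum4 (g z) (c1 * t%:C) (c2 * t%:C ^+ 2).
have s3 : cmod (g z + c2 * (t%:C * 'i) ^+ 2) ^+ 2 + cmod (g z + c2 * t%:C ^+ 2) ^+ 2
   = 2 * cmod (g z) ^+ 2 + 2 * cmod (c2 * t%:C ^+ 2) ^+ 2.
  have -> : (t%:C * 'i) ^+ 2 = - (t%:C ^+ 2) :> R[i].
    by rewrite exprMn sqr_i mulrN1.
  rewrite mulrN; have := sum4 (g z) (c2 * t%:C ^+ 2) 0; rewrite !addr0 => ->.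
  by [].
have kt2 : 0 <= k * t ^+ 2 by rewrite mulr_ge0 ?exprn_ge0// ltW.
have b1 := sqr_ge0 (cmod (c1 * (t%:C * 'i))).
have b2 := sqr_ge0 (cmod (c1 * t%:C)).
have b3 := sqr_ge0 (cmod (c2 * t%:C ^+ 2)).
rewrite -kE.
have -> : k * (8 * A + 1) * t ^+ 2 = 4 * (2 * A * k * t ^+ 2) + k * t ^+ 2 by ring.
lra.
Qed.

Definition in_square s r z :=
  `|complex.Re (z - s)| <= r /\ `|complex.Im (z - s)| <= r.

(** The function [|g|^2 + e |z - s|^2] has no maximum in the interior: summed over four neighbours,
    the second term gains [4 e t^2] while the first loses at most [e t^2]. A square is convenient
    because it is a product of compact intervals and the neighbours lie along its axes. *)
Lemma max_square g s r B : 0 < r ->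
  (forall z, in_square s r z -> peano2 g z) ->
  (forall z, in_square s r z -> `|complex.Re (z - s)| = r \/ `|complex.Im (z - s)| = r ->
     cmod (g z) <= B) ->
  forall z, in_square s r z -> cmod (g z) <= B.
Proof.
move=> r0 hg hB z hz.
have B0 : 0 <= B.
  apply: le_trans (cmod_ge0 (g (s + r%:C))) (hB _ _ _); rewrite /in_square addrC addKr /=.
    by split; [rewrite ger0_norm// ltW | rewrite normr0 ltW].
  by left; rewrite ger0_norm// ltW.
rewrite -(ler_pXn2r (n := 2)) ?nnegrE ?cmod_ge0//.
apply: (@ler_eps_mul _ _ _ (2 * r ^+ 2)) => e e0.
pose I : set R := `[- r, r]%classic.
pose u (q : R * R) := cmod (g (s + (q.1 +i* q.2))) ^+ 2 + e * (q.1 ^+ 2 + q.2 ^+ 2).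
have II x : I x <-> `|x| <= r by rewrite /I /= in_itv /= ler_norml.
have sqE (q : R * R) : (I `*` I) q <-> in_square s r (s + (q.1 +i* q.2)).
  by rewrite /in_square addrC addKr /=; split => -[/II ? /II ?]; split => //; apply/II.
have cu : {within I `*` I, continuous u}.
  apply: continuous_in_subspaceT => q /set_mem /sqE hq.
  have hc := contin_cmod_plane (peano2_contin (hg _ hq)).
  have h1 : {for q, continuous (fun q : R * R => q.1)} by exact: cvg_fst.
  have h2 : {for q, continuous (fun q : R * R => q.2)} by exact: cvg_snd.
  apply: (cvgD (cvgM hc hc)); apply: cvgM; first exact: cvg_cst.
  exact: cvgD (cvgM h1 h1) (cvgM h2 h2).
have I0 : (I `*` I) !=set0.
  by exists (0, 0); split; apply/II; rewrite normr0 ltW.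
have cI : compact (I `*` I) by apply: compact_setX; exact: segment_compact.
have [[x0 y0] /set_mem hq hmax] := compact_EVT_max I0 cI cu.
have zE : z = s + (complex.Re (z - s) +i* complex.Im (z - s)).
  by case: (z) (s) => [a b] [c d]; apply/eqP; rewrite eq_complex /=; apply/andP; split; apply/eqP; ring.
have hzu : u (complex.Re (z - s), complex.Im (z - s)) <= u (x0, y0).
  by apply: hmax; apply/mem_set/sqE; rewrite /= -zE.
have hzu2 : cmod (g z) ^+ 2 <= u (x0, y0).
  by apply: le_trans hzu; rewrite /u /= -zE lerDl mulr_ge0 ?(ltW e0)// addr_ge0 ?sqr_ge0.
apply: (le_trans hzu2).
have hq' := (sqE _).1 hq.
have [/II /= hx /II /= hy] := hq.
have bd : cmod (g (s + (x0 +i* y0))) <= B -> u (x0, y0) <= B ^+ 2 + 2 * r ^+ 2 * e.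
  move=> h; rewrite /u lerD//= ?ler_pXn2r ?nnegrE ?cmod_ge0//.
  rewrite mulrC ler_wpM2r ?(ltW e0)// mulr_natl mulr2n.
  by rewrite lerD// -[_ ^+ 2]ger0_norm ?sqr_ge0// normrX ler_pXn2r ?nnegrE// ltW.
case: (eqVneq `|x0| r) => [xr|xr].
  by apply: bd; apply: hB => //; left; rewrite addrC addKr.
case: (eqVneq `|y0| r) => [yr|yr].
  by apply: bd; apply: hB => //; right; rewrite addrC addKr.
exfalso.
have {hx xr} hx : `|x0| < r by rewrite lt_neqAle xr.
have {hy yr} hy : `|y0| < r by rewrite lt_neqAle yr.
set w := s + (x0 +i* y0) in hq' bd.
have [d d0 hd] := peano2_four_points e0 (hg _ hq').
pose t := Num.min (d / 2) (Num.min (r - `|x0|) (r - `|y0|)).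
have t0 : 0 < t by rewrite !lt_min divr_gt0//= !subr_gt0 hx hy.
have td : t < d by rewrite gt_min; apply/orP; left; lra.
have tx : t <= r - `|x0| by rewrite !ge_min lexx orbT.
have ty : t <= r - `|y0| by rewrite !ge_min lexx !orbT.
have {hd} hd := hd t t0 td.
have mx (a b : R) : `|x0 + a| <= r -> `|y0 + b| <= r ->
   cmod (g (w + (a +i* b))) ^+ 2 + e * ((x0 + a) ^+ 2 + (y0 + b) ^+ 2)
    <= cmod (g w) ^+ 2 + e * (x0 ^+ 2 + y0 ^+ 2).
  move=> ha hb; have := hmax (x0 + a, y0 + b).
  rewrite /u /= -/w; have -> : s + ((x0 + a) +i* (y0 + b)) = w + (a +i* b).
    by rewrite /w -addrA; congr (_ + _); apply/eqP; rewrite eq_complex /= !eqxx.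
  by apply; apply/mem_set; split; apply/II.
have nx a : `|a| <= t -> `|x0 + a| <= r by move=> h; apply: le_trans (ler_normD _ _) _; lra.
have ny a : `|a| <= t -> `|y0 + a| <= r by move=> h; apply: le_trans (ler_normD _ _) _; lra.
have nt : `|t| <= t by rewrite ger0_norm// ltW.
have nnt : `|- t| <= t by rewrite normrN.
have n0 : `|0 : R| <= t by rewrite normr0 ltW.
have := mx _ _ (nx _ nt) (ny _ n0); have := mx _ _ (nx _ nnt) (ny _ n0).
have := mx _ _ (nx _ n0) (ny _ nt); have := mx _ _ (nx _ n0) (ny _ nnt).
have -> : w + (0 +i* t) = w + t%:C * 'i.
  by congr (_ + _); apply/eqP; rewrite eq_complex /=; apply/andP; split; apply/eqP; ring.
have -> : w + (0 -i* t) = w - t%:C * 'i.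
  by congr (_ + _); apply/eqP; rewrite eq_complex /=; apply/andP; split; apply/eqP; ring.
have -> : w + (- t +i* 0) = w - t%:C.
  by congr (_ + _); apply/eqP; rewrite eq_complex /= oppr0 !eqxx.
have -> : w + (t +i* 0) = w + t%:C by [].
move: hd; move: (cmod _) (cmod _) (cmod _) (cmod _) (cmod _) => g0 g1 g2 g3 g4.
have et : 0 < e * t ^+ 2 by rewrite mulr_gt0// exprn_gt0.
have -> : (x0 + 0) ^+ 2 = x0 ^+ 2 by rewrite addr0.
have -> : (y0 + 0) ^+ 2 = y0 ^+ 2 by rewrite addr0.
rewrite !sqrrD !sqrrN !mulrN !mulrDr; lra.
Qed.

(* Divide a primitive vanishing near [s] by [(z - s)^k] and let [k] grow. *)
Lemma local_identity f s r e : 0 < e -> cder_on_ball f s r ->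
  (forall z, cmod (z - s) < e -> f z = 0) ->
  forall z, cmod (z - s) < r / 2 -> f z = 0.
Proof.
move=> e0 hf h0.
have [r0|r0 z] := ltrP 0 r; last first.
  by move=> hz; exfalso; have := cmod_ge0 (z - s); lra.
pose G := cint f s.
have hs : cmod (s - s) <= r by rewrite subrr cmod0 ltW.
pose e' := Num.min (e / 2) r.
have e'0 : 0 < e' by rewrite lt_min divr_gt0.
have G0 z : cmod (z - s) <= e' -> G z = 0.
  move=> hz; have hzr : cmod (z - s) <= r by apply: (le_trans hz); rewrite ge_min lexx orbT.
  have hze : cmod (z - s) <= e / 2 by apply: (le_trans hz); rewrite ge_min lexx.
  have hse : cmod (s - s) <= e / 2 by rewrite subrr cmod0; lra.
  have := @cint_near_affine _ f s r s z s (e / 2) 0 0 0 hf hs hzr hse hze.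
  rewrite mul0r !mul0r !addr0 subr0 => h.
  apply/eqP; rewrite -cmod_eq0 eq_le cmod_ge0 andbT; apply: h => y hy.
  by rewrite h0 ?mul0r ?addr0 ?subr0 ?cmod0//; lra.
(* The square of half-side [rho] lies inside the disc of radius [r], as [2 (2/3)^2 < 1], and
   contains the disc of radius [r / 2]. *)
pose rho := r * 2 / 3.
have rho0 : 0 < rho by rewrite /rho; lra.
have sqr_ball z : in_square s rho z -> cmod (z - s) < r.
  move=> [h1 h2]; rewrite -(ltr_pXn2r (n := 2)) ?nnegrE ?cmod_ge0 ?ltW//.
  rewrite cmod_sqr -(real_normK (num_real (complex.Re _))).
  rewrite -(real_normK (num_real (complex.Im _))).
  have := ler_pM (normr_ge0 _) (normr_ge0 _) h1 h1.
  have := ler_pM (normr_ge0 _) (normr_ge0 _) h2 h2.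
  rewrite -!expr2 => k1 k2; apply: le_lt_trans (lerD k2 k1) _.
  by rewrite /rho; nra.
have GP z : in_square s rho z -> peano2 G z.
  by move=> /sqr_ball; exact: primitive_peano2.
have [M M0 hM] : exists2 M, 0 <= M & forall z, in_square s rho z -> cmod (G z) <= M.
  pose I : set R := `[- rho, rho]%classic.
  have II x : I x <-> `|x| <= rho by rewrite /I /= in_itv /= ler_norml.
  have sqE (q : R * R) : (I `*` I) q <-> in_square s rho (s + (q.1 +i* q.2)).
    by rewrite /in_square addrC addKr /=; split => -[/II ? /II ?]; split => //; apply/II.
  pose u (q : R * R) := cmod (G (s + (q.1 +i* q.2))).
  have cu : {within I `*` I, continuous u}.
    apply: continuous_in_subspaceT => q /set_mem /sqE hq.
    exact: contin_cmod_plane (peano2_contin (GP _ hq)).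
  have I0 : (I `*` I) !=set0.
    by exists (0, 0); split; apply/II; rewrite normr0 ltW.
  have cI : compact (I `*` I) by apply: compact_setX; exact: segment_compact.
  have [q0 _ hmax] := compact_EVT_max I0 cI cu.
  exists (u q0) => [|z hz]; first exact: cmod_ge0.
  have zE : z = s + (complex.Re (z - s) +i* complex.Im (z - s)).
    by case: (z) (s) => [a b] [c d]; apply/eqP; rewrite eq_complex /=; apply/andP; split; apply/eqP; ring.
  by have := hmax (complex.Re (z - s), complex.Im (z - s)); rewrite /u /= -zE; apply; apply/mem_set/sqE; rewrite /= -zE.
(* The quotient is regular at [s] because [G] vanishes in a neighbourhood of [s], where the quotient
   is therefore constantly [0]. On the boundary of the square [|z - s| >= rho]. *)
have hG k z : in_square s rho z -> cmod (G z * (z - s)^-1 ^+ k) <= M / rho ^+ k.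
  move: z; apply: max_square => // z hz.
  - have [->|zs] := eqVneq z s.
      apply: (peano2_ext e'0 _ (peano2_cst 0 s)) => x hx.
      by rewrite G0 ?mul0r// ltW.
    elim: k => [|k IH].
      by apply: (peano2_ext ltr01 _ (GP z hz)) => x _; rewrite expr0 mulr1.
    apply: (peano2_ext ltr01 _ (peano2M IH (peano2_inv zs))) => x _.
    by rewrite exprSr mulrA.
  - move=> hb; have hr : rho <= cmod (z - s).
      by case: hb => <-; [exact: abs_Re_le|exact: abs_Im_le].
    rewrite cmodM cmodX cmodV ler_pM ?cmod_ge0 ?exprn_ge0 ?invr_ge0 ?cmod_ge0//.
      exact: hM.
    rewrite -exprVn lerXn2r ?nnegrE ?invr_ge0 ?cmod_ge0 ?(ltW rho0)//.
    by rewrite lef_pV2 ?posrE// (lt_le_trans rho0).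
have Gz z : cmod (z - s) < rho -> G z = 0.
  move=> hz; have [->|zs] := eqVneq z s; first by rewrite G0// subrr cmod0 ltW.
  have zs0 : 0 < cmod (z - s) by rewrite cmod_gt0 subr_eq0.
  have hsq : in_square s rho z.
    by split; apply: le_trans (ltW hz); [exact: abs_Re_le|exact: abs_Im_le].
  pose q := cmod (z - s) / rho.
  have q0 : 0 <= q by rewrite divr_ge0 ?cmod_ge0// ltW.
  have q1 : `|q| < 1 by rewrite ger0_norm// ltr_pdivrMr// mul1r.
  have hGk k : cmod (G z) <= M * q ^+ k.
    have := hG k z hsq; rewrite cmodM cmodX cmodV exprVn ler_pdivrMr ?exprn_gt0// => /le_trans; apply.
    by rewrite /q (expr_div_n _ rho) mulrA mulrAC.
  apply/eqP; rewrite -cmod_eq0 eq_le cmod_ge0 andbT.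
  have hc : (fun k => M * q ^+ k) @ \oo --> (M * 0 : R).
    by apply: cvgM; [exact: cvg_cst | exact: cvg_expr].
  rewrite mulr0 in hc.
  apply: (cvgr_to_ge hc); exact: nearW.
(* Back from [G] to [f]: the integral of [f] over a short step [h] at [z] is an increment of [G],
   hence [0], and by continuity it is within [d h] of [f z * h]. *)
move=> z hz; apply/eqP; rewrite -cmod_eq0 eq_le cmod_ge0 andbT.
apply: (@ler_eps_mul _ _ _ 1) => d d0; rewrite add0r mul1r.
have hzr : cmod (z - s) <= r by lra.
have [t t0 ht] := cder_on_ball_contin hf hzr d0.
pose h := Num.min (t / 2) ((rho - cmod (z - s)) / 2).
have hrho : cmod (z - s) < rho by rewrite /rho; lra.
have hh0 : 0 < h by rewrite lt_min !divr_gt0// subr_gt0.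
have hht : h <= t / 2 by rewrite ge_min lexx.
have hhr : h <= (rho - cmod (z - s)) / 2 by rewrite ge_min lexx orbT.
have hch : cmod h%:C = h by rewrite cmod_real gtr0_norm.
have hzh : cmod (z + h%:C - s) < rho.
  by rewrite addrAC; apply: le_lt_trans (cmodD _ _) _; rewrite hch; lra.
have hzhr : cmod (z + h%:C - s) <= r by apply: (le_trans (ltW hzh)); rewrite /rho; lra.
have a1 : cmod (z - z) <= h by rewrite subrr cmod0 ltW.
have a2 : cmod (z + h%:C - z) <= h by rewrite addrC addKr hch.
have := @cint_near_affine _ f s r z (z + h%:C) z h (f z) 0 d hf hzr hzhr a1 a2.
rewrite -(cint_triangle hf hs hzr hzhr) -/(G _) -/(G _) Gz// Gz// mul0r mul0r addr0 subrr sub0r.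
rewrite cmodN addrAC subrr add0r cmodM hch => H.
rewrite -(ler_pM2r hh0); apply: H => y hy; rewrite mul0r addr0.
by rewrite -[in f y](subrKC z y); apply: ht; lra.
Qed.

End MaximumPrinciple.

(** * The identity theorem along segments *)

Section SegmentIdentity.
Variables (R : realType) (X : lmodType R[i]).
Implicit Types (z : R[i]) (f : R[i] -> R[i]) (phi : R[i] -> X).

Lemma span_seq_basis (s : seq X) : exists (d : nat) (e : 'I_d -> X),
  lin_indep e /\ forall x, x \in s -> lin_span e x.
Proof.
elim: s => [|x s [d [e [he hs]]]].
  by exists 0%N, (fun=> 0); split=> [c _ []|].
have [hx|hx] := pselect (lin_span e x).
  by exists d, e; split=> // y; rewrite inE => /predU1P[->|/hs].
pose e' (i : 'I_d.+1) := oapp e x (unlift ord0 i).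
have e'0 : e' ord0 = x by rewrite /e' unlift_none.
have e'S i : e' (lift ord0 i) = e i by rewrite /e' liftK.
have sumE (c : 'I_d.+1 -> R[i]) : \sum_i c i *: e' i =
    c ord0 *: x + \sum_i c (lift ord0 i) *: e i.
  by rewrite big_ord_recl e'0; under eq_bigr do rewrite e'S.
exists d.+1, e'; split=> [c|y].
- rewrite sumE => h0.
  have c0 : c ord0 = 0.
    apply/eqP; apply: contrapT => /negP c0; apply: hx.
    exists (fun i => - (c ord0)^-1 * c (lift ord0 i)).
    under eq_bigr do rewrite -scalerA.
    rewrite -scaler_sumr scaleNr -scalerN; apply: (scalerI c0).
    rewrite scalerA mulfV// scale1r; apply/eqP; rewrite -subr_eq0 opprK.
    by rewrite h0.
  move: h0; rewrite c0 scale0r add0r => /he hc i.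
  by case: (unliftP ord0 i) => [j ->|->].
- rewrite inE => /predU1P[->|/hs [c ->]].
    exists (fun i => (i == ord0)%:R); rewrite sumE eqxx scale1r big1 ?addr0// => i _.
    by rewrite eq_sym eq_liftF scale0r.
  exists (fun i => oapp c 0 (unlift ord0 i)).
  rewrite sumE unlift_none /= scale0r add0r; apply: eq_bigr => i _.
  by rewrite liftK.
Qed.

Lemma spanning_basis (J : finType) (e : J -> X) :
  exists (d : nat) (b : 'I_d -> X) (A : J -> 'I_d -> R[i]),
    lin_indep b /\ forall j, e j = \sum_i A j i *: b i.
Proof.
have [d [b [hb hs]]] := span_seq_basis [seq e j | j <- enum J].
have /choice[A hA] : forall j, exists c : 'I_d -> R[i], e j = \sum_i c i *: b i.
  by move=> j; apply: hs; apply: map_f; rewrite mem_enum.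
by exists d, b, A.
Qed.

Definition locally_holo phi (z : R[i]) : Prop :=
  exists (r : R) (J : finType) (e : J -> X) (h : J -> R[i] -> R[i]),
    [/\ 0 < r, forall j, cder_on_ball (h j) z r
      & forall y, cmod (y - z) <= r -> phi y = \sum_j h j y *: e j].

Lemma cderZ (k : R[i]) f z d : cder f z d -> cder (fun x => k * f x) z (k * d).
Proof.
move=> hf e e0; have D0 : 0 < cmod k + 1 by rewrite ltr_wpDl ?cmod_ge0.
have [r r0 hr] := hf _ (divr_gt0 e0 D0); exists r => // h /hr hh.
have -> : k * f (z + h) - k * f z - k * d * h = k * (f (z + h) - f z - d * h) by ring.
rewrite cmodM; apply: le_trans (ler_wpM2l (cmod_ge0 k) hh) _.
rewrite mulrA ler_wpM2r ?cmod_ge0// mulrA ler_pdivrMr// mulrC ler_wpM2l ?(ltW e0)//.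
by rewrite lerDl.
Qed.

Lemma cderD f g z d d' : cder f z d -> cder g z d' ->
  cder (fun x => f x + g x) z (d + d').
Proof.
move=> hf hg e e0; have e20 : 0 < e / 2 by lra.
have [r r0 hr] := hf _ e20; have [r' r'0 hr'] := hg _ e20.
exists (Num.min r r'); first by rewrite lt_min r0.
move=> h; rewrite lt_min => /andP[/hr h1 /hr' h2].
have -> : f (z + h) + g (z + h) - (f z + g z) - (d + d') * h =
  (f (z + h) - f z - d * h) + (g (z + h) - g z - d' * h) by ring.
by apply: le_trans (cmodD _ _) _; apply: le_trans (lerD h1 h2) _; rewrite -mulrDl -splitr.
Qed.

Lemma cder0 z : cder (fun=> 0) z 0.
Proof.
move=> e e0; exists 1 => // h _.
by rewrite mul0r !subr0 cmod0 mulr_ge0 ?cmod_ge0// ltW.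
Qed.

Lemma cder_comb (J : finType) (h : J -> R[i] -> R[i]) (a : J -> R[i]) z :
  (forall j, exists d, cder (h j) z d) ->
  exists d, cder (fun x => \sum_j h j x * a j) z d.
Proof.
move=> hh; rewrite /index_enum; elim: (Finite.enum _) => [|j s [d IH]].
  exists 0; have -> : (fun x => \sum_(j <- [::]) h j x * a j) = fun=> 0.
    by apply/funext => x; rewrite big_nil.
  exact: cder0.
have [d' hd'] := hh j; exists (a j * d' + d).
have -> : (fun x => \sum_(j <- j :: s) h j x * a j) =
   fun x => a j * h j x + \sum_(j <- s) h j x * a j.
  by apply/funext => x; rewrite big_cons [h j x * _]mulrC.
exact: cderD (cderZ _ hd') IH.
Qed.

Lemma locally_holo_identity phi z : locally_holo phi z -> exists2 r : R, 0 < r &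
  forall y (d : R), cmod (y - z) < r -> 0 < d ->
    (forall x, cmod (x - y) < d -> phi x = 0) ->
    forall x, cmod (x - z) < r -> phi x = 0.
Proof.
move=> [r [J [e [h [r0 hh hphi]]]]].
have [d [b [A [hb hA]]]] := spanning_basis e.
pose k i x := \sum_j h j x * A j i.
have hk x : cmod (x - z) <= r -> phi x = \sum_i k i x *: b i.
  move=> /hphi ->; under eq_bigr do rewrite hA scaler_sumr.
  rewrite exchange_big; apply: eq_bigr => i _; rewrite scaler_suml.
  by apply: eq_bigr => j _; rewrite scalerA.
(* [local_identity] around [y] with radius [r / 2] yields vanishing within [r / 4] of [y], and this
   disc covers the disc of radius [r / 8] around [z]. *)
exists (r / 8); first by rewrite divr_gt0.
move=> y d' hy d'0 h0 x hx.
have hxr : cmod (x - z) <= r by lra.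
rewrite hk// big1// => i _.
have -> : k i x = 0; last by rewrite scale0r.
have ball_in (w : R[i]) : cmod (w - y) <= r / 2 -> cmod (w - z) <= r.
  by move=> hw; apply: le_trans (cmod_dist _ y _) _; lra.
apply: (@local_identity R (k i) y (r / 2) (Num.min d' (r / 2))).
- by rewrite lt_min d'0 divr_gt0.
- move=> w /ball_in hw; apply: cder_comb => j; exact: hh.
- move=> w; rewrite lt_min => /andP[w1 w2].
  have := h0 _ w1; rewrite hk; last exact/ball_in/ltW.
  by move=> /hb.
- have := cmod_dist x z y; rewrite (cmodBC z y); lra.
Qed.

(** At the supremum [T] of the parameters up to which [phi] vanishes locally, the disc given by
    [locally_holo_identity] meets the part already reached, so vanishing extends past [T] unless
    [T = 1]. *)
Lemma segment_identity phi :
  (forall t : R, 0 <= t <= 1 -> locally_holo phi t%:C) ->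
  (exists2 d : R, 0 < d & forall z, cmod z < d -> phi z = 0) ->
  phi 1 = 0.
Proof.
move=> hphi [d0 d00 hd0].
pose E (t : R) := exists2 d : R, 0 < d & forall z, cmod (z - t%:C) < d -> phi z = 0.
pose S : set R := [set t | 0 <= t <= 1 /\ forall s, 0 <= s <= t -> E s].
have S0 : S 0.
  split; first by rewrite lexx ler01.
  move=> s; rewrite -eq_le => /eqP <-; exists d0 => // z.
  by rewrite subr0; exact: hd0.
have hS : has_sup S by split; [exists 0 | exists 1 => x [/andP[]]].
pose T := sup S.
have T01 : 0 <= T <= 1.
  apply/andP; split; first by apply: ub_le_sup => //; case: hS.
  by apply: ge_sup; [case: hS | move=> x [/andP[]]].
have [r r0 hr] := locally_holo_identity (hphi _ T01).
have [s sS hs] := sup_adherent r0 hS.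
have sT : s <= T by apply: ub_le_sup => //; case: hS.
have dR (a b : R) : cmod (a%:C - b%:C) = `|a - b| by rewrite -rmorphB cmod_real.
have Tr x : cmod (x - T%:C) < r -> phi x = 0.
  have [s01 sE] := sS; have [|d dgt0 hd] := sE s; first by case/andP: s01 => ->; rewrite lexx.
  apply: (hr s%:C d) => //; rewrite dR ltr_norml; rewrite -/T in hs; lra.
have Enear (t : R) : `|t - T| < r -> E t.
  move=> ht; exists (r - `|t - T|); first by rewrite subr_gt0.
  move=> z hz; apply: Tr; apply: le_lt_trans (cmod_dist _ t%:C _) _.
  by rewrite dR; lra.
have [s01 sE] := sS.
have ST (t : R) : 0 <= t <= 1 -> t < T + r -> S t.
  move=> t01 tr; split=> // u /andP[u0 ut].
  have [us|su] := lerP u s; first by apply: sE; rewrite u0.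
  by apply: Enear; rewrite ltr_norml; rewrite -/T in hs; lra.
have T1 : T = 1.
  apply/eqP; rewrite eq_le ((andP T01).2) /=; rewrite leNgt; apply/negP => Tlt1.
  pose t := Num.min 1 (T + r / 2).
  have tT : T < t by rewrite lt_min Tlt1; lra.
  have : S t.
    apply: ST; last by rewrite gt_min; apply/orP; right; lra.
    by rewrite (ltW (le_lt_trans ((andP T01).1) tT)) ge_min lexx.
  by move=> St; have : t <= T by [apply: ub_le_sup => //; case: hS]; rewrite leNgt tT.
by apply: Tr; rewrite T1 subrr cmod0.
Qed.

End SegmentIdentity.

(** * Holomorphic maps and their restrictions to complex lines *)

Section Lines.
Variables (R : realType) (E : normedModType R[i]) (X : lmodType R[i]).
Implicit Types (q v : E) (z : R[i]).

Lemma gt0_complexP (e : R[i]) : 0 < e -> exists2 r : R, 0 < r & e = r%:C.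
Proof.
case: e => a b; rewrite ltcE /= => /andP[/eqP b0 a0]; exists a => //.
by rewrite b0.
Qed.

Lemma line_nbhs (W : set E) q v z : open W -> W (q + z *: v) ->
  exists2 r : R, 0 < r & forall y, cmod (y - z) <= r -> W (q + y *: v).
Proof.
move=> oW Wz; have /nbhs_ballP[e /= e0 he] := open_nbhs_nbhs (conj oW Wz).
have [r r0 re] := gt0_complexP e0.
have v1 : 0 < `|v| + 1 by rewrite ltr_wpDl.
have [w w0 wE] := gt0_complexP v1.
exists (r / w / 2); first by rewrite !divr_gt0.
move=> y hy; apply: he; rewrite -ball_normE /= opprD addrACA subrr add0r -scalerBl.
rewrite normrZ re distrC.
apply: (@le_lt_trans _ _ ((r / w / 2)%:C * w%:C)).
  rewrite ler_pM// ?normr_cmod ?lecR//.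
  by rewrite -wE lerDl ler01.
rewrite -rmorphM ltcR mulrAC divfK ?gt_eqF//.
by rewrite ltr_pdivrMr// mulr_natr mulr2n ltrDl.
Qed.

Lemma differentiable_line (f : E -> R[i]^o) q v z :
  differentiable f (q + z *: v) ->
  exists d, cder (fun y => f (q + y *: v)) z d.
Proof.
move=> /(diff_derivable (v := v)) /cvg_ex[/= d hd]; exists d => e e0.
have eC : 0 < e%:C by rewrite ltcR.
move/cvgrPdist_le: hd => /(_ _ eC) /nbhs_ballP[r /= r0 hr].
have [s s0 sE] := gt0_complexP r0.
exists s => // h hs; have [->|h0] := eqVneq h 0.
  by rewrite addr0 subrr mulr0 subrr cmod0 mulr0.
have := hr h; rewrite -ball_normE /= sub0r normrN sE normr_cmod ltcR => /(_ hs h0).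
have -> : f (q + (z + h) *: v) = f (h *: v + (q + z *: v)).
  by congr f; rewrite scalerDl addrA addrC.
set A := f _; set B := f _; rewrite normr_cmod lecR => hh.
have -> : A - B - d * h = - ((d - h^-1 * (A - B)) * h).
  by field.
by rewrite cmodN cmodM ler_wpM2r ?cmod_ge0.
Qed.

(* As [holomorphic], with a spanning family in place of a basis. *)
Definition holo_span (U : set E) (f : E -> X) : Prop :=
  forall p, U p -> exists W : set E, [/\ open W, W p, W `<=` U
    & exists (J : finType) (e : J -> X) (h : J -> E -> R[i]^o),
      (forall j x, W x -> differentiable (h j) x) /\
      forall x, W x -> f x = \sum_j h j x *: e j].

Lemma holomorphic_holo_span (U : set E) (f : E -> X) :
  holomorphic U f -> holo_span U f.
Proof.
move=> hf p /hf[W [oW Wp WU [d [e [h [_ h1 h2]]]]]]; exists W; split=> //.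
by exists 'I_d, e, h.
Qed.

Lemma differentiable_sum_fin (J : finType) (h : J -> E -> R[i]^o) x :
  (forall j, differentiable (h j) x) -> differentiable (fun y => \sum_j h j y : R[i]^o) x.
Proof.
move=> hh; rewrite /index_enum; elim: (Finite.enum _) => [|j s IH].
  have -> : (fun y => \sum_(j <- [::]) h j y : R[i]^o) = cst 0.
    by apply/funext => y; rewrite big_nil.
  exact: differentiable_cst.
have -> : (fun y => \sum_(j <- j :: s) h j y : R[i]^o) =
   h j + (fun y => \sum_(j <- s) h j y : R[i]^o).
  by apply/funext => y; rewrite big_cons.
exact: differentiableD.
Qed.

Lemma holo_span_holomorphic (U : set E) (f : E -> X) :
  holo_span U f -> holomorphic U f.
Proof.
move=> hf p /hf[W [oW Wp WU [J [e [h [h1 h2]]]]]]; exists W; split=> //.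
have [d [b [A [hb hA]]]] := spanning_basis e.
exists d, b, (fun i x => \sum_j h j x * A j i); split=> // [i x Wx|x Wx].
  apply: differentiable_sum_fin => j.
  have -> : (fun x => h j x * A j i : R[i]^o) = h j * cst (A j i : R[i]^o) by [].
  by apply: differentiableM; [exact: h1|exact: differentiable_cst].
rewrite h2//; under eq_bigr do rewrite hA scaler_sumr.
rewrite exchange_big; apply: eq_bigr => i _; rewrite scaler_suml.
by apply: eq_bigr => j _; rewrite scalerA.
Qed.

Lemma holo_spanZ (U : set E) (c : E -> R[i]^o) (f : E -> X) :
  (forall x, U x -> differentiable c x) -> holo_span U f ->
  holo_span U (fun x => c x *: f x).
Proof.
move=> hc hf p /hf[W [oW Wp WU [J [e [h [h1 h2]]]]]]; exists W; split=> //.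
exists J, e, (fun j => c * h j); split=> [j x Wx|x Wx].
  by apply: differentiableM; [exact/hc/WU|exact: h1].
by rewrite h2// scaler_sumr; apply: eq_bigr => j _; rewrite scalerA.
Qed.

Lemma holo_spanB (U : set E) (f g : E -> X) : holo_span U f -> holo_span U g ->
  holo_span U (fun x => f x - g x).
Proof.
move=> hf hg p Up; have [W [oW Wp WU [J [e [h [h1 h2]]]]]] := hf p Up.
have [W' [oW' Wp' WU' [J' [e' [h' [h1' h2']]]]]] := hg p Up.
exists (W `&` W'); split=> //; [exact: openI | by move=> x [/WU] |].
exists (J + J')%type, (fun j => match j with inl i => e i | inr i => - e' i end),
  (fun j => match j with inl i => h i | inr i => h' i end); split=> [[j|j] x [Wx Wx']|x [Wx Wx']].
- exact: h1.
- exact: h1'.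
rewrite big_sumType /= h2// h2'//; congr (_ + _).
by rewrite -sumrN; apply: eq_bigr => j _; rewrite scalerN.
Qed.

Lemma holo_span_comb (U : set E) (J : finType) (e : J -> X) (h : J -> E -> R[i]^o) :
  open U -> (forall j x, U x -> differentiable (h j) x) ->
  holo_span U (fun x => \sum_j h j x *: e j).
Proof. by move=> oU hh p Up; exists U; split=> //; exists J, e, h. Qed.

Lemma holo_span_line (U : set E) (f : E -> X) q v z :
  holo_span U f -> U (q + z *: v) ->
  locally_holo (fun y => f (q + y *: v)) z.
Proof.
move=> hf /hf[W [oW Wz WU [J [e [h [hd he]]]]]].
have [r r0 hr] := line_nbhs oW Wz.
exists r, J, e, (fun j y => h j (q + y *: v)); split=> //.
  by move=> j y hy; apply: differentiable_line; apply: hd; exact: hr.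
by move=> y hy; rewrite he//; exact: hr.
Qed.

End Lines.

(** * Formal distributions and locality *)

Section FormalDistributions.
Variable I : finType.
Implicit Types (i j s t : I) (p : {ffun I -> int}) (ps : seq (I * I)) (N : nat).

Definition ee (i : I) : {ffun I -> int} := [ffun j => (j == i)%:R].

Section Operators.
Variable X : zmodType.
Implicit Types (A B : {ffun I -> int} -> X).

(* A family [A p] of coefficients stands for the formal distribution [sum_p A p x^p];
   [Msub (i, j)] is then multiplication by [x_i - x_j]. *)
Definition Msub (ij : I * I) A : {ffun I -> int} -> X :=
  fun p => A (p - ee ij.1) - A (p - ee ij.2).

(** Multiplication by the product of the [(x_i - x_j)^N] over the pairs in [ps]. *)
Definition Dop N ps A : {ffun I -> int} -> X :=
  foldr (fun ij B => iter N (Msub ij) B) A ps.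

Lemma Msub_comm ij kl A : Msub ij (Msub kl A) = Msub kl (Msub ij A).
Proof.
apply/funext => p; rewrite /Msub !opprB addrACA [in RHS]addrACA.
rewrite !(addrAC p (- ee kl.1)) !(addrAC p (- ee kl.2)).
by congr (_ + _); rewrite addrC.
Qed.

Lemma iter_comm (T : Type) (f g : T -> T) n x :
  (forall y, f (g y) = g (f y)) -> iter n f (g x) = g (iter n f x).
Proof. by move=> h; elim: n => //= n ->. Qed.

Lemma iterM_comm N M ij kl A :
  iter N (Msub ij) (iter M (Msub kl) A) = iter M (Msub kl) (iter N (Msub ij) A).
Proof.
rewrite (@iter_comm _ (Msub ij) (iter M (Msub kl)))// => B.
by rewrite (@iter_comm _ (Msub kl) (Msub ij))// => C; rewrite Msub_comm.
Qed.

Lemma Dop_iter N M ij ps A :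
  Dop N ps (iter M (Msub ij) A) = iter M (Msub ij) (Dop N ps A).
Proof. by elim: ps => //= kl ps ->; rewrite iterM_comm. Qed.

Lemma Dop_cat N ps qs A : Dop N (ps ++ qs) A = Dop N ps (Dop N qs A).
Proof. by rewrite /Dop foldr_cat. Qed.

Lemma Dop_comm N M ps qs A : Dop N ps (Dop M qs A) = Dop M qs (Dop N ps A).
Proof. by elim: qs => //= ij qs <-; rewrite Dop_iter. Qed.

Lemma Dop_perm N ps qs A : perm_eq ps qs -> Dop N ps A = Dop N qs A.
Proof.
elim: ps qs => [|ij ps IH] qs; first by rewrite perm_sym => /perm_nilP ->.
move=> /[dup] h /perm_mem /(_ ij); rewrite mem_head => /esym hij.
have hq := perm_to_rem hij.
have {}IH := IH (rem ij qs) _; rewrite /= IH; last first.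
  by rewrite -(perm_cons ij) -(permPr hq).
elim: qs hij {h IH hq} => //= kl qs IH; rewrite inE; case: eqVneq => [->//|ne] /= hij.
by rewrite iterM_comm IH.
Qed.

Lemma DopD N M ps A : Dop (N + M) ps A = Dop N ps (Dop M ps A).
Proof.
by elim: ps => //= ij ps ->; rewrite iterD Dop_iter.
Qed.

(** A coefficient of a product with a polynomial involves only coefficients at lower exponents, so
    vanishing on a set closed under lowering exponents persists. *)
Lemma Dop_closed (S : {ffun I -> int} -> Prop) N ps A :
  (forall p i, S p -> S (p - ee i)) -> (forall p, S p -> A p = 0) ->
  forall p, S p -> Dop N ps A p = 0.
Proof.
move=> hS hA; elim: ps => //= ij ps IH.
elim: N {IH} (Dop _ _ _) IH => //= N IHN B hB p Sp.
by rewrite /Msub !(IHN B hB) ?subrr//; exact: hS.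
Qed.

End Operators.

Lemma Dop_additive (X X' : zmodType) (f : {additive X -> X'}) N ps
    (A : {ffun I -> int} -> X) p :
  Dop N ps (fun p => f (A p)) p = f (Dop N ps A p).
Proof.
have -> : Dop N ps (fun p => f (A p)) = fun p => f (Dop N ps A p); last by [].
elim: ps => //= ij ps ->; move: (Dop N ps A) => B; elim: N => //= N ->.
by apply/funext => q; rewrite /Msub raddfB.
Qed.

Lemma Dop_comb (K : pzRingType) (X : lmodType K) N ps (c : K) (A B : {ffun I -> int} -> X) p :
  Dop N ps (fun p => c *: A p + B p) p = c *: Dop N ps A p + Dop N ps B p.
Proof.
have -> : Dop N ps (fun p => c *: A p + B p) =
  fun p => c *: Dop N ps A p + Dop N ps B p; last by [].
elim: ps => //= ij ps ->; move: (Dop N ps A) (Dop N ps B) => A' B'.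
by elim: N => //= N ->; apply/funext => q; rewrite /Msub scalerBr opprD addrACA.
Qed.

Lemma eeE i j : ee i j = (j == i)%:R.
Proof. by rewrite ffunE. Qed.

Definition tdeg p : int := \sum_i p i.

Lemma tdeg_ee i : tdeg (ee i) = 1.
Proof.
rewrite /tdeg (bigD1 i)//= eeE eqxx big1 ?addr0// => j ji.
by rewrite eeE (negbTE ji).
Qed.

Lemma tdegD p q : tdeg (p + q) = tdeg p + tdeg q.
Proof. by rewrite /tdeg -big_split; apply: eq_bigr => i _; rewrite ffunE. Qed.

Lemma tdegB p q : tdeg (p - q) = tdeg p - tdeg q.
Proof.
rewrite tdegD; congr (_ + _); rewrite /tdeg -sumrN.
by apply: eq_bigr => i _; rewrite ffunE.
Qed.

(** The pairs of the Vandermonde product of the variables in [r], each taken once and oriented by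
    the order of the list. *)
Fixpoint prs (r : seq I) : seq (I * I) :=
  if r is s :: r' then [seq (s, t) | t <- r'] ++ prs r' else [::].

Lemma prs_split r1 s r2 : exists rest,
  perm_eq (prs (r1 ++ s :: r2)) ([seq (s, t) | t <- r2] ++ rest).
Proof.
elim: r1 => [|t r1 [rest IH]] /=; first by exists (prs r2).
exists ([seq (t, u) | u <- r1 ++ s :: r2] ++ rest).
rewrite perm_sym perm_catCA perm_cat2l perm_sym.
exact: IH.
Qed.

Lemma prs_neq r : uniq r -> forall ij, ij \in prs r -> ij.1 != ij.2.
Proof.
elim: r => //= s r IH /andP[sr ur] ij; rewrite mem_cat => /orP[/mapP[t tr ->]/=|].
  by apply: contraNneq sr => ->.
exact: IH.
Qed.

End FormalDistributions.

(** * Products of several fields and their numerators *)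

Section VertexAlgebra.
Variables (R : realType) (V : vertexAlgebra R).
Implicit Types (u v w : V) (d e k l : int).

Definition Fge d v : Prop := forall k, k < d -> gr_proj V k v = 0.

Lemma Fge_le d e v : e <= d -> Fge d v -> Fge e v.
Proof. by move=> ed h k /lt_le_trans /(_ ed) /h. Qed.

Lemma Fge_exists v : exists d, Fge d v.
Proof.
have [s hs] := gr_sum v; exists (- \sum_(k <- s) `|k|) => k hk.
rewrite hs raddf_sum big_seq big1// => j js; apply: gr_proj0.
apply: contraTneq hk => ->; rewrite -leNgt (big_fsetD1 j)//= lerNl.
by rewrite (le_trans (ler_norm _))// normrN lerDl sumr_ge0.
Qed.

Lemma gr_proj_homogeneous d e v : homogeneous d v -> e != d -> gr_proj V e v = 0.
Proof. by move=> [x ->] h; exact: gr_proj0. Qed.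

Lemma mode_Fge d e k u v : Fge d u -> Fge e v -> Fge (d + e - k - 1) (va_mode u k v).
Proof.
move=> hu hv j hj; have [s us] := gr_sum u; have [t vt] := gr_sum v.
have mode_sum (r : seq int) (F : int -> V) y :
    va_mode (\sum_(i <- r) F i) k y = \sum_(i <- r) va_mode (F i) k y.
  elim: r => [|i r IH]; rewrite ?big_nil ?big_cons.
    have := va_mode_linear (-1) 0 0 k y.
    by rewrite scaleN1r oppr0 addr0 scaleN1r addNr.
  have := va_mode_linear 1 (F i) (\sum_(j <- r) F j) k y.
  by rewrite !scale1r IH.
rewrite us mode_sum raddf_sum big1// => i _.
rewrite vt !raddf_sum big1// => i' _ /=.
have [hi|hi] := ltP i d; first by rewrite hu// !linear0 -(scale0r (0 : V)); have /= := mode_sum [::] (fun=> 0) (gr_inj V i' (gr_proj V i' v)); rewrite !big_nil scale0r => ->; rewrite linear0.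
have [hi'|hi'] := ltP i' e; first by rewrite hv// !linear0.
apply: (@gr_proj_homogeneous (i' + (i - k - 1))).
  by apply: va_mode_degree; [exists (gr_proj V i u) | exists (gr_proj V i' v)].
by rewrite lt_eqF//; lia.
Qed.

Definition loc N u v : Prop := forall w (p q : int), iter N (@mul_x_sub_y V)
  (fun p q => va_mode u (- p - 1) (va_mode v (- q - 1) w)
              - va_mode v (- q - 1) (va_mode u (- p - 1) w)) p q = 0.

Lemma loc_le N M u v : (N <= M)%N -> loc N u v -> loc M u v.
Proof.
move=> NM h w p q; rewrite -(subnK NM) iterD; set F := iter N _ _.
have F0 : F = fun _ _ => 0 by apply/funext => x; apply/funext => y; exact: h.
rewrite F0; elim: (_ - _)%N p q => //= n IH p q.
by rewrite /mul_x_sub_y !IH subrr.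
Qed.

Lemma loc_exists (I : finType) (a : I -> V) :
  exists N, forall i j, loc N (a i) (a j).
Proof.
have /choice[F hF] : forall ij : I * I, exists N, loc N (a ij.1) (a ij.2).
  by move=> ij; exact: va_locality.
exists (\max_ij F ij) => i j; apply: loc_le (hF (i, j)).
exact: (leq_bigmax (i, j)).
Qed.

Variable I : finType.
Implicit Types (a : I -> V) (r : seq I) (p q : {ffun I -> int}).

(* The coefficient of [x^p] in [prod_(i <- r) Y(a i, x_i) v]. *)
Definition Wop a r v p : V := foldr (fun i v => va_mode (a i) (- p i - 1) v) v r.

Lemma Wop_eq a r v p q : (forall i, i \in r -> p i = q i) -> Wop a r v p = Wop a r v q.
Proof.
elim: r => //= i r IH h; rewrite h ?mem_head// IH// => j jr.
by apply: h; rewrite inE jr orbT.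
Qed.

Lemma Wop_cat a r1 r2 v p : Wop a (r1 ++ r2) v p = Wop a r1 (Wop a r2 v p) p.
Proof. by rewrite /Wop foldr_cat. Qed.

Lemma WopZ a r p c v : Wop a r (c *: v) p = c *: Wop a r v p.
Proof. by elim: r => //= i r ->; rewrite linearZ. Qed.

Lemma WopD a r p u v : Wop a r (u + v) p = Wop a r u p + Wop a r v p.
Proof. by elim: r => //= i r ->; rewrite linearD. Qed.

Lemma WopB a r p u v : Wop a r (u - v) p = Wop a r u p - Wop a r v p.
Proof. by elim: r => //= i r ->; rewrite linearB. Qed.

Lemma Wop0 a r p : Wop a r 0 p = 0.
Proof. by elim: r => //= i r ->; rewrite linear0. Qed.

Lemma Wop_Fge a (d : I -> int) r v e p : (forall i, Fge (d i) (a i)) -> Fge e v ->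
  Fge (\sum_(i <- r) (d i + p i) + e) (Wop a r v p).
Proof.
move=> ha hv; elim: r => [|i r IH] /=; first by rewrite big_nil add0r.
rewrite big_cons; apply: Fge_le (mode_Fge (ha i) IH).
by rewrite le_eqVlt; apply/orP; left; apply/eqP; ring.
Qed.

(** Only the exponents at [s] and [t] move, which reduces the operator to the two-variable one in
    the locality axiom. *)
Lemma iter_Msub_pair (X : zmodType) (s t : I) N (B : {ffun I -> int} -> X)
    (F : int -> int -> X) p : s != t ->
  (forall q, (forall u : I, u != s -> u != t -> q u = p u) -> B q = F (q s) (q t)) ->
  iter N (Msub (s, t)) B p = iter N (@mul_x_sub_y X) F (p s) (p t).
Proof.
move=> st; have ts : t == s = false by rewrite eq_sym; exact: negbTE.
elim: N p => [|N IH] p hB /=; first exact: hB.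
have shift (x : I) : x \in [:: s; t] -> forall q,
   (forall u : I, u != s -> u != t -> q u = (p - ee x) u) -> B q = F (q s) (q t).
  move=> hx q hq; apply: hB => u us ut; rewrite hq// !ffunE.
  by move: hx; rewrite !inE => /orP[]/eqP ->; rewrite ?(negbTE us) ?(negbTE ut) subr0.
rewrite /Msub /mul_x_sub_y /= IH; last by apply: shift; rewrite inE eqxx.
rewrite IH; last by apply: shift; rewrite !inE eqxx orbT.
by rewrite !ffunE !eqxx ts (negbTE st) !subr0.
Qed.

Lemma Wop_swap a s t r v N : s != t -> s \notin r -> t \notin r ->
  loc N (a s) (a t) ->
  iter N (Msub (s, t)) (Wop a (s :: t :: r) v) =
  iter N (Msub (s, t)) (Wop a (t :: s :: r) v).
Proof.
move=> st sr tr hl; apply/funext => p; apply/eqP; rewrite -subr_eq0; apply/eqP.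
pose B q := Wop a (s :: t :: r) v q - Wop a (t :: s :: r) v q.
have hB : iter N (Msub (s, t)) B = fun p => iter N (Msub (s, t)) (Wop a (s :: t :: r) v) p
   - iter N (Msub (s, t)) (Wop a (t :: s :: r) v) p.
  elim: (N) => //= n ->; apply/funext => q; rewrite /Msub !opprB addrACA [in RHS]addrACA.
  by congr (_ + _); exact: addrC.
rewrite -[LHS]/((fun p => _ - _) p) -hB.
rewrite (iter_Msub_pair N (F := fun x y => va_mode (a s) (- x - 1) (va_mode (a t) (- y - 1) (Wop a r v p))
   - va_mode (a t) (- y - 1) (va_mode (a s) (- x - 1) (Wop a r v p))) st).
  exact: hl.
move=> q hq; rewrite /B /= (@Wop_eq a r v q p)// => i ir; apply: hq.
  by apply: contraNneq sr => <-.
by apply: contraNneq tr => <-.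
Qed.

(** [f q] stands for fields to the left whose variables do not occur in [ps]; multiplication by the
    factors in [ps] passes through them. *)
Lemma Dop_prefix (X : zmodType) (f : {ffun I -> int} -> X -> X) N (ps : seq (I * I)) A p :
  (forall q, zmod_morphism (f q)) ->
  (forall ij, ij \in ps -> forall q, f (q - ee ij.1) = f q /\ f (q - ee ij.2) = f q) ->
  Dop N ps (fun q => f q (A q)) p = f p (Dop N ps A p).
Proof.
move=> fB hf.
have -> : Dop N ps (fun q => f q (A q)) = fun q => f q (Dop N ps A q); last by [].
elim: ps hf => //= ij ps IH hf; rewrite IH; last first.
  by move=> kl h; apply: hf; rewrite inE h orbT.
move: (Dop N ps A) => B {IH}; elim: N => //= n ->; apply/funext => q; rewrite /Msub fB.
by have [-> ->] := hf ij (mem_head _ _) q.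
Qed.

(* Locality moves [a s] next to the vacuum, where creation applies. *)
Lemma Wop_last_pos a N s r : (forall i j, loc N (a i) (a j)) -> uniq r -> s \notin r ->
  forall p, p s < 0 -> Dop N [seq (s, t) | t <- r] (Wop a (s :: r) (va_vac V)) p = 0.
Proof.
move=> hl; elim: r => [|t r IH] /=.
  move=> _ _ p ps; rewrite (proj2 (va_creation (a s)))//.
  by move: (p s) ps => x; lia.
case/andP => tr ur; rewrite inE negb_or => /andP[st sr] p ps.
rewrite -[Wop a (s :: t :: r) _]/(Wop a (s :: t :: r) _).
rewrite -Dop_iter (Wop_swap _ st sr tr (hl _ _)) Dop_iter.
have hS (B : {ffun I -> int} -> V) : (forall q, q s < 0 -> B q = 0) ->
   forall q, q s < 0 -> iter N (Msub (s, t)) B q = 0.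
  move=> hB; apply: (@Dop_closed I V (fun q => q s < 0) N [:: (s, t)]) => // q i qs.
  by rewrite !ffunE; case: eqP => _; move: (q s) qs => x; lia.
apply: hS ps => q qs.
rewrite (@Dop_prefix V (fun q => va_mode (a t) (- q t - 1)) N _ (Wop a (s :: r) (va_vac V)) q).
- by rewrite IH// raddf0.
- by move=> q' u v; rewrite raddfB.
move=> _ /mapP[u ur' ->] q' /=; rewrite !ffunE eq_sym (negbTE st) subr0.
by rewrite (_ : t == u = false) ?subr0//; apply: contraNF tr => /eqP ->.
Qed.

(** The factors pairing [s] with the variables to its right are enough to bring [a s] to the vacuum.
    The fields to its left are a prefix, and the remaining factors preserve the vanishing by
    [Dop_closed]. *)
Lemma Wop_pos a N r s p : (forall i j, loc N (a i) (a j)) -> uniq r -> s \in r ->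
  p s < 0 -> Dop N (prs r) (Wop a r (va_vac V)) p = 0.
Proof.
move=> hl ur sr ps; case/splitPr: sr ur => r1 r2 ur.
have [rest hr] := prs_split r1 s r2.
have hr' : perm_eq (prs (r1 ++ s :: r2)) (rest ++ [seq (s, t) | t <- r2]).
  by rewrite (permPl hr) perm_catC.
rewrite (Dop_perm _ _ hr') Dop_cat; apply: (@Dop_closed I V (fun q => q s < 0)) ps => [q i|q qs].
  by rewrite !ffunE; case: eqP => _; move: (q s) => x; lia.
have -> : Wop a (r1 ++ s :: r2) (va_vac V) = fun q => Wop a r1 (Wop a (s :: r2) (va_vac V) q) q.
  by apply/funext => q'; rewrite Wop_cat.
move: ur; rewrite cat_uniq => /and3P[_ /hasPn disj].
rewrite cons_uniq => /andP[sr2 ur2].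
have notin1 t : t \in s :: r2 -> t \notin r1 by exact: disj.
rewrite (@Dop_prefix V (fun q v => Wop a r1 v q)).
- by rewrite Wop_last_pos// Wop0.
- by move=> q' u v; exact: WopB.
move=> _ /mapP[t tr2 ->] q' /=.
split; apply/funext => v; apply: Wop_eq => i ir1; rewrite !ffunE.
  by rewrite (_ : i == s = false) ?subr0//; apply: contraTF ir1 => /eqP ->; rewrite notin1 ?mem_head.
rewrite (_ : i == t = false) ?subr0//; apply: contraTF ir1 => /eqP ->.
by rewrite notin1// inE tr2 orbT.
Qed.

(** [P] is instantiated by a lower bound on degrees and by concentration in one degree. Each factor
    [x_i - x_j] lowers by one the degree attached to a given exponent. *)
Lemma Dop_degree (P : int -> V -> Prop) N (ps : seq (I * I)) (A : {ffun I -> int} -> V) c :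
  (forall d u v, P d u -> P d v -> P d (u - v)) ->
  (forall p, P (c + tdeg p) (A p)) ->
  forall p, P (c - (N * size ps)%:Z + tdeg p) (Dop N ps A p).
Proof.
move=> PB hA.
have step (ij : I * I) B c' : (forall p, P (c' + tdeg p) (B p)) ->
    forall p, P (c' - 1 + tdeg p) (Msub ij B p).
  move=> hB p; rewrite /Msub; apply: PB.
    by have := hB (p - ee ij.1); rewrite tdegB tdeg_ee addrA addrAC.
  by have := hB (p - ee ij.2); rewrite tdegB tdeg_ee addrA addrAC.
have stepN (ij : I * I) n B c' : (forall p, P (c' + tdeg p) (B p)) ->
    forall p, P (c' - n%:Z + tdeg p) (iter n (Msub ij) B p).
  move=> hB; elim: n => [|n IH] /=; first by rewrite subr0.
  move=> p; have := step ij _ _ IH p.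
  by rewrite -addn1 PoszD opprD addrA.
elim: ps => [|ij ps IH] /=; first by rewrite muln0 subr0.
move=> p; have := stepN ij N _ _ IH p.
by rewrite mulnS PoszD opprD [- N%:Z - _]addrC addrA.
Qed.

(** By the translation axiom and [T vac = 0], [T] acts as the sum of the partial derivatives; the
    right-hand side is the coefficient of [x^p] in it. *)
Lemma va_T_Wop a r p : uniq r ->
  va_T V (Wop a r (va_vac V) p) =
  \sum_(i <- r) (p i + 1)%:~R *: Wop a r (va_vac V) (p + ee i).
Proof.
elim: r => [|i r IH] /=; first by rewrite big_nil va_T_vac.
case/andP => ir ur; rewrite big_cons.
have := va_translation (a i) (- p i - 1) (Wop a r (va_vac V) p).
move/eqP; rewrite subr_eq => /eqP ->; rewrite IH// !linear_sum.
congr (_ + _).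
  rewrite !ffunE eqxx (@Wop_eq a r _ (p + ee i) p).
    by congr ((_)%:~R *: va_mode (a i) _ _); rewrite ?mulr1n; ring.
  move=> j jr; rewrite !ffunE (_ : j == i = false) ?addr0//.
  by apply: contraTF jr => /eqP ->.
rewrite big_seq [RHS]big_seq; apply: eq_bigr => j jr.
rewrite linearZ; congr (_ *: va_mode (a i) _ _).
rewrite !ffunE (_ : i == j = false) ?addr0//.
by apply: contraTF jr => /eqP <-.
Qed.

(* The numerator of [mu]; its components are polynomials when [N] is large. *)
Definition Mv a N : {ffun I -> int} -> V :=
  Dop N (prs (enum I)) (Wop a (enum I) (va_vac V)).

Lemma Mv_pos a N s p : (forall i j, loc N (a i) (a j)) -> p s < 0 -> Mv a N p = 0.
Proof. by move=> hl; apply: Wop_pos hl (enum_uniq I) _; rewrite mem_enum. Qed.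

Lemma Mv_Fge a N : exists c, forall p, Fge (c + tdeg p) (Mv a N p).
Proof.
have /choice[d hd] : forall i, exists d, Fge d (a i) by move=> i; exact: Fge_exists.
have [e he] := Fge_exists (va_vac V).
pose c := \sum_i d i + e; exists (c - (N * size (prs (enum I)))%:Z).
apply: Dop_degree => [d' u v hu hv k hk|p]; first by rewrite linearB /= hu// hv// subrr.
apply: Fge_le (Wop_Fge hd he).
by rewrite big_enum /= big_split /= /c /tdeg addrAC.
Qed.

Lemma Mv_homogeneous a N (d : I -> int) p k : (forall i, homogeneous (d i) (a i)) ->
  k != \sum_i d i - (N * size (prs (enum I)))%:Z + tdeg p -> gr_proj V k (Mv a N p) = 0.
Proof.
move=> ha hk.
pose P e v := forall k, k != e -> gr_proj V k v = 0.
suff : forall p, P (\sum_i d i - (N * size (prs (enum I)))%:Z + tdeg p) (Mv a N p) by apply.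
apply: Dop_degree => {p k hk}[e u v hu hv k hk|p k hk]; first by rewrite linearB /= hu// hv// subrr.
apply: gr_proj_homogeneous hk.
have -> : \sum_i d i + tdeg p = \sum_(i <- enum I) (d i + p i) by rewrite big_enum big_split.
elim: (enum I) => [|i r IH]; first by rewrite big_nil; exact: va_vac_degree.
rewrite big_cons /=; have := va_mode_degree (- p i - 1) (ha i) IH.
by congr homogeneous; ring.
Qed.

(** The sum of the partial derivatives kills every [x_i - x_j], hence commutes with multiplication
    by it. *)
Lemma va_T_Mv a N p :
  va_T V (Mv a N p) = \sum_i (p i + 1)%:~R *: Mv a N (p + ee i).
Proof.
pose dT (A : {ffun I -> int} -> V) p := \sum_i (p i + 1)%:~R *: A (p + ee i).
have dTM ij A : dT (Msub ij A) = Msub ij (dT A).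
  apply/funext => q; rewrite /dT /Msub.
  under eq_bigr do rewrite scalerBr.
  rewrite sumrB.
  have key (x : I) : \sum_i (q i + 1)%:~R *: A (q + ee i - ee x)
     = \sum_i ((q - ee x) i + 1)%:~R *: A (q - ee x + ee i) + A q.
    rewrite (bigD1 x)//= [in RHS](bigD1 x)//= [RHS]addrAC; congr (_ + _).
      by rewrite addrK subrK !ffunE eqxx subrK intrD scalerDl scale1r.
    apply: eq_bigr => i ix; rewrite !ffunE (negbTE ix) subr0.
    by rewrite addrAC.
  by rewrite !key opprD addrACA subrr addr0.
have dTD ps A : dT (Dop N ps A) = Dop N ps (dT A).
  elim: ps => //= ij ps <-; elim: (N) (Dop N ps A) => //= n IH B.
  by rewrite dTM IH.
rewrite /Mv -Dop_additive -[RHS]/(dT _ p) dTD; congr (Dop N _ _ p).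
by apply/funext => q; apply: (etrans (va_T_Wop a q (enum_uniq I))); rewrite big_enum.
Qed.

Lemma Mv_linear N (c : R[i]) a a' a'' (s : I) p :
  (forall i, i != s -> a' i = a i /\ a'' i = a i) -> a'' s = c *: a s + a' s ->
  Mv a'' N p = c *: Mv a N p + Mv a' N p.
Proof.
move=> h hs; rewrite /Mv -Dop_comb; congr (Dop N _ _ p); apply/funext => q.
have : s \in enum I by rewrite mem_enum.
elim: (enum I) (enum_uniq I) => //= i r IH /andP[ir ur].
have [si|si] := eqVneq s i; last first.
  rewrite in_cons (negbTE si) /= => sr; rewrite eq_sym in si.
  by have [-> ->] := h _ si; rewrite IH// linearP.
rewrite -{}si in ir *; move=> _; have Wr (b : I -> V) : (forall i, i \in r -> b i = a i) -> Wop b r (va_vac V) q = Wop a r (va_vac V) q.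
  move=> hb; elim: r hb {IH ir ur} => //= j r IH hb.
  by rewrite hb ?mem_head// IH// => k kr; apply: hb; rewrite inE kr orbT.
have nes j : j \in r -> j != s by move=> jr; apply: contraNneq ir => <-.
rewrite (Wr a'); last by move=> j /nes/h[].
rewrite (Wr a''); last by move=> j /nes/h[].
by rewrite hs va_mode_linear.
Qed.

End VertexAlgebra.

(** * Evaluation of polynomial distributions *)

Section FiniteSums.
Variables (T : choiceType) (X : zmodType).
Implicit Types (A B : T -> X).

Definition fs A : Prop := exists S : {fset T}, forall p, p \notin S -> A p = 0.

Definition fsum A : X := \sum_(p \in [set: T]) A p.

Lemma fsumE (S : {fset T}) A : (forall p, p \notin S -> A p = 0) ->
  fsum A = \sum_(p <- S) A p.
Proof. exact: fsbigTE. Qed.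

Lemma fs_sum2 A B : fs A -> fs B -> exists S : {fset T},
  (forall p, p \notin S -> A p = 0) /\ (forall p, p \notin S -> B p = 0).
Proof.
move=> [S hS] [S' hS']; exists (S `|` S')%fset.
by split=> p; rewrite inE negb_or => /andP[h h']; [apply: hS|apply: hS'].
Qed.

Lemma fsB A B : fs A -> fs B -> fs (fun p => A p - B p).
Proof.
move=> hA hB; have [S [h1 h2]] := fs_sum2 hA hB.
by exists S => p hp; rewrite h1// h2// subrr.
Qed.

Lemma fsD A B : fs A -> fs B -> fs (fun p => A p + B p).
Proof.
move=> hA hB; have [S [h1 h2]] := fs_sum2 hA hB.
by exists S => p hp; rewrite h1// h2// addr0.
Qed.

Lemma fsumB A B : fs A -> fs B -> fsum (fun p => A p - B p) = fsum A - fsum B.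
Proof.
move=> hA hB; have [S [h1 h2]] := fs_sum2 hA hB.
rewrite (fsumE h1) (fsumE h2) (@fsumE S) ?sumrB// => p hp.
by rewrite h1// h2// subrr.
Qed.

Lemma fsumD A B : fs A -> fs B -> fsum (fun p => A p + B p) = fsum A + fsum B.
Proof.
move=> hA hB; have [S [h1 h2]] := fs_sum2 hA hB.
rewrite (fsumE h1) (fsumE h2) (@fsumE S) ?big_split// => p hp.
by rewrite h1// h2// addr0.
Qed.

Lemma fsum0 A : (forall p, A p = 0) -> fsum A = 0.
Proof. by move=> h; apply: fsbig1 => p _; exact: h. Qed.

Lemma eq_fsum A B : (forall p, A p = B p) -> fsum A = fsum B.
Proof. by move=> h; congr fsum; apply/funext. Qed.

End FiniteSums.

Lemma fs_map (T : choiceType) (X X' : zmodType) (f : T -> X -> X') (A : T -> X) :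
  (forall p, f p 0 = 0) -> fs A -> fs (fun p => f p (A p)).
Proof. by move=> f0 [S hS]; exists S => p /hS ->. Qed.

Lemma fsum_morph (T : choiceType) (X X' : zmodType) (f : X -> X') (A : T -> X) :
  f 0 = 0 -> {morph f : x y / x + y} -> fs A ->
  f (fsum A) = fsum (fun p => f (A p)).
Proof.
move=> f0 fD [S hS]; rewrite (fsumE hS) (@fsumE _ _ S).
  by rewrite (big_morph f fD f0).
by move=> p /hS ->.
Qed.

Lemma fsum_reindex (T T' : choiceType) (X : zmodType) (h : T -> T') (A : T' -> X) :
  bijective h -> fsum A = fsum (A \o h).
Proof. exact: reindex_fsbigT. Qed.

Lemma fs_reindex (T T' : choiceType) (X : zmodType) (h : T -> T') (A : T' -> X) :
  bijective h -> fs A -> fs (A \o h).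
Proof.
move=> [g gh hg] [S hS]; exists [fset g x | x in S]%fset => p hp.
by apply: hS; apply: contra hp => hp; apply/imfsetP; exists (h p).
Qed.

Lemma fsum_sum (T : choiceType) (J : Type) (s : seq J) (X : zmodType) (A : J -> T -> X) :
  (forall j, fs (A j)) ->
  fs (fun p => \sum_(j <- s) A j p) /\
  fsum (fun p => \sum_(j <- s) A j p) = \sum_(j <- s) fsum (A j).
Proof.
move=> hA; elim: s => [|j s [IH1 IH2]].
  split; first by exists fset0 => p _; rewrite big_nil.
  by rewrite big_nil fsum0// => p; rewrite big_nil.
have -> : (fun p => \sum_(j <- j :: s) A j p) = fun p => A j p + \sum_(j <- s) A j p.
  by apply/funext => p; rewrite big_cons.
by split; [exact: fsD | rewrite fsumD// IH2 big_cons].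
Qed.

Lemma bij_addr (X : zmodType) (x : X) : bijective (fun y => y + x).
Proof. by exists (fun y => y - x) => y; rewrite ?addrK ?subrK. Qed.

Section Evaluation.
Variables (R : realType) (I : finType) (X : lmodType R[i]).
Implicit Types (z : I -> R[i]) (p : {ffun I -> int}) (A B : {ffun I -> int} -> X)
  (ps : seq (I * I)) (N : nat).

Definition mono z p : R[i] := \prod_i z i ^ p i.

(** The condition for [z^(p + e_i) = z_i z^p]. It excludes negative powers of [0], which are [0] by
    convention: at [z_i = 0] the rule fails for exponent [-1]. *)
Definition ok_exp z p : Prop := forall i, z i != 0 \/ 0 <= p i.

Lemma ok_exp_neq0 z p : (forall i, z i != 0) -> ok_exp z p.
Proof. by move=> h i; left. Qed.

Lemma ok_exp_sub z p i : ok_exp z (p - ee i) -> ok_exp z p.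
Proof.
move=> h j; case: (h j) => [->|]; [by left|right].
by move: b; rewrite !ffunE; case: eqP => _ /=; move: (p j) => x; lia.
Qed.

Lemma mono_ee z p i : ok_exp z p -> mono z (p + ee i) = z i * mono z p.
Proof.
move=> h; rewrite /mono (bigD1 i)//= [in RHS](bigD1 i)//= mulrA; congr (_ * _).
  rewrite !ffunE eqxx; case: (h i) => [zi|]; first by rewrite expfzDr// mulrC.
  by case: (p i) => // n _; rewrite -exprSz -addn1.
by apply: eq_bigr => j ji; rewrite !ffunE (negbTE ji) addr0.
Qed.

Lemma mono_sub z p i : ok_exp z (p - ee i) -> mono z p = z i * mono z (p - ee i).
Proof. by move=> /mono_ee <-; rewrite subrK. Qed.

Definition ev z A : X := fsum (fun p => mono z p *: A p).

Lemma fs_mono z A : fs A -> fs (fun p => mono z p *: A p).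
Proof. by apply: (fs_map (f := fun p x => mono z p *: x)) => p; rewrite scaler0. Qed.

Lemma ev_shift z A i : fs A -> (forall p, A p != 0 -> ok_exp z p) ->
  ev z (fun p => A (p - ee i)) = z i *: ev z A.
Proof.
move=> hA hz; rewrite /ev (fsum_morph (f := fun x => z i *: x)).
- rewrite (fsum_reindex _ (bij_addr (ee i))); apply: eq_fsum => p /=.
  rewrite addrK scalerA; have [->|A0] := eqVneq (A p) 0; first by rewrite !scaler0.
  by rewrite mono_ee//; exact: hz.
- by rewrite scaler0.
- by move=> x y; rewrite scalerDr.
exact: fs_mono.
Qed.

Lemma fs_shift A (q : {ffun I -> int}) : fs A -> fs (fun p => A (p - q)).
Proof. exact: fs_reindex (bij_addr (- q)). Qed.

Lemma fs_Msub ij A : fs A -> fs (Msub ij A).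
Proof. by move=> hA; apply: fsB; exact: fs_shift. Qed.

Lemma ev_Msub z A ij : fs A -> (forall p, A p != 0 -> ok_exp z p) ->
  ev z (Msub ij A) = (z ij.1 - z ij.2) *: ev z A.
Proof.
move=> hA hz; rewrite scalerBl -!ev_shift// /ev -fsumB.
- by apply: eq_fsum => p; rewrite -scalerBr.
- exact/fs_mono/fs_shift.
- exact/fs_mono/fs_shift.
Qed.

Definition DD N ps z : R[i] := \prod_(ij <- ps) (z ij.1 - z ij.2) ^+ N.

Lemma DD_cat N ps qs z : DD N (ps ++ qs) z = DD N ps z * DD N qs z.
Proof. by rewrite /DD big_cat. Qed.

Lemma DD_perm N ps qs z : perm_eq ps qs -> DD N ps z = DD N qs z.
Proof. by move=> h; rewrite /DD (perm_big _ h). Qed.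

Lemma DD_addn N M ps z : DD (N + M) ps z = DD N ps z * DD M ps z.
Proof. by rewrite /DD -big_split; apply: eq_bigr => ij _; rewrite exprD. Qed.

Lemma DD_neq0 N ps z : (forall ij, ij \in ps -> z ij.1 != z ij.2) -> DD N ps z != 0.
Proof.
move=> h; rewrite /DD; elim: ps h => [|ij ps IH] h; first by rewrite big_nil oner_eq0.
rewrite big_cons mulf_neq0//.
  by rewrite expf_neq0// subr_eq0; apply: h; rewrite mem_head.
by apply: IH => kl hkl; apply: h; rewrite inE hkl orbT.
Qed.

Lemma ev_Dop z A N ps : fs A -> (forall p, A p != 0 -> ok_exp z p) ->
  [/\ fs (Dop N ps A), forall p, Dop N ps A p != 0 -> ok_exp z p
    & ev z (Dop N ps A) = DD N ps z *: ev z A].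
Proof.
move=> hA hz; elim: ps => [|ij ps [IH1 IH2 IH3]].
  by split=> //; rewrite /DD big_nil scale1r.
rewrite /= /DD big_cons -/(DD N ps z) -scalerA -IH3.
elim: N (Dop N ps A) IH1 IH2 {IH3} => [|N IHN] B h1 h2.
  by split=> //; rewrite expr0 scale1r.
have [k1 k2 k3] := IHN B h1 h2.
split=> /=; first exact: fs_Msub.
- move=> p; rewrite /Msub.
  have [h0|/k2 /ok_exp_sub//] := eqVneq (iter N (Msub ij) B (p - ee ij.1)) 0.
  have [h0'|/k2 /ok_exp_sub//] := eqVneq (iter N (Msub ij) B (p - ee ij.2)) 0.
  by rewrite h0 h0' subrr eqxx.
by rewrite ev_Msub// k3 scalerA exprS.
Qed.

End Evaluation.

(** * Convergent series multiplied by polynomials *)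

Section UnorderedSums.
Variables (R : realType) (X : lmodType R[i]) (Y : set X) (nu : X -> R).
Hypotheses (hY : findim_subspace Y) (hnu : norm_on Y nu).

(** Unlike in [has_sum], the subspace and the norm are fixed, so that two such sums can be
    subtracted. *)
Definition usum (J : choiceType) (g : J -> X) (s : X) : Prop :=
  [/\ forall j, Y (g j), Y s & forall e, 0 < e -> exists A0 : {fset J},
     forall A : {fset J}, (A0 `<=` A)%fset -> nu (\sum_(j <- A) g j - s) <= e].

Lemma subspace_comb c x y : Y x -> Y y -> Y (c *: x + y).
Proof.
have [d [b ->]] := hY; move=> [f ->] [g ->]; exists (fun i => c * f i + g i).
rewrite scaler_sumr -big_split; apply: eq_bigr => i _ /=.
by rewrite scalerDl scalerA.
Qed.

Lemma subspace0 : Y 0.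
Proof.
have [d [b ->]] := hY; exists (fun=> 0).
by rewrite big1// => i _; rewrite scale0r.
Qed.

Lemma subspaceZ c x : Y x -> Y (c *: x).
Proof. by move=> hx; rewrite -[_ *: _]addr0; apply: subspace_comb => //; exact: subspace0. Qed.

Lemma subspaceB x y : Y x -> Y y -> Y (x - y).
Proof. by move=> hx hy; rewrite addrC -scaleN1r; exact: subspace_comb. Qed.

Lemma subspace_sum (J : Type) (s : seq J) (g : J -> X) :
  (forall j, Y (g j)) -> Y (\sum_(j <- s) g j).
Proof.
move=> hg; elim: s => [|j s IH]; first by rewrite big_nil; exact: subspace0.
by rewrite big_cons -[g j]scale1r; exact: subspace_comb.
Qed.

Lemma usum_eq (J : choiceType) (g g' : J -> X) s :
  (forall j, g j = g' j) -> usum g s -> usum g' s.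
Proof. by move=> /funext ->. Qed.

Lemma usumZ (J : choiceType) (g : J -> X) s c :
  usum g s -> usum (fun j => c *: g j) (c *: s).
Proof.
move=> [h1 h2 h3]; split; [by move=> j; exact: subspaceZ | exact: subspaceZ |].
move=> e e0; have D0 : 0 < cmod c + 1 by rewrite ltr_wpDl ?cmod_ge0.
have [A0 hA0] := h3 _ (divr_gt0 e0 D0); exists A0 => A /hA0 hA.
have [n1 n2 n3 n4] := hnu.
have YA : Y (\sum_(j <- A) g j - s) by apply: subspaceB => //; exact: subspace_sum.
rewrite -scaler_sumr -scalerBr n3// -/(cmod c).
apply: le_trans (ler_wpM2l (cmod_ge0 c) hA) _.
by rewrite mulrA ler_pdivrMr// mulrC ler_wpM2l ?(ltW e0)// lerDl.
Qed.

Lemma usumB (J : choiceType) (g g' : J -> X) s s' :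
  usum g s -> usum g' s' -> usum (fun j => g j - g' j) (s - s').
Proof.
move=> [h1 h2 h3] [h1' h2' h3']; split; [by move=> j; exact: subspaceB | exact: subspaceB |].
have [n1 n2 n3 n4] := hnu.
move=> e e0; have e20 : 0 < e / 2 by lra.
have [A0 hA0] := h3 _ e20; have [A1 hA1] := h3' _ e20.
exists (A0 `|` A1)%fset => A; rewrite fsubUset => /andP[/hA0 k0 /hA1 k1].
have YA : Y (\sum_(j <- A) g j - s) by apply: subspaceB => //; exact: subspace_sum.
have YA' : Y (\sum_(j <- A) g' j - s') by apply: subspaceB => //; exact: subspace_sum.
have -> : \sum_(j <- A) (g j - g' j) - (s - s') =
   (\sum_(j <- A) g j - s) + (-1) *: (\sum_(j <- A) g' j - s').
  by rewrite sumrB scaleN1r !opprB addrACA [in RHS]addrACA; congr (_ + _); rewrite addrC.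
apply: le_trans (n4 _ _ YA (subspaceZ _ YA')) _.
by rewrite n3// -/(cmod _) cmodN cmod1 mul1r (splitr e) lerD.
Qed.

Lemma usum_reindex (J J' : choiceType) (f : J' -> J) (g : J -> X) s :
  bijective f -> usum g s -> usum (g \o f) s.
Proof.
move=> [h fK hK] [h1 h2 h3]; split=> // [j|e /h3[A0 hA0]]; first exact: h1.
exists [fset h x | x in A0]%fset => A hA.
have -> : \sum_(j <- A) (g \o f) j = \sum_(j <- [fset f x | x in A]%fset) g j.
  by rewrite big_imfset//= => x y _ _ /(can_inj fK).
apply: hA0; apply/fsubsetP => x xA0; apply/imfsetP; exists (h x); last by rewrite hK.
by apply: (fsubsetP hA); apply/imfsetP; exists x.
Qed.

Lemma usum_finite (J : choiceType) (g : J -> X) s : fs g -> usum g s -> s = fsum g.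
Proof.
move=> [S hS] [h1 h2 h3]; rewrite (fsumE hS).
have [n1 n2 n3 n4] := hnu.
have YA : Y (\sum_(j <- S) g j - s) by apply: subspaceB => //; exact: subspace_sum.
apply/esym/eqP; rewrite -subr_eq0; apply/eqP; apply: n2 => //.
apply/eqP; rewrite eq_le n1// andbT; apply/ler_addgt0Pl => e /h3[A0 hA0].
rewrite addr0; have := hA0 _ (fsubsetUl A0 S).
by rewrite -(@fsumE _ _ (A0 `|` S)%fset g) ?(fsumE hS)// => j; rewrite inE negb_or => /andP[_ /hS].
Qed.

Lemma usum_Msub (I : finType) (z : I -> R[i]) (A : {ffun I -> int} -> X) s ij :
  (forall i, z i != 0) -> usum (fun p => mono z p *: A p) s ->
  usum (fun p => mono z p *: Msub ij A p) ((z ij.1 - z ij.2) *: s).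
Proof.
move=> hz hs; rewrite scalerBl.
have shift i : usum (fun p => mono z p *: A (p - ee i)) (z i *: s).
  have := usumZ (z i) (usum_reindex (bij_addr (- ee i)) hs).
  apply: usum_eq => p /=; rewrite scalerA -mono_sub//; exact: ok_exp_neq0.
have := usumB (shift ij.1) (shift ij.2).
by apply: usum_eq => p; rewrite -scalerBr.
Qed.

(** Formal multiplication by a polynomial multiplies the value of a convergent series. It turns the
    defining series of [mu] into the finite sum over the numerator; nonzero [z_i] are required for
    the shifts of negative exponents. *)
Lemma usum_Dop (I : finType) (z : I -> R[i]) (A : {ffun I -> int} -> X) s N ps :
  (forall i, z i != 0) -> usum (fun p => mono z p *: A p) s ->
  usum (fun p => mono z p *: Dop N ps A p) (DD N ps z *: s).
Proof.
move=> hz hs; elim: ps => [|ij ps IH]; first by rewrite /DD big_nil scale1r.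
rewrite /DD big_cons -/(DD N ps z) -scalerA /=; move: (Dop N ps A) (DD N ps z *: s) IH.
move=> B t; elim: N => [|N IHN] ht /=; first by rewrite expr0 scale1r.
by rewrite exprS -scalerA; apply: usum_Msub => //; exact: IHN.
Qed.

End UnorderedSums.

Lemma has_sum_usum (R : realType) (X : lmodType R[i]) (J : choiceType) (g : J -> X) s :
  has_sum g s -> exists Y nu, [/\ findim_subspace Y, norm_on Y nu & usum Y nu g s].
Proof.
move=> [Y [nu [h1 h2 h3 h4 h5]]]; exists Y, nu; split=> //; split=> // e e0.
have [n1 n2 n3 n4] := h2.
have FT : Filter (@summability.totally J) by exact: summability.totally_filter.
move/cvgrPdist_le: h5 => /(_ e e0) [A0 _ hA0]; exists A0 => A /hA0 /=.
rewrite sub0r normrN /summability.partial_sum (big_seq_fsetE _ A predT g) => hA.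
exact: le_trans (ler_norm _) hA.
Qed.

Lemma prs_mem (I : finType) (r : seq I) i j : i \in r -> j \in r -> i != j ->
  ((i, j) \in prs r) || ((j, i) \in prs r).
Proof.
elim: r => //= s r IH; rewrite !inE !mem_cat => /predU1P[->|ir] /predU1P[->|jr].
- by rewrite eqxx.
- by move=> _; rewrite map_f.
- by move=> _; rewrite (map_f (pair s) ir) orbT.
- by move=> ij; case/orP: (IH ir jr ij) => ->; rewrite !orbT.
Qed.

Section FatDiagonal.
Variables (R : realType) (m : nat).
Implicit Types z : 'rV[R[i]]_m.

Lemma not_fat_diagonalP z : ~ fat_diagonal z <-> forall i j, i != j -> z 0 i != z 0 j.
Proof.
split=> [h i j ij|h [i [j [ij /eqP e]]]]; last by move: (h _ _ ij); rewrite e.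
by apply: contra_notN h => /eqP e; exists i, j.
Qed.

Lemma DD_neq0_fat N z : ~ fat_diagonal z -> DD N (prs (enum 'I_m)) (z 0) != 0.
Proof.
move=> /not_fat_diagonalP h; apply: DD_neq0 => ij hij; apply: h.
exact: prs_neq (enum_uniq _) _ hij.
Qed.

Lemma fat_diagonal_DD z : DD 1 (prs (enum 'I_m)) (z 0) != 0 -> ~ fat_diagonal z.
Proof.
move=> h [i [j [ij zij]]]; case/negP: h; rewrite /DD prodf_seq_eq0.
have := prs_mem (mem_enum _ i) (mem_enum _ j) ij.
by case/orP => h; apply/hasP; eexists; try exact: h; rewrite /= zij subrr.
Qed.

End FatDiagonal.

(** * Holomorphic scalar functions of several variables *)

Section DifferentiableScalars.
Variables (R : realType) (E : normedModType R[i]).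
Implicit Types (f : E -> R[i]^o).

Lemma differentiable_prod (J : Type) (s : seq J) (h : J -> E -> R[i]^o) x :
  (forall j, differentiable (h j) x) ->
  differentiable (fun y => \prod_(j <- s) h j y : R[i]^o) x.
Proof.
move=> hh; elim: s => [|j s IH].
  have -> : (fun y => \prod_(j <- [::]) h j y : R[i]^o) = cst 1.
    by apply/funext => y; rewrite big_nil.
  exact: differentiable_cst.
have -> : (fun y => \prod_(j <- j :: s) h j y : R[i]^o) =
   h j * (fun y => \prod_(j <- s) h j y : R[i]^o).
  by apply/funext => y; rewrite big_cons.
exact: differentiableM.
Qed.

Lemma differentiable_sub f g x : differentiable f x -> differentiable g x ->
  differentiable (fun y => f y - g y : R[i]^o) x.
Proof. exact: differentiableB. Qed.

Lemma differentiable_mul f g x : differentiable f x -> differentiable g x ->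
  differentiable (fun y => f y * g y : R[i]^o) x.
Proof. exact: differentiableM. Qed.

Lemma differentiable_pow f n x : differentiable f x ->
  differentiable (fun y => f y ^+ n : R[i]^o) x.
Proof.
move=> hf; elim: n => [|n IH].
  have -> : (fun y => f y ^+ 0 : R[i]^o) = cst 1 by apply/funext => y; rewrite expr0.
  exact: differentiable_cst.
have -> : (fun y => f y ^+ n.+1 : R[i]^o) = fun y => f y * f y ^+ n.
  by apply/funext => y; rewrite exprS.
exact: differentiable_mul.
Qed.

Lemma differentiable_inv f x : differentiable f x -> f x != 0 ->
  differentiable (fun y => (f y)^-1 : R[i]^o) x.
Proof. exact: differentiableV. Qed.

Lemma differentiable_DD (I : finType) N ps (z : I -> E -> R[i]^o) x :
  (forall i, differentiable (z i) x) ->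
  differentiable (fun y => DD N ps (fun i => z i y) : R[i]^o) x.
Proof.
move=> hz; apply: differentiable_prod => ij; apply: differentiable_pow.
exact: differentiable_sub.
Qed.

(* Equal to [mono] for nonnegative exponents, but holomorphic everywhere. *)
Definition nmono (I : finType) (z : I -> R[i]) (p : {ffun I -> int}) : R[i] :=
  \prod_i z i ^+ `|p i|%N.

Lemma nmonoE (I : finType) (z : I -> R[i]) (p : {ffun I -> int}) : (forall i, 0 <= p i) -> mono z p = nmono z p.
Proof. by move=> h; apply: eq_bigr => i _; case: (p i) (h i). Qed.

Lemma differentiable_nmono (I : finType) (p : {ffun I -> int}) (z : I -> E -> R[i]^o) x :
  (forall i, differentiable (z i) x) ->
  differentiable (fun y => nmono (fun i => z i y) p : R[i]^o) x.
Proof. by move=> hz; apply: differentiable_prod => i; exact: differentiable_pow. Qed.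

Lemma open_neq0 f : (forall x, differentiable f x) -> open [set x | f x != 0].
Proof.
move=> hf; have -> : [set x | f x != 0] = f @^-1` (~` [set 0]).
  by apply/seteqP; split=> x /= => [/eqP|/eqP].
apply: open_comp => [x _|]; first exact: differentiable_continuous.
exact/closed_openC/(@accessible_closed_set1 R[i]^o)/hausdorff_accessible/norm_hausdorff.
Qed.

End DifferentiableScalars.

Lemma differentiable_entry (R : realType) m i x :
  differentiable (fun z : 'rV[R[i]]_m => z 0 i : R[i]^o) x.
Proof. exact: differentiable_coord. Qed.

Lemma differentiable_DD_row (R : realType) m N ps x :
  differentiable (fun z : 'rV[R[i]]_m => DD N ps (z 0) : R[i]^o) x.
Proof.
apply: (@differentiable_DD R ('rV[R[i]]_m : normedModType R[i]) _ N ps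
  (fun i (z : 'rV[R[i]]_m) => z 0 i)) => i.
exact: differentiable_entry.
Qed.

Lemma differentiable_nmono_row (R : realType) m p x :
  differentiable (fun z : 'rV[R[i]]_m => nmono (z 0) p : R[i]^o) x.
Proof.
apply: (@differentiable_nmono R ('rV[R[i]]_m : normedModType R[i]) _ p
  (fun i (z : 'rV[R[i]]_m) => z 0 i)) => i.
exact: differentiable_entry.
Qed.

Lemma open_not_fat (R : realType) m :
  @open ('rV[R[i]]_m : normedModType R[i]) (~` @fat_diagonal R m).
Proof.
have -> : ~` @fat_diagonal R m =
    [set z : 'rV[R[i]]_m | DD 1 (prs (enum 'I_m)) (z 0) != 0].
  apply/seteqP; split=> z /=; [exact: DD_neq0_fat | exact: fat_diagonal_DD].
apply: (@open_neq0 R ('rV[R[i]]_m : normedModType R[i])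
  (fun z : 'rV[R[i]]_m => DD 1 (prs (enum 'I_m)) (z 0))) => x.
exact: differentiable_DD_row.
Qed.

Lemma nonneg_box (I : finType) (B : int) : exists S : {fset {ffun I -> int}},
  (forall p : {ffun I -> int}, p \in S -> forall s, 0 <= p s) /\
  forall p : {ffun I -> int}, (forall s, 0 <= p s) -> tdeg p <= B -> p \in S.
Proof.
pose f (g : {ffun I -> 'I_`|B|.+1}) : {ffun I -> int} := [ffun i => (g i : nat)%:Z].
exists (seq_fset tt (map f (enum {ffun I -> 'I_`|B|.+1}))); split=> p.
  by rewrite seq_fsetE => /mapP[g _ ->] s; rewrite ffunE.
move=> p0 pB; rewrite seq_fsetE.
have pb i : (`|p i| < `|B|.+1)%N.
  have : p i <= tdeg p.
    by rewrite /tdeg (bigD1 i)//= lerDl sumr_ge0.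
  by have := p0 i; move: (p i) (tdeg p) pB => x t; lia.
apply/mapP; exists [ffun i => Ordinal (pb i)]; first by rewrite mem_enum.
by apply/ffunP => i; rewrite !ffunE /= gez0_abs.
Qed.

Lemma fs_box (I : finType) (X : zmodType) (A : {ffun I -> int} -> X) (B : int) :
  (forall p, A p != 0 -> (forall s, 0 <= p s) /\ tdeg p <= B) -> fs A.
Proof.
move=> hA; have [S [_ hS]] := nonneg_box I B; exists S => p hp.
by apply/eqP; apply: contraNT hp => /hA[h1 h2]; exact: hS.
Qed.

Lemma finite_small (R : realType) (J : finType) (P : J -> R[i] -> Prop) :
  (forall j, exists2 d : R, 0 < d & forall y, cmod y < d -> P j y) ->
  exists2 d : R, 0 < d & forall y, cmod y < d -> forall j, P j y.
Proof.
move=> hP.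
have /choice[d hd] : forall j, exists d : R, 0 < d /\ forall y, cmod y < d -> P j y.
  by move=> j; have [d d0 h] := hP j; exists d.
exists (\big[Num.min/1]_j d j).
  by elim/big_ind: _ => // [x y x0 y0|j _]; [rewrite lt_min x0|have [] := hd j].
move=> y hy j; apply: (hd j).2; apply: (lt_le_trans hy).
by rewrite (bigD1 j)//= ge_min lexx.
Qed.

Lemma near_cmod_lt (R : realType) (a b v w : R[i]) : cmod b < cmod a ->
  exists2 d : R, 0 < d & forall y, cmod y < d -> cmod (b + y * w) < cmod (a + y * v).
Proof.
move=> ab; have D0 : 0 < cmod v + cmod w + 1 by rewrite ltr_wpDl ?addr_ge0 ?cmod_ge0.
exists ((cmod a - cmod b) / (cmod v + cmod w + 1)); first by rewrite divr_gt0 ?subr_gt0.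
move=> y; rewrite ltr_pdivlMr// => hy.
have h1 := cmodD b (y * w); have h2 := cmodB (a + y * v) (y * v).
rewrite addrK in h2; rewrite !cmodM in h1 h2.
by have := cmod_ge0 y; lra.
Qed.

(** * Rationality and translation *)

Section Rationality.
Variables (R : realType) (V : vertexAlgebra R).

(** Locality and creation exclude negative exponents; the lower bound on the degrees of the entries
    and the vacuum bounds the total exponent from above in degree [l]. As [c] is independent of [l],
    all components below [c] vanish. *)
Lemma Mv_support (I : finType) (a : I -> V) N : (forall i j, loc N (a i) (a j)) ->
  exists c, forall l p, gr_proj V l (Mv a N p) != 0 ->
    (forall s, 0 <= p s) /\ tdeg p <= l - c.
Proof.
move=> hl; have [c hc] := Mv_Fge a N; exists c => l p h; split.
  move=> s; rewrite leNgt; apply: contra h => ps.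
  by rewrite (Mv_pos hl ps) linear0.
rewrite leNgt; apply: contra h => h; rewrite (hc p)//.
by move: (tdeg p) h => t; lia.
Qed.

Lemma Mv_fs (I : finType) (a : I -> V) N l : (forall i j, loc N (a i) (a j)) ->
  fs (fun p => gr_proj V l (Mv a N p)).
Proof.
move=> /Mv_support[c hc]; apply: (@fs_box _ _ _ (l - c)) => p; exact: hc.
Qed.

Variable mu : forall m : nat, 'rV[V]_m -> 'rV[R[i]]_m -> completion V.
Hypothesis Hmu : is_multiplication mu.

Lemma mu_radial m (a : 'rV[V]_m) N l (z : 'rV[R[i]]_m) : (forall i j, loc N (a 0 i) (a 0 j)) ->
  (forall i, z 0 i != 0) -> radially_ordered z ->
  DD N (prs (enum 'I_m)) (z 0) *: mu a z l =
  ev (z 0) (fun p => gr_proj V l (Mv (a 0) N p)).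
Proof.
move=> hl hz hr; have [_ [_ /(_ z hr)]] := Hmu a l.
move=> /has_sum_usum[Y [nu [hY hnu hs]]].
(* The passage between mode indices [k] and exponents [p = - k - 1], an involution. *)
pose f (p : {ffun 'I_m -> int}) : {ffun 'I_m -> int} := [ffun i => - p i - 1].
have fbij : bijective f.
  by exists f => p; apply/ffunP => i; rewrite !ffunE; ring.
have {}hs := usum_reindex fbij hs.
have := @usum_Dop _ _ _ _ hY hnu _ (z 0)
  (fun p => gr_proj V l (Wop (a 0) (enum 'I_m) (va_vac V) p)) (mu a z l) N (prs (enum 'I_m)) hz.
have hs' : usum Y nu (fun p => mono (z 0) p *:
   gr_proj V l (Wop (a 0) (enum 'I_m) (va_vac V) p)) (mu a z l).
  apply: usum_eq hs => p; rewrite /= /mode_term; congr (_ *: gr_proj V l _).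
    by apply: eq_bigr => i _; rewrite ffunE; congr (_ ^ _); ring.
  rewrite /iterated_modes /Wop; elim: (enum _) => //= i r ->.
  by rewrite ffunE.
move=> /(_ hs') {}hs.
have E : Dop N (prs (enum 'I_m)) (fun p => gr_proj V l (Wop (a 0) (enum 'I_m) (va_vac V) p))
   = fun p => gr_proj V l (Mv (a 0) N p).
  by apply/funext => p; exact: Dop_additive.
rewrite E in hs; apply: (usum_finite hY hnu _ hs).
exact/fs_mono/Mv_fs.
Qed.

(** The conclusion says that no [d] is a real multiple of [1 + i y]; any [y] above all the slopes
    [|Im d / Re d|] will do. *)
Lemma generic_direction (s : seq R[i]) : (forall d, d \in s -> d != 0) ->
  exists y : R, forall d, d \in s -> y * complex.Re d - complex.Im d != 0.
Proof.
move=> hs; pose b (d : R[i]) := `|complex.Im d / complex.Re d|.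
exists (1 + \sum_(d <- s) b d) => d ds.
have hb : b d <= \sum_(d <- s) b d.
  rewrite (big_rem d ds) /= lerDl sumr_ge0// => *; exact: normr_ge0.
have [r0|r0] := eqVneq (complex.Re d) 0.
  rewrite r0 mulr0 sub0r oppr_eq0; apply: contra (hs d ds) => /eqP i0.
  by rewrite eq_complex r0 i0 !eqxx.
rewrite subr_eq0; apply/eqP => h.
have : b d = `|1 + \sum_(d <- s) b d| by rewrite /b -h mulfK.
have S0 : 0 <= \sum_(d <- s) b d by apply: sumr_ge0 => *; exact: normr_ge0.
by rewrite ger0_norm ?addr_ge0// => bE; move: hb; rewrite bE gerDr ler10.
Qed.

(* A radially ordered point from which the segment to [z] avoids the diagonals. *)
Lemma radial_base_point m (z : 'rV[R[i]]_m) : ~ fat_diagonal z ->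
  exists q : 'rV[R[i]]_m, [/\ forall i, q 0 i != 0, radially_ordered q
    & forall t : R, 0 <= t <= 1 -> ~ fat_diagonal (q + t%:C *: (z - q))].
Proof.
move=> /not_fat_diagonalP hz.
have [|y hy] := generic_direction (s := [seq z 0 ij.1 - z 0 ij.2 |
    ij <- [seq ij <- enum {: 'I_m * 'I_m} | ij.1 != ij.2]]).
  move=> d /mapP[ij]; rewrite mem_filter => /andP[ij12 _] ->.
  by rewrite subr_eq0 hz.
(* The base points are distinct real multiples of one direction [zeta], in decreasing order of
   modulus. Their differences are real multiples of [zeta] and those of [z] are not, so no real
   combination with weights [1 - t] and [t] vanishes. *)
pose rho (i : 'I_m) : R := (m - i)%:R.
pose zeta : R[i] := 1 +i* y.
have zeta0 : zeta != 0 by rewrite eq_complex /= oner_eq0.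
exists (\row_i ((rho i)%:C * zeta)); split.
- move=> i; rewrite mxE mulf_neq0// (inj_eq (@complexI R)) pnatr_eq0.
  by rewrite subn_eq0 -ltnNge.
- move=> i j ij; rewrite !mxE lt_cmod !cmodM ltr_pM2r ?cmod_gt0//.
  rewrite !cmod_real !ger0_norm ?ler0n// ltr_nat.
  by have := ltn_ord j; lia.
move=> t /andP[t0 t1]; apply/not_fat_diagonalP => i j ij; rewrite !mxE.
apply/negP => /eqP h.
have hd := hy (z 0 i - z 0 j) _; move: hd.
have -> : z 0 i - z 0 j \in [seq z 0 ij.1 - z 0 ij.2 |
    ij <- [seq ij <- enum {: 'I_m * 'I_m} | ij.1 != ij.2]].
  by apply/mapP; exists (i, j) => //; rewrite mem_filter ij mem_enum.
move=> /(_ isT).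
have rij : rho i - rho j != 0.
  rewrite subr_eq0 eqr_nat; apply: contra ij => /eqP h'; apply/eqP/val_inj => /=.
  by have := ltn_ord i; have := ltn_ord j; lia.
have := hz i j ij; rewrite -subr_eq0; set d := z 0 i - z 0 j => d0.
have h2 : ((1 - t) * (rho i - rho j))%:C * zeta + t%:C * d = 0.
  move/eqP: h; rewrite -subr_eq0 => /eqP <-.
  by rewrite /d !rmorphM !rmorphB rmorph1 /=; ring.
move: d0 h2; case: d => [d1 d2]; rewrite /zeta => d0 /eqP.
rewrite eq_complex /= !mul0r !subr0 !addr0 !mulr1 => /andP[/eqP e1 /eqP e2] /eqP hy0.
apply: hy0.
have e3 : (1 - t) * (rho i - rho j) * (y * d1 - d2) = 0.
  have e1' : (1 - t) * (rho i - rho j) + t * d1 = 0 by rewrite -[RHS]e1; ring.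
  have e2' : (1 - t) * (rho i - rho j) * y + t * d2 = 0 by rewrite -[RHS]e2; ring.
  have -> : (1 - t) * (rho i - rho j) * (y * d1 - d2) =
    d1 * ((1 - t) * (rho i - rho j) * y + t * d2)
    - d2 * ((1 - t) * (rho i - rho j) + t * d1) by ring.
  by rewrite e1' e2' !mulr0 subrr.
move/eqP: e3; rewrite !mulf_eq0 (negbTE rij) orbF subr_eq0 => /orP[/eqP t1'|/eqP//].
move: e1 e2; rewrite -t1' subrr !mul0r !add0r !mul1r => e1 e2.
by move: d0; rewrite e1 e2 eq_complex /= eqxx.
Qed.

Theorem mu_rational m (a : 'rV[V]_m) N l (z : 'rV[R[i]]_m) : (forall i j, loc N (a 0 i) (a 0 j)) ->
  ~ fat_diagonal z ->
  DD N (prs (enum 'I_m)) (z 0) *: mu a z l =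
  ev (z 0) (fun p => gr_proj V l (Mv (a 0) N p)).
Proof.
move=> hl hz; have [q [q0 qr hq]] := radial_base_point hz.
have [c hc] := Mv_support hl; have [S hS] := Mv_fs l hl.
pose P (x : 'rV[R[i]]_m) := \sum_(j : S) nmono (x 0) (val j) *: gr_proj V l (Mv (a 0) N (val j)).
have PE (x : 'rV[R[i]]_m) : ev (x 0) (fun p => gr_proj V l (Mv (a 0) N p)) = P x.
  rewrite /ev (@fsumE _ _ S); last by move=> p /hS ->; rewrite scaler0.
  rewrite big_seq_fsetE; apply: eq_bigr => -[p pS] _ /=.
  have [->|/hc[p0 _]] := eqVneq (gr_proj V l (Mv (a 0) N p)) 0; first by rewrite !scaler0.
  by rewrite nmonoE.
pose F (x : 'rV[R[i]]_m) := DD N (prs (enum 'I_m)) (x 0) *: mu a x l - P x.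
have hF : holo_span (~` @fat_diagonal R m) F.
  apply: holo_spanB.
    apply: (@holo_spanZ _ _ _ _ (fun x : 'rV[R[i]]_m => DD N (prs (enum 'I_m)) (x 0) : R[i]^o)).
      by move=> x _; exact: differentiable_DD_row.
    by apply: holomorphic_holo_span; have [] := Hmu a l.
  apply: (@holo_span_comb R ('rV[R[i]]_m : normedModType R[i]) _ _ S
    (fun j => gr_proj V l (Mv (a 0) N (val j))) (fun j x => nmono (x 0) (val j))).
    exact: open_not_fat.
  by move=> j x _; exact: differentiable_nmono_row.
rewrite PE; apply/eqP; rewrite -subr_eq0; apply/eqP; rewrite -/(F z).
have -> : z = q + 1 *: (z - q) by rewrite scale1r subrKC.
apply: (segment_identity (phi := fun y => F (q + y *: (z - q)))).
  by move=> t /hq ht; exact: holo_span_line hF ht.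
have [d1 d10 h1] : exists2 d : R, 0 < d & forall y, cmod y < d ->
    forall i, (q + y *: (z - q)) 0 i != 0.
  apply: finite_small => i.
  have qi : cmod (0 : R[i]) < cmod (q 0 i) by rewrite cmod0 cmod_gt0.
  have [d d0 hd] := near_cmod_lt (z 0 i - q 0 i) 0 qi; exists d => // y /hd.
  by rewrite mulr0 addr0 cmod0 cmod_gt0 !mxE.
have [d2 d20 h2] : exists2 d : R, 0 < d & forall y, cmod y < d ->
    forall ij : 'I_m * 'I_m, (ij.1 < ij.2)%N ->
      `|(q + y *: (z - q)) 0 ij.2| < `|(q + y *: (z - q)) 0 ij.1|.
  apply: finite_small => -[i j] /=; have [ij|ij] := ltnP i j; last by exists 1.
  have := qr i j ij; rewrite lt_cmod => qij.
  have [d d0 hd] := near_cmod_lt (z 0 i - q 0 i) (z 0 j - q 0 j) qij; exists d => // y /hd.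
  by rewrite lt_cmod !mxE.
exists (Num.min d1 d2); first by rewrite lt_min d10.
move=> y; rewrite lt_min => /andP[/h1 y1 /h2 y2].
rewrite /F -PE mu_radial ?subrr// => i j ij; exact: (y2 (i, j)).
Qed.

End Rationality.

(** * Taylor expansion and translation of all points *)

Section TaylorPolynomials.
Variables (F : fieldType) (I : finType).
Implicit Types (z : I -> F) (p : {ffun I -> int}).

(* [(w + X)^k], with junk value [0] for [k < 0]. *)
Definition shifted_power (w : F) (k : int) : {poly F} :=
  if k is Posz n then (w%:P + 'X) ^+ n else 0.

Definition shifted_mono z p : {poly F} := \prod_i shifted_power (z i) (p i).

Lemma deriv_shifted_power w (k : int) : 0 <= k ->
  (shifted_power w k)^`() = k%:~R *: shifted_power w (k - 1).
Proof.
case: k => // -[|n] _; first by rewrite /= expr0 -polyC1 derivC scale0r.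
have -> : (Posz n.+1) - 1 = Posz n by lia.
rewrite /= deriv_exp derivD derivC derivX add0r mul1r /=.
by rewrite -scaler_nat.
Qed.

(** The derivative in the translation parameter is the sum of the partial derivatives, the same
    combination as in [va_T_Mv]. The junk value at exponent [-1] occurs only with coefficient
    [0]. *)
Lemma deriv_shifted_mono z p : (forall i, 0 <= p i) ->
  (shifted_mono z p)^`() = \sum_i (p i)%:~R *: shifted_mono z (p - ee i).
Proof.
move=> p0; rewrite /shifted_mono; have := index_enum_uniq I.
elim: (index_enum I) => [|x s IH] /=; first by rewrite !big_nil derivC.
case/andP => xs us; rewrite !big_cons derivM IH// deriv_shifted_power//.
congr (_ + _).
  rewrite -scalerAl; congr (_ *: (shifted_power _ _ * _)); first by rewrite !ffunE eqxx.
  rewrite big_seq [RHS]big_seq; apply: eq_bigr => j js.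
  rewrite !ffunE (_ : j == x = false) ?subr0//.
  by apply: contraTF js => /eqP ->.
rewrite mulr_sumr big_seq [RHS]big_seq; apply: eq_bigr => j js.
rewrite big_cons -scalerAr; congr (_ *: (shifted_power _ _ * _)).
rewrite !ffunE (_ : x == j = false) ?subr0//.
by apply: contraTF js => /eqP <-.
Qed.

Lemma horner_shifted_mono z p c : (forall i, 0 <= p i) ->
  (shifted_mono z p).[c] = \prod_i (z i + c) ^+ `|p i|%N.
Proof.
move=> p0; rewrite /shifted_mono horner_prod; apply: eq_bigr => i _.
by case: (p i) (p0 i) => // n _; rewrite /= horner_exp hornerD hornerC hornerX.
Qed.

End TaylorPolynomials.

Section Multiplication.
Variables (R : realType) (V : vertexAlgebra R).
Variable mu : forall m : nat, 'rV[V]_m -> 'rV[R[i]]_m -> completion V.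
Hypothesis Hmu : is_multiplication mu.

Lemma loc_row (m : nat) (a : 'rV[V]_m) : exists N, forall M, (N <= M)%N ->
  forall i j, loc M (a 0 i) (a 0 j).
Proof.
have [N hN] := loc_exists (a 0); exists N => M NM i j; exact: loc_le (hN i j).
Qed.

Lemma mu_linear m (a a' a'' : 'rV[V]_m) (s : 'I_m) c l z : ~ fat_diagonal z ->
  (forall i, i != s -> a' 0 i = a 0 i /\ a'' 0 i = a 0 i) ->
  a'' 0 s = c *: a 0 s + a' 0 s ->
  mu a'' z l = c *: mu a z l + mu a' z l.
Proof.
move=> hz h hs.
have [N1 h1] := loc_row a; have [N2 h2] := loc_row a'; have [N3 h3] := loc_row a''.
pose N := maxn N1 (maxn N2 N3).
have {}h1 := h1 N (leq_maxl _ _).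
have {}h2 := h2 N (leq_trans (leq_maxl _ _) (leq_maxr _ _)).
have {}h3 := h3 N (leq_trans (leq_maxr _ _) (leq_maxr _ _)).
apply: (scalerI (DD_neq0_fat N hz)); rewrite scalerDr scalerA [_ * c]mulrC -scalerA.
rewrite !(mu_rational Hmu)// /ev.
rewrite [X in X + _](fsum_morph (f := fun x => c *: x)); [ | by rewrite scaler0
  | by move=> x y; rewrite scalerDr | exact/fs_mono/Mv_fs].
rewrite -fsumD; [ | | exact/fs_mono/Mv_fs].
  apply: eq_fsum => p; rewrite (Mv_linear N p h hs) linearP scalerDr.
  by rewrite !scalerA [c * _]mulrC.
apply: (fs_map (f := fun _ x => c *: x)); first by move=> _; rewrite scaler0.
exact/fs_mono/Mv_fs.
Qed.

Lemma va_T_proj l (v : V) :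
  va_T V (gr_inj V l (gr_proj V l v)) = gr_inj V (l + 1) (gr_proj V (l + 1) (va_T V v)).
Proof.
have [s hs] := gr_sum v; rewrite [in RHS]hs !linear_sum /=.
have hT k (x : gr_comp V k) : gr_inj V (k + 1) (gr_proj V (k + 1) (va_T V (gr_inj V k x))) = va_T V (gr_inj V k x).
  have [y ->] := va_T_degree (ex_intro _ x erefl : homogeneous k (gr_inj V k x)).
  by rewrite gr_projK.
have hT0 k (x : gr_comp V k) : k != l -> gr_proj V (l + 1) (va_T V (gr_inj V k x)) = 0.
  move=> kl; apply: gr_proj_homogeneous (va_T_degree _) _; first by exists x.
  by rewrite (inj_eq (addIr 1)) eq_sym.
have [ls|ls] := boolP (l \in s).
  rewrite (big_fsetD1 l)//= hT big_seq big1 ?addr0// => k; rewrite !inE => /andP[kl _].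
  by rewrite hT0// linear0.
rewrite big_seq big1 => [|k ks].
  have -> : gr_proj V l v = 0; last by rewrite !linear0.
  rewrite hs linear_sum big_seq big1// => k ks; apply: gr_proj0.
  by apply: contraNneq ls => ->.
by rewrite hT0 ?linear0//; apply: contraNneq ls => <-.
Qed.

Lemma mono_shift m (z : 'rV[R[i]]_m) c (p : {ffun 'I_m -> int}) n :
  (forall i, 0 <= p i) -> (size (shifted_mono (z 0%R) p) <= n)%N ->
  mono ((z + const_mx c) 0) p = \sum_(j < n) (shifted_mono (z 0) p)`_j * c ^+ j.
Proof.
move=> p0 hn; rewrite -horner_coef_wide// horner_shifted_mono// nmonoE//.
by apply: eq_bigr => i _; rewrite !mxE.
Qed.

(* Both sides of [P(z + c) = sum c^r/r! T^r P(z)] are polynomials, where [P] is the numerator of [mu]. *)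
Lemma not_fat_translate (m : nat) (z : 'rV[R[i]]_m) c :
  ~ fat_diagonal z -> ~ fat_diagonal (z + const_mx c).
Proof.
move=> /not_fat_diagonalP hz; apply/not_fat_diagonalP => i j ij.
by rewrite !mxE (inj_eq (addIr c)); exact: hz.
Qed.

Lemma iter_va_T0 r : iter r (va_T V) 0 = 0.
Proof. by elim: r => //= r ->; rewrite linear0. Qed.

Lemma sum_trunc (X : zmodType) (F : nat -> X) n n' : (n <= n')%N ->
  (forall j, (n <= j)%N -> F j = 0) -> \sum_(j < n') F j = \sum_(j < n) F j.
Proof.
move=> nn F0; rewrite -!(big_mkord xpredT F) (big_cat_nat (n := n))//=.
rewrite [X in _ + X]big_nat_cond [X in _ + X]big1 ?addr0// => j; rewrite andbT => /andP[nj _].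
exact: F0.
Qed.

(** [exp (c T)] is cut off because the components of [mu a z] vanish below some degree. [R0] depends
    on [a] and [l] only, and every [n >= R0] is allowed, so that expansions for different lists of
    vectors can be given equal length. *)
Lemma mu_translation m (a : 'rV[V]_m) l : exists R0 : nat, forall (n : nat) z c,
  (R0 <= n)%N -> ~ fat_diagonal z ->
  mu a (z + const_mx c) l = \sum_(r < n) (c ^+ r / r`!%:R) *:
    gr_proj V l (iter r (va_T V) (gr_inj V (l - r%:Z) (mu a z (l - r%:Z)))).
Proof.
have [N /(_ N (leqnn N)) hl] := loc_row a.
have [b hb] := Mv_support hl.
exists `|l - b|.+1 => n z c hn hz.
have hzc := @not_fat_translate _ _ c hz.
have DE : DD N (prs (enum 'I_m)) ((z + const_mx c) 0) = DD N (prs (enum 'I_m)) (z 0).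
  by apply: eq_bigr => ij _; rewrite !mxE opprD addrACA subrr addr0.
apply: (scalerI (DD_neq0_fat N hz)); rewrite -{1}DE (mu_rational Hmu)//.
pose q p := shifted_mono (z 0) p.
pose A k p : V := gr_inj V k (gr_proj V k (Mv (a 0) N p)).
have Afs k : fs (A k).
  by have [S hS] := Mv_fs k hl; exists S => p /hS h; rewrite /A h linear0.
have Apos k p : A k p != 0 -> forall i, 0 <= p i.
  move=> h; have [] := hb k p => //; apply: contra h => /eqP h.
  by rewrite /A h linear0.
(* The coefficient of [c^j] in the degree [k] component of the numerator at [z + c], viewed in [V]
   so that powers of [T] apply. By [hT] and [hTr] it is [T^j / j!] of the constant term in degree
   [k - j]. *)
pose h k j : V := fsum (fun p => (q p)`_j *: A k p).
have qAfs (f : {ffun 'I_m -> int} -> R[i]) k : fs (fun p => f p *: A k p).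
  by apply: (fs_map (f := fun p x => f p *: x)) (Afs k) => p; rewrite scaler0.
have hT k j : va_T V (h k j) = j.+1%:R *: h (k + 1) j.+1.
  rewrite /h (fsum_morph (f := fun x => va_T V x)); [ | exact: linear0 | exact: linearD | exact: qAfs].
  rewrite (fsum_morph (f := fun x => j.+1%:R *: x)); [ | by rewrite scaler0
    | by move=> x y; rewrite scalerDr | exact: qAfs].
  pose G i p := ((q p)`_j * (p i + 1)%:~R) *: A (k + 1) (p + ee i).
  have GE i : (fun p => G i p) = (fun p => ((q (p - ee i))`_j * (p i)%:~R) *: A (k + 1) p) \o (fun p => p + ee i).
    apply/funext => p; rewrite /= /G addrK !ffunE eqxx.
    by [].
  have Gfs i : fs (G i).
    by rewrite /= (_ : G i = fun p => G i p)// GE; apply: fs_reindex (bij_addr _) _; exact: qAfs.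
  transitivity (fsum (fun p => \sum_i G i p)).
    apply: eq_fsum => p; rewrite linearZ /= va_T_proj va_T_Mv !linear_sum ?scaler_sumr.
    by apply: eq_bigr => i _; rewrite !linearZ /= scalerA [_ * (q p)`_j]mulrC.
  apply: (etrans (fsum_sum (index_enum 'I_m) Gfs).2).
  pose H i p := ((q (p - ee i))`_j * (p i)%:~R) *: A (k + 1) p.
  transitivity (\sum_i fsum (H i)).
    apply: eq_bigr => i _; rewrite (fsum_reindex (H i) (bij_addr (ee i))).
    by apply: eq_fsum => p; rewrite -[LHS]/((fun p => G i p) p) GE.
  apply: (etrans (esym (fsum_sum (index_enum 'I_m) (A := H) _).2)).
    by move=> i; exact: (qAfs (fun p => (q (p - ee i))`_j * (p i)%:~R)).
  apply: eq_fsum => p; rewrite /H; have [->|/Apos p0] := eqVneq (A (k + 1) p) 0.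
    by rewrite !scaler0 big1// => i _; rewrite scaler0.
  rewrite -scaler_suml scalerA; congr (_ *: _).
  rewrite mulr_natl -coef_deriv deriv_shifted_mono// coef_sum; apply: eq_bigr => i _.
  by rewrite coefZ mulrC.
have hTr r k : iter r (va_T V) (h k 0) = r`!%:R *: h (k + r%:Z) r.
  elim: r => [|r IH]; first by rewrite fact0 scale1r addr0.
  rewrite iterS IH linearZ /= hT scalerA -natrM mulnC -factS -addn1 PoszD addrA.
  by rewrite addn1.
have h0 k : h k 0 = DD N (prs (enum 'I_m)) (z 0) *: gr_inj V k (mu a z k).
  rewrite -linearZ /= (mu_rational Hmu)// /ev (fsum_morph (f := fun x => gr_inj V k x));
    [ | exact: linear0 | exact: linearD | exact/fs_mono/Mv_fs].
  apply: eq_fsum => p; rewrite linearZ /= -/(A k p).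
  have [->|/Apos p0] := eqVneq (A k p) 0; first by rewrite !scaler0.
  congr (_ *: _); rewrite nmonoE// -horner_coef0 horner_shifted_mono//.
  by apply: eq_bigr => i _; rewrite addr0.
have hvanish k j : k < b -> h k j = 0.
  move=> kb; apply: fsum0 => p; rewrite /A (_ : gr_proj V k _ = 0) ?linear0 ?scaler0//.
  apply/eqP; apply: contraT => /hb[p0 pd].
  have : 0 <= tdeg p by apply: sumr_ge0.
  by move: (tdeg p) pd => t; lia.
(* For [j >= n] the degree [l - j] lies below the bound [b], hence the choice of [R0]. *)
have hjvanish j : (n <= j)%N -> h l j = 0.
  move=> nj; have := hTr j (l - j%:Z); rewrite subrK hvanish; last by lia.
  rewrite iter_va_T0 => /esym/eqP; rewrite scaler_eq0 pnatr_eq0 -leqn0 leqNgt fact_gt0 /=.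
  by move/eqP.
have [S hS] := Afs l.
pose J := maxn n (\max_(p <- S) size (q p)).
have main : gr_inj V l (ev ((z + const_mx c) 0) (fun p => gr_proj V l (Mv (a 0) N p)))
    = \sum_(j < J) c ^+ j *: h l j.
  rewrite /ev (fsum_morph (f := fun x => gr_inj V l x));
    [ | exact: linear0 | exact: linearD | exact/fs_mono/Mv_fs].
  transitivity (fsum (fun p => \sum_(j <- index_enum 'I_J) (c ^+ j * (q p)`_j) *: A l p)).
    apply: eq_fsum => p; rewrite linearZ /= -/(A l p) -scaler_suml.
    have [A0|A0] := eqVneq (A l p) 0; first by rewrite A0 !scaler0.
    congr (_ *: _); rewrite (@mono_shift _ z c p J).
    - by apply: eq_bigr => j _; rewrite mulrC.
    - exact: Apos A0.
    - have pS : p \in S by apply: contraNT A0 => /hS ->.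
      by rewrite leq_max; apply/orP; right; rewrite (big_fsetD1 p)//= leq_maxl.
  apply: (etrans (fsum_sum (index_enum 'I_J)
    (fun j : 'I_J => qAfs (fun p => c ^+ j * (q p)`_j) l)).2).
  apply: eq_bigr => j _; rewrite (fsum_morph (f := fun x => c ^+ j *: x));
    [ | by rewrite scaler0 | by move=> x y; rewrite scalerDr | exact: qAfs].
  by apply: eq_fsum => p; rewrite scalerA.
apply: (can_inj (gr_projK (k := l))); rewrite main.
rewrite scaler_sumr linear_sum /=.
rewrite (@sum_trunc _ (fun j => c ^+ j *: h l j) n) ?leq_maxl//; last first.
  by move=> j /hjvanish ->; rewrite scaler0.
apply: eq_bigr => r _; set D := DD _ _ _; set w := gr_inj V (l - r%:Z) _.
have iterT_degree e u k : homogeneous e u -> homogeneous (e + k%:Z) (iter k (va_T V) u).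
  move=> hu; elim: k => [|k IH]; first by rewrite addr0.
  by move: IH => /va_T_degree; rewrite -addrA -PoszD addn1.
have [x hx] : homogeneous l (iter r (va_T V) w).
  have := @iterT_degree (l - r%:Z) w r (ex_intro _ (mu a z (l - r%:Z)) erefl).
  by rewrite subrK.
have iterTZ k (e : R[i]) u : iter k (va_T V) (e *: u) = e *: iter k (va_T V) u.
  by elim: k => //= k ->; rewrite linearZ.
have hw : D *: iter r (va_T V) w = r`!%:R *: h l r.
  by rewrite -iterTZ /D /w -h0 hTr subrK.
have r0 : r`!%:R != 0 :> R[i] by rewrite pnatr_eq0 -lt0n fact_gt0.
rewrite !linearZ /= hx gr_projK -hx scalerA mulrC -scalerA hw scalerA.
by rewrite divfK.
Qed.

End Multiplication.

(** * Expansion at the base point [0] *)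

Lemma prs_cat (I : finType) (r1 r2 : seq I) :
  perm_eq (prs (r1 ++ r2)) (prs r1 ++ [seq (i, j) | i <- r1, j <- r2] ++ prs r2).
Proof.
elim: r1 => //= s r1 IH; rewrite map_cat -!catA perm_cat2l.
apply: (perm_trans (y := [seq (s, j) | j <- r2] ++
    (prs r1 ++ [seq (i, j) | i <- r1, j <- r2] ++ prs r2))).
  by rewrite perm_cat2l.
by rewrite perm_catCA.
Qed.

Lemma prs_map (I J : finType) (f : I -> J) (r : seq I) :
  prs [seq f i | i <- r] = [seq (f ij.1, f ij.2) | ij <- prs r].
Proof. by elim: r => //= s r ->; rewrite map_cat -!map_comp. Qed.

Lemma enum_ordD m n : enum 'I_(m + n) =
  [seq lshift n i | i <- enum 'I_m] ++ [seq rshift m j | j <- enum 'I_n].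
Proof.
apply: (inj_map val_inj); rewrite val_enum_ord iotaD map_cat add0n; congr (_ ++ _).
  by rewrite -val_enum_ord -[RHS]map_comp; apply: eq_map.
by rewrite -[m in LHS]addn0 iotaDl -val_enum_ord -!map_comp; apply: eq_map.
Qed.

Lemma Dop_morph (I : finType) (X X' : zmodType) (f : X -> X') N (ps : seq (I * I))
    (A : {ffun I -> int} -> X) p : zmod_morphism f ->
  Dop N ps (fun p => f (A p)) p = f (Dop N ps A p).
Proof.
move=> fB; have -> : Dop N ps (fun p => f (A p)) = fun p => f (Dop N ps A p); last by [].
elim: ps => //= ij ps ->; move: (Dop N ps A) => B; elim: N => //= N ->.
by apply/funext => q; rewrite /Msub fB.
Qed.

(** * Exponents split into two groups of variables *)

Section Join.
Variables (m n : nat).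
Implicit Types (p : {ffun 'I_m -> int}) (q : {ffun 'I_n -> int}) (P : {ffun 'I_(m + n) -> int}).

Definition jidx p q : {ffun 'I_(m + n) -> int} :=
  [ffun k : 'I_(m + n) => match fintype.split k with inl i => p i | inr j => q j end].

Definition lpart P : {ffun 'I_m -> int} := [ffun i => P (lshift n i)].
Definition rpart P : {ffun 'I_n -> int} := [ffun j => P (rshift m j)].

Lemma jidx_l p q i : jidx p q (lshift n i) = p i.
Proof. by rewrite ffunE (unsplitK (inl i)). Qed.

Lemma jidx_r p q j : jidx p q (rshift m j) = q j.
Proof. by rewrite ffunE (unsplitK (inr j)). Qed.

Lemma jidxP P (Q : {ffun 'I_(m + n) -> int}) : (forall i, P (lshift n i) = Q (lshift n i)) ->
  (forall j, P (rshift m j) = Q (rshift m j)) -> P = Q.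
Proof. by move=> h1 h2; apply/ffunP => k; case: (split_ordP k) => i ->. Qed.

Lemma jidx_parts P : jidx (lpart P) (rpart P) = P.
Proof. by apply: jidxP => i; rewrite ?jidx_l ?jidx_r ffunE. Qed.

Lemma lpart_jidx p q : lpart (jidx p q) = p.
Proof. by apply/ffunP => i; rewrite ffunE jidx_l. Qed.

Lemma rpart_jidx p q : rpart (jidx p q) = q.
Proof. by apply/ffunP => i; rewrite ffunE jidx_r. Qed.

Lemma jidx_eq p q P : (P == jidx p q) = (lpart P == p) && (rpart P == q).
Proof.
apply/eqP/andP => [->|[/eqP <- /eqP <-]]; last by rewrite jidx_parts.
by rewrite lpart_jidx rpart_jidx !eqxx.
Qed.

Lemma jidx_sub_l p q i : jidx p q - ee (lshift n i) = jidx (p - ee i) q.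
Proof.
apply: jidxP => j; rewrite !ffunE ?(unsplitK (inl j)) ?(unsplitK (inr j)) ?ffunE.
  by rewrite (inj_eq (@lshift_inj _ _)).
by rewrite eq_rlshift subr0.
Qed.

Lemma jidx_sub_r p q j : jidx p q - ee (rshift m j) = jidx p (q - ee j).
Proof.
apply: jidxP => i; rewrite !ffunE ?(unsplitK (inl i)) ?(unsplitK (inr i)) ?ffunE.
  by rewrite eq_lrshift subr0.
by rewrite (inj_eq (@rshift_inj _ _)).
Qed.

Section JoinOperators.
Variable X : zmodType.
Implicit Types (A : {ffun 'I_(m + n) -> int} -> X).

Lemma Dop_join_l N ps A p q :
  Dop N [seq (lshift n ij.1, lshift n ij.2) | ij <- ps] A (jidx p q) =
  Dop N ps (fun p => A (jidx p q)) p.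
Proof.
elim: ps p => //= ij ps IH p.
move: (Dop N ps _) (Dop N (map _ _) _) IH => B B'; elim: N p => //= N IHN p h.
by rewrite /Msub /= !jidx_sub_l !IHN.
Qed.

Lemma Dop_join_r N ps A p q :
  Dop N [seq (rshift m ij.1, rshift m ij.2) | ij <- ps] A (jidx p q) =
  Dop N ps (fun q => A (jidx p q)) q.
Proof.
elim: ps q => //= ij ps IH q.
move: (Dop N ps _) (Dop N (map _ _) _) IH => B B'; elim: N q => //= N IHN q h.
by rewrite /Msub /= !jidx_sub_r !IHN.
Qed.

Lemma fsum_delta (T : choiceType) (t : T) (x : X) :
  fsum (fun s => if s == t then x else 0) = x.
Proof.
rewrite (@fsumE _ _ [fset t]%fset) ?big_seq_fset1 ?eqxx// => s.
by rewrite inE => /negbTE ->.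
Qed.

Lemma fs_delta (T : choiceType) (t : T) (x : X) : fs (fun s => if s == t then x else 0).
Proof. by exists [fset t]%fset => s; rewrite inE => /negbTE ->. Qed.

Lemma fsum_join A : fs A ->
  [/\ forall p, fs (fun q => A (jidx p q)), fs (fun p => fsum (fun q => A (jidx p q)))
    & fsum (fun p => fsum (fun q => A (jidx p q))) = fsum A].
Proof.
move=> [S hS].
have AE P : A P = \sum_(Q <- S) if P == Q then A Q else 0.
  have [PS|/[dup] PS /hS ->] := boolP (P \in S); last first.
    by rewrite big_seq big1// => Q QS; rewrite eq_sym (negbTE (memPn PS _ QS)).
  rewrite (big_fsetD1 P)//= eqxx big_seq big1 ?addr0// => Q; rewrite !inE => /andP[QP _].
  by rewrite eq_sym (negbTE QP).
have fsA p : fs (fun q => A (jidx p q)).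
  exists [fset rpart P | P in S]%fset => q hq; apply: hS; apply: contra hq => hq.
  by apply/imfsetP; exists (jidx p q) => //; rewrite rpart_jidx.
have inner p : fsum (fun q => A (jidx p q)) = \sum_(Q <- S) if p == lpart Q then A Q else 0.
  transitivity (fsum (fun q => \sum_(Q <- S) (fun Q q => if jidx p q == Q then A Q else 0) Q q)).
    by apply: eq_fsum => q; rewrite AE.
  rewrite (fsum_sum _ _).2; last first.
    move=> Q; exists [fset rpart Q]%fset => q; rewrite inE [jidx p q == _]eq_sym jidx_eq.
    by rewrite [q == _]eq_sym => /negbTE ->; rewrite andbF.
  apply: eq_bigr => Q _; rewrite [p == _]eq_sym.
  case: eqVneq => [h|h]; last first.
    by apply: fsum0 => q; rewrite [jidx p q == _]eq_sym jidx_eq (negbTE h).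
  rewrite -[RHS](fsum_delta (rpart Q)); apply: eq_fsum => q.
  by rewrite [jidx p q == _]eq_sym jidx_eq h eqxx [q == _]eq_sym.
split=> //.
  exists [fset lpart P | P in S]%fset => p hp; rewrite inner big_seq big1// => Q QS.
  by case: eqP => // pQ; case/negP: hp; apply/imfsetP; exists Q.
rewrite (fsumE hS); transitivity (fsum (fun p => \sum_(Q <- S)
   (fun Q p => if p == lpart Q then A Q else 0) Q p)).
  by apply: eq_fsum => p; rewrite inner.
rewrite (fsum_sum _ _).2; last by move=> Q; exact: fs_delta.
by apply: eq_bigr => Q _; exact: fsum_delta.
Qed.

End JoinOperators.

End Join.

(** * Parts of given degree in the second group of variables *)

Section PartialEvaluation.
Variables (R : realType) (m n : nat) (X : lmodType R[i]).
Implicit Types (p : {ffun 'I_m -> int}) (q : {ffun 'I_n -> int}) (k : int)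
  (A : {ffun 'I_(m + n) -> int} -> X) (z : 'I_m -> R[i]) (w : 'I_n -> R[i]).

Lemma mono_join (y : 'I_(m + n) -> R[i]) p q :
  mono y (jidx p q) = mono (fun i => y (lshift n i)) p * mono (fun j => y (rshift m j)) q.
Proof.
by rewrite /mono big_split_ord; congr (_ * _); apply: eq_bigr => i _; rewrite ?jidx_l ?jidx_r.
Qed.

(** Nonnegative exponents in the last variables leave finitely many monomials of each total degree
    there and none of negative degree. They also allow some [w_j = 0]. *)
Definition pos_r A : Prop := forall P, A P != 0 -> forall j, 0 <= P (rshift m j).

Lemma pos_r_Msub A ij : pos_r A -> pos_r (Msub ij A).
Proof.
move=> h P; rewrite /Msub => hP j.
have {hP} : A (P - ee ij.1) != 0 \/ A (P - ee ij.2) != 0.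
  apply/orP; apply: contraNT hP; rewrite negb_or !negbK => /andP[/eqP -> /eqP ->].
  by rewrite subrr.
by case=> /h /(_ j); rewrite !ffunE; case: eqP => _ /=; move: (P _) => x; lia.
Qed.

Lemma pos_r_Dop A N ps : pos_r A -> pos_r (Dop N ps A).
Proof.
move=> h; elim: ps => //= ij ps; move: (Dop _ _ _) => B hB.
by elim: N => //= N; exact: pos_r_Msub.
Qed.

(* The part of [A] of total degree [k] in the last [n] variables, evaluated there at [w]. *)
Definition peval w A k p : X :=
  fsum (fun q => (if tdeg q == k then mono w q else 0) *: A (jidx p q)).

Lemma peval_fs w A k p : pos_r A ->
  fs (fun q => (if tdeg q == k then mono w q else 0) *: A (jidx p q)).
Proof.
move=> hA; apply: (@fs_box _ _ _ k) => q; case: (tdeg q =P k) => [qk|_]; last by rewrite scale0r eqxx.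
move=> h; have : A (jidx p q) != 0 by apply: contraNneq h => ->; rewrite scaler0.
by move=> /hA h0; split=> [j|]; [have := h0 j; rewrite jidx_r | rewrite qk].
Qed.

Lemma peval_neg w A k p : pos_r A -> k < 0 -> peval w A k p = 0.
Proof.
move=> hA k0; apply: fsum0 => q; case: (tdeg q =P k) => [qk|_]; last by rewrite scale0r.
have [->|/hA h] := eqVneq (A (jidx p q)) 0; first by rewrite scaler0.
suff : 0 <= tdeg q by rewrite qk leNgt k0.
by apply: sumr_ge0 => j _; have := h j; rewrite jidx_r.
Qed.

Lemma peval_shift_r w A k p j : pos_r A ->
  fsum (fun q => (if tdeg q == k then mono w q else 0) *: A (jidx p (q - ee j))) =
  w j *: peval w A (k - 1) p.
Proof.
move=> hA; rewrite (fsum_reindex _ (bij_addr (ee j))).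
rewrite /peval (fsum_morph (f := fun x => w j *: x)); [ | by rewrite scaler0
  | by move=> x y; rewrite scalerDr | exact: peval_fs].
apply: eq_fsum => q /=; rewrite addrK tdegD tdeg_ee -[k in LHS](subrK 1) (inj_eq (addIr 1)).
case: eqP => _; last by rewrite !scale0r scaler0.
have [->|/hA h] := eqVneq (A (jidx p q)) 0; first by rewrite !scaler0.
by rewrite mono_ee ?scalerA// => i; right; have := h i; rewrite jidx_r.
Qed.

Lemma peval_Msub_l w A k p i i' : pos_r A ->
  peval w (Msub (lshift n i, lshift n i') A) k p = Msub (i, i') (peval w A k) p.
Proof.
move=> hA; rewrite /Msub /= /peval -fsumB; [ | exact: peval_fs | exact: peval_fs].
by apply: eq_fsum => q; rewrite !jidx_sub_l scalerBr.
Qed.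

Lemma peval_Dop_l w A k p N ps : pos_r A ->
  peval w (Dop N [seq (lshift n ij.1, lshift n ij.2) | ij <- ps] A) k p =
  Dop N ps (peval w A k) p.
Proof.
move=> hA; elim: ps p => //= ij ps IH p.
have hB : pos_r (Dop N [seq (lshift n ij.1, lshift n ij.2) | ij <- ps] A) by exact: pos_r_Dop.
move: (Dop N ps _) (Dop N (map _ _) _) IH hB => B B' hBB' hB'.
elim: N p => //= N IHN p; rewrite peval_Msub_l; last first.
  by elim: (N) => //= k' ; exact: pos_r_Msub.
by rewrite /Msub !IHN.
Qed.

(** In [z_i - w_j] the first term keeps the degree in [w] and the second raises it by one, so the
    parts of degree [k] and [k - 1] become coupled. *)
Lemma peval_Msub_lr w A k p i j : pos_r A ->
  peval w (Msub (lshift n i, rshift m j) A) k p =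
  peval w A k (p - ee i) - w j *: peval w A (k - 1) p.
Proof.
move=> hA; rewrite -peval_shift_r// /peval -fsumB; [ | exact: peval_fs | ].
  by apply: eq_fsum => q; rewrite /Msub /= jidx_sub_l jidx_sub_r scalerBr.
have hA' : pos_r (fun P => A (P - ee (rshift m j))).
  move=> P /hA h j'; have := h j'; rewrite !ffunE; case: eqP => _ /=; move: (P _) => x; lia.
have := peval_fs w k p hA'; congr fs.
by apply/funext => q; rewrite jidx_sub_r.
Qed.

Definition pairs_lr (cs : seq ('I_m * 'I_n)) : seq ('I_(m + n) * 'I_(m + n)) :=
  [seq (lshift n c.1, rshift m c.2) | c <- cs].

(* [z_i B_k - w_j B_(k-1)] determines [B_k] since [B_k = 0] for [k < 0]. *)
Lemma peval_div w A z c : pos_r A -> (forall i, z i != 0) ->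
  (forall k, fs (peval w (Msub (lshift n c.1, rshift m c.2) A) k)) ->
  (forall k, fs (peval w A k)) /\
  forall k, ev z (peval w (Msub (lshift n c.1, rshift m c.2) A) k) =
    z c.1 *: ev z (peval w A k) - w c.2 *: ev z (peval w A (k - 1)).
Proof.
move=> hA hz hM.
have step k : fs (peval w A (k - 1)) -> fs (peval w A k).
  move=> h; have -> : peval w A k = (fun p => peval w (Msub (lshift n c.1, rshift m c.2) A) k p
     + w c.2 *: peval w A (k - 1) p) \o (fun p => p + ee c.1).
    by apply/funext => p /=; rewrite peval_Msub_lr// addrK subrK.
  apply: fs_reindex (bij_addr _) _; apply: fsD => //.
  by apply: (fs_map (f := fun p x => w c.2 *: x)) h => p; rewrite scaler0.
have hB k : fs (peval w A k).
  have [k0|k0] := ltP k 0.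
    by exists fset0 => p _; exact: peval_neg.
  case: k k0 => // k _; elim: k => [|k IH]; apply: step.
    by exists fset0 => p _; exact: peval_neg.
  by rewrite (_ : k.+1%:Z - 1 = k%:Z)//; lia.
split=> // k; have -> : peval w (Msub (lshift n c.1, rshift m c.2) A) k =
   fun p => peval w A k (p - ee c.1) - w c.2 *: peval w A (k - 1) p.
  by apply/funext => p; rewrite peval_Msub_lr.
rewrite -ev_shift//; last by move=> p _; exact: ok_exp_neq0.
rewrite /ev (fsum_morph (f := fun x => w c.2 *: x)); [ | by rewrite scaler0
  | by move=> x y; rewrite scalerDr | exact: fs_mono].
rewrite -fsumB; [ | exact/fs_mono/fs_shift | ].
  by apply: eq_fsum => p; rewrite scalerBr !scalerA [mono _ _ * _]mulrC.
apply: (fs_map (f := fun p x => w c.2 *: x)); first by move=> p; rewrite scaler0.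
exact: fs_mono.
Qed.

End PartialEvaluation.

(** * Division by mixed factors through complete symmetric functions *)

Section CompleteSymmetric.
Variable F : comPzRingType.
Implicit Types (u : F) (us : seq F).

(* Coefficients of [prod_(u in us) 1 / (1 - u X)]. *)
Fixpoint hsym us (k : nat) : F :=
  if us is u :: us' then
    (fix aux k := hsym us' k + if k is k'.+1 then u * aux k' else 0) k
  else (k == 0)%:R.

Lemma hsym_nil k : hsym [::] k = (k == 0)%:R.
Proof. by []. Qed.

Lemma hsym0 u us : hsym (u :: us) 0 = hsym us 0.
Proof. by rewrite /= addr0. Qed.

Lemma hsymS u us k : hsym (u :: us) k.+1 = hsym us k.+1 + u * hsym (u :: us) k.
Proof. by []. Qed.

Definition hsymz us (k : int) : F := if k is Posz k' then hsym us k' else 0.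

Lemma hsymz_rec u us k : hsymz (u :: us) k = hsymz us k + u * hsymz (u :: us) (k - 1).
Proof.
case: k => [[|k]|k].
- by rewrite sub0r /= mulr0 addr0.
- by rewrite (_ : k.+1%:Z - 1 = k%:Z)//; lia.
by rewrite (_ : Negz k - 1 = Negz k.+1) /= ?mulr0 ?addr0//; lia.
Qed.

Lemma hsymz_neg us k : k < 0 -> hsymz us k = 0.
Proof. by case: k. Qed.

Lemma hsymz_nil k : hsymz [::] k = (k == 0)%:R.
Proof. by case: k. Qed.

End CompleteSymmetric.
Arguments hsym : simpl never.

Section Division.
Variables (R : realType) (X : lmodType R[i]) (T : finType).
Implicit Types (x : T -> X) (d : T -> int).

(** Division by [z - w = z (1 - w / z)] multiplies the generating series in [k] by
    [z^-1 / (1 - (w / z) X)], that is, adds the argument [w / z] to [hsymz]. Both sides solve the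
    same recursion and vanish for [k < 0], which determines them. *)
Lemma division_step (E E' : int -> X) (z w K : R[i]) us x d : z != 0 ->
  (forall t, x t != 0 -> 0 <= d t) ->
  (forall k, k < 0 -> E k = 0) ->
  (forall k, E' k = z *: E k - w *: E (k - 1)) ->
  (forall k, E' k = K *: \sum_t hsymz us (k - d t) *: x t) ->
  forall k, E k = (z^-1 * K) *: \sum_t hsymz ((w / z) :: us) (k - d t) *: x t.
Proof.
move=> z0 hd E0 h1 h2.
pose C k := (z^-1 * K) *: \sum_t hsymz ((w / z) :: us) (k - d t) *: x t.
have C0 k : k < 0 -> C k = 0.
  move=> k0; rewrite /C big1 ?scaler0// => t _.
  have [->|/hd dt] := eqVneq (x t) 0; first by rewrite scaler0.
  by rewrite hsymz_neg ?scale0r//; lia.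
have Crec k : z *: C k - w *: C (k - 1) = E' k.
  rewrite h2 /C; set S1 := \sum_t _; set S2 := \sum_t _.
  have -> : w *: ((z^-1 * K) *: S2) = K *: ((w / z) *: S2).
    by rewrite !scalerA; congr (_ *: _); ring.
  have -> : z *: ((z^-1 * K) *: S1) = K *: S1.
    by rewrite scalerA mulrA mulfV// mul1r.
  rewrite -scalerBr; congr (_ *: _).
  rewrite /S1 /S2 scaler_sumr -sumrB; apply: eq_bigr => t _.
  rewrite scalerA -scalerBl; congr (_ *: _); rewrite [in LHS]hsymz_rec.
  by rewrite [k - 1 - _]addrAC addrK.
have step k : E (k - 1) = C (k - 1) -> E k = C k.
  move=> h; apply: (scalerI z0); apply: (addIr (- (w *: E (k - 1)))).
  by rewrite -h1 h Crec.
move=> k; have [k0|k0] := ltP k 0; first by rewrite E0// -/(C k) C0.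
case: k k0 => // k _; elim: k => [|k IH]; apply: step.
  by rewrite E0// C0.
by rewrite (_ : k.+1%:Z - 1 = k%:Z)//; lia.
Qed.

(** [catrev] appears because [foldr] applies the head of [cs] outermost, so it is divided out first
    and its ratio is pushed first. *)
Lemma peval_divs m n (w : 'I_n -> R[i]) (z : 'I_m -> R[i]) cs
    (A : {ffun 'I_(m + n) -> int} -> X) us K x d : pos_r A -> (forall i, z i != 0) ->
  (forall t, x t != 0 -> 0 <= d t) ->
  let M := foldr (@Msub _ _) A (pairs_lr cs) in
  (forall k, fs (peval w M k)) ->
  (forall k, ev z (peval w M k) = K *: \sum_t hsymz us (k - d t) *: x t) ->
  (forall k, fs (peval w A k)) /\ forall k, ev z (peval w A k) =
    (\prod_(c <- cs) (z c.1)^-1 * K) *: \sum_t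
       hsymz (catrev [seq w c.2 / z c.1 | c <- cs] us) (k - d t) *: x t.
Proof.
move=> hA hz hd; elim: cs us K => [|c cs IH] us K /= hM hE.
  by split=> // k; rewrite big_nil mul1r hE.
set B := foldr _ _ _ in hM hE.
have hB : pos_r B.
  by rewrite /B; elim: (pairs_lr cs) => //= ij ps; exact: pos_r_Msub.
have [h1 h2] := peval_div hB hz hM.
have E0 k : k < 0 -> ev z (peval w B k) = 0.
  by move=> k0; apply: fsum0 => p; rewrite peval_neg// scaler0.
have h3 := division_step (hz c.1) hd E0 h2 hE.
have [h4 h5] := IH _ _ h1 h3; split=> // k.
by rewrite h5 big_cons mulrA [_ * (z c.1)^-1]mulrC.
Qed.

End Division.

Lemma Dop_flatten (I : finType) (X : zmodType) N (ps : seq (I * I)) (A : {ffun I -> int} -> X) :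
  Dop N ps A = Dop 1 (flatten [seq nseq N ij | ij <- ps]) A.
Proof.
elim: ps => //= ij ps IH; rewrite Dop_cat -IH.
by move: (Dop N ps A) => B {IH}; elim: N => //= N ->.
Qed.

Lemma DD_flatten (R : realType) (I : finType) N (ps : seq (I * I)) (z : I -> R[i]) :
  DD N ps z = \prod_(ij <- flatten [seq nseq N ij | ij <- ps]) (z ij.1 - z ij.2).
Proof.
elim: ps => [|ij ps IH]; first by rewrite /DD !big_nil.
by rewrite /DD /= big_cons big_cat big_nseq -/(DD N ps z) IH -iter_mulr_1.
Qed.

(** * Factors within the two groups and between them *)

Section Blocks.
Variables (R : realType) (m n : nat).

(** Each pair is repeated [N] times, so that the [N]-th power of a mixed factor is removed by [N]
    single divisions. *)
Definition crossN N : seq ('I_m * 'I_n) :=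
  flatten [seq nseq N c | c <- [seq (i, j) | i <- enum 'I_m, j <- enum 'I_n]].

Notation pair_l := (fun ij : 'I_m * 'I_m => (lshift n ij.1, lshift n ij.2)).
Notation pair_r := (fun ij : 'I_n * 'I_n => (rshift m ij.1, rshift m ij.2)).

Lemma prs_blocks : perm_eq (prs (enum 'I_(m + n)))
  ([seq pair_l ij | ij <- prs (enum 'I_m)] ++
   pairs_lr [seq (i, j) | i <- enum 'I_m, j <- enum 'I_n] ++
   [seq pair_r ij | ij <- prs (enum 'I_n)]).
Proof.
rewrite enum_ordD (perm_trans (prs_cat _ _))// !prs_map perm_cat2l perm_cat2r.
by rewrite allpairs_mapl allpairs_mapr /pairs_lr map_allpairs.
Qed.

Lemma pairs_lr_flatten N (cs : seq ('I_m * 'I_n)) :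
  flatten [seq nseq N ij | ij <- pairs_lr cs] = pairs_lr (flatten [seq nseq N c | c <- cs]).
Proof. by elim: cs => //= c cs ->; rewrite /pairs_lr map_cat map_nseq. Qed.

Lemma Dop_blocks (X : zmodType) N (A : {ffun 'I_(m + n) -> int} -> X) :
  Dop N (prs (enum 'I_(m + n))) A = Dop 1 (pairs_lr (crossN N))
    (Dop N [seq pair_l ij | ij <- prs (enum 'I_m)]
      (Dop N [seq pair_r ij | ij <- prs (enum 'I_n)] A)).
Proof.
by rewrite (Dop_perm _ _ prs_blocks) !Dop_cat Dop_comm Dop_flatten pairs_lr_flatten.
Qed.

Lemma DD_blocks N (y : 'I_(m + n) -> R[i]) :
  DD N (prs (enum 'I_(m + n))) y = DD N (prs (enum 'I_m)) (fun i => y (lshift n i)) *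
    (\prod_(c <- crossN N) (y (lshift n c.1) - y (rshift m c.2)) *
     DD N (prs (enum 'I_n)) (fun j => y (rshift m j))).
Proof.
rewrite (DD_perm _ _ prs_blocks) !DD_cat.
rewrite [DD N (pairs_lr _) y]DD_flatten pairs_lr_flatten /DD /pairs_lr !big_map.
by [].
Qed.

Lemma ev_join (X : lmodType R[i]) (y : 'I_(m + n) -> R[i]) (A : {ffun 'I_(m + n) -> int} -> X) :
  fs A -> ev y A = fsum (fun p => mono (fun i => y (lshift n i)) p *:
    fsum (fun q => mono (fun j => y (rshift m j)) q *: A (jidx p q))).
Proof.
move=> hA; have [h1 h2 h3] := fsum_join (fs_mono y hA).
rewrite /ev -h3; apply: eq_fsum => p.
rewrite (fsum_morph (f := fun x => mono (fun i => y (lshift n i)) p *: x)); [ | by rewrite scaler0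
  | by move=> u v; rewrite scalerDr | ].
  by apply: eq_fsum => q; rewrite mono_join scalerA.
have [hj _ _] := fsum_join hA.
apply: (fs_map (f := fun q x => mono (fun j => y (rshift m j)) q *: x)) (hj p) => q.
by rewrite scaler0.
Qed.

(** The indicator [(k - tdeg == 0)] is [hsymz [::]]: this is the starting point of the successive
    divisions in [peval_divs]. *)
Lemma ev_peval (X : lmodType R[i]) (z : 'I_m -> R[i]) (w : 'I_n -> R[i]) k
    (A : {ffun 'I_(m + n) -> int} -> X) (S : {fset {ffun 'I_(m + n) -> int}}) :
  (forall P, P \notin S -> A P = 0) ->
  fs (peval w A k) /\
  ev z (peval w A k) = \sum_(P : S) (k - tdeg (rpart (val P)) == 0)%:R *:
    ((mono z (lpart (val P)) * mono w (rpart (val P))) *: A (val P)).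
Proof.
move=> hS; pose G P : X := (if tdeg (rpart P) == k then mono w (rpart P) else 0) *: A P.
have hG : fs G by exists S => P /hS h; rewrite /G h scaler0.
have [h1 h2 _] := fsum_join hG.
have EG p : peval w A k p = fsum (fun q => G (jidx p q)).
  by apply: eq_fsum => q; rewrite /G rpart_jidx.
split; first by move: h2; congr fs; apply/funext => p; rewrite EG.
pose G' P : X := mono z (lpart P) *: G P.
have hG' : fs G' by apply: (fs_map (f := fun P x => mono z (lpart P) *: x)) hG => P; rewrite scaler0.
have [_ _ h3] := fsum_join hG'.
transitivity (fsum G').
  rewrite -h3; apply: eq_fsum => p.
  rewrite EG (fsum_morph (f := fun x => mono z p *: x)); [ | by rewrite scaler0
    | by move=> u v; rewrite scalerDr | exact: h1].
  by apply: eq_fsum => q; rewrite /G' lpart_jidx.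
rewrite (@fsumE _ _ S) => [|P /hS h]; last by rewrite /G' /G h !scaler0.
rewrite big_seq_fsetE; apply: eq_bigr => P _; rewrite /G' /G subr_eq0 [k == _]eq_sym.
by case: eqP => _; rewrite ?scale1r ?scale0r ?scaler0// scalerA.
Qed.

End Blocks.

(** * Inserting a component of the inner product *)

Section Slices.
Variables (R : realType) (V : vertexAlgebra R).

Lemma Wop_blocks m n (c : 'I_(m + n) -> V) v p q :
  Wop c (enum 'I_(m + n)) v (jidx p q) =
  Wop (fun i => c (lshift n i)) (enum 'I_m)
    (Wop (fun j => c (rshift m j)) (enum 'I_n) v q) p.
Proof.
have Wop_map (I : finType) (f : I -> 'I_(m + n)) r u P : Wop c [seq f i | i <- r] u P =
    Wop (fun i => c (f i)) r u [ffun i => P (f i)].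
  by elim: r => //= i r ->; rewrite ffunE.
rewrite enum_ordD Wop_cat !Wop_map -/(lpart (jidx p q)) -/(rpart (jidx p q)).
by rewrite lpart_jidx rpart_jidx.
Qed.

Lemma zmod_morphism_proj_Wop m (a : 'I_m -> V) l r p :
  zmod_morphism (fun v => gr_proj V l (Wop a r v p)).
Proof.
by move=> u v; rewrite WopB linearB.
Qed.

(** Only the factors among the last [n] variables are multiplied in. They act inside the innermost
    product, so the modes of the first [m] vectors are applied to the numerator of the last [n]; see
    [right_freeE]. *)
Definition right_free m n (c : 'I_(m + n) -> V) N l : {ffun 'I_(m + n) -> int} -> gr_comp V l :=
  Dop N [seq (rshift m ij.1, rshift m ij.2) | ij <- prs (enum 'I_n)]
    (fun P => gr_proj V l (Wop c (enum 'I_(m + n)) (va_vac V) P)).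

(** All factors except the mixed ones. Obtaining this from the full numerator means dividing by the
    [z_i - w_j], which produces the expansion in [w_j / z_i]. *)
Definition cross_free m n (c : 'I_(m + n) -> V) N l : {ffun 'I_(m + n) -> int} -> gr_comp V l :=
  Dop N [seq (lshift n ij.1, lshift n ij.2) | ij <- prs (enum 'I_m)] (right_free c N l).

Lemma right_freeE m n (c : 'I_(m + n) -> V) N l p q :
  right_free c N l (jidx p q) = gr_proj V l (Wop (fun i => c (lshift n i)) (enum 'I_m)
       (Mv (fun j => c (rshift m j)) N q) p).
Proof.
rewrite /right_free Dop_join_r.
have -> : (fun q => gr_proj V l (Wop c (enum 'I_(m + n)) (va_vac V) (jidx p q))) =
   fun q => gr_proj V l (Wop (fun i => c (lshift n i)) (enum 'I_m)
     (Wop (fun j => c (rshift m j)) (enum 'I_n) (va_vac V) q) p).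
  by apply/funext => q'; rewrite Wop_blocks.
exact: (@Dop_morph _ _ _ (fun v => gr_proj V l (Wop (fun i => c (lshift n i)) (enum 'I_m) v p)) N
  _ _ q (zmod_morphism_proj_Wop _ _ _ _)).
Qed.

Lemma cross_freeE m n (c : 'I_(m + n) -> V) N l p q :
  cross_free c N l (jidx p q) = Dop N (prs (enum 'I_m))
    (fun p => gr_proj V l (Wop (fun i => c (lshift n i)) (enum 'I_m)
       (Mv (fun j => c (rshift m j)) N q) p)) p.
Proof.
rewrite /cross_free Dop_join_l; congr (Dop N _ _ p); apply/funext => {}p.
exact: right_freeE.
Qed.

Lemma right_free_pos m n (c : 'I_(m + n) -> V) N l : (forall i j, loc N (c i) (c j)) ->
  pos_r (right_free c N l).
Proof.
move=> hl P; rewrite -(jidx_parts P) right_freeE => h j; rewrite jidx_r leNgt.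
apply: contra h => h; by rewrite (@Mv_pos _ _ _ _ N j)// Wop0 linear0.
Qed.

Lemma cross_free_pos m n (c : 'I_(m + n) -> V) N l : (forall i j, loc N (c i) (c j)) ->
  pos_r (cross_free c N l).
Proof. by move=> hl; apply: pos_r_Dop; exact: right_free_pos. Qed.

Lemma Mv_cross_free m n (c : 'I_(m + n) -> V) N l :
  (fun P => gr_proj V l (Mv c N P)) = Dop 1 (pairs_lr (crossN m n N)) (cross_free c N l).
Proof. by rewrite -Dop_blocks; apply/funext => P; rewrite -Dop_additive. Qed.

Variable mu : forall m : nat, 'rV[V]_m -> 'rV[R[i]]_m -> completion V.
Hypothesis Hmu : is_multiplication mu.

Lemma not_fat_row0 m (z : 'rV[R[i]]_m) : ~ fat_diagonal (row_mx z (0 : 'rV_1)) ->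
  (forall i, z 0 i != 0) /\ ~ fat_diagonal z.
Proof.
move=> /not_fat_diagonalP h; split=> [i|].
  by have := h (lshift 1 i) (rshift m 0); rewrite eq_lrshift row_mxEl row_mxEr mxE; apply.
apply/not_fat_diagonalP => i j ij.
have := h (lshift 1 i) (lshift 1 j); rewrite !row_mxEl (inj_eq (@lshift_inj _ _)).
exact.
Qed.

(** At the last point [0] only exponent [0] of the last variable contributes, and its coefficient is
    [v] by creation. The mixed factors become powers of the [z_i], which are nonzero and cancel. *)
Lemma mu_slice m (a : 'rV[V]_m) (v : V) N l (z : 'rV[R[i]]_m) :
  let c := row_mx a (const_mx v : 'rV_1) in
  let T p := gr_proj V l (Wop (a 0) (enum 'I_m) v p) in
  (forall i j, loc N (c 0 i) (c 0 j)) ->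
  ~ fat_diagonal (row_mx z (0 : 'rV_1)) ->
  fs (Dop N (prs (enum 'I_m)) T) /\
  DD N (prs (enum 'I_m)) (z 0) *: mu c (row_mx z (0 : 'rV_1)) l =
    ev (z 0) (Dop N (prs (enum 'I_m)) T).
Proof.
move=> c T hl hz; have [z0 zf] := not_fat_row0 hz.
pose w : 'I_1 -> R[i] := fun=> 0.
have cl : (fun i => c 0 (lshift 1 i)) = a 0 by apply/funext => i; rewrite row_mxEl.
have zl : (fun i => row_mx z (0 : 'rV_1) 0 (lshift 1 i)) = z 0 by apply/funext => i; rewrite row_mxEl.
have zr : (fun j => row_mx z (0 : 'rV_1) 0 (rshift m j)) = w by apply/funext => j; rewrite row_mxEr mxE.
have prs1 : prs (enum 'I_1) = [::].
  have : size (enum 'I_1) = 1%N by rewrite size_enum_ord.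
  by case: (enum 'I_1) => [//|x [|//]].
have tdeg1 (q : {ffun 'I_1 -> int}) : tdeg q = q 0 by rewrite /tdeg big_ord1.
have mono0 (q : {ffun 'I_1 -> int}) : 0 <= q 0 -> mono w q = (q 0 == 0)%:R.
  by rewrite /mono big_ord1; case: (q 0) => // -[|k] _; rewrite ?expr0z// -exprnP expr0n.
have evw0 (A : {ffun 'I_(m + 1) -> int} -> gr_comp V l) : pos_r A -> forall p,
    fsum (fun q => mono w q *: A (jidx p q)) = peval w A 0 p.
  move=> hA p; apply: eq_fsum => q; rewrite tdeg1.
  have [->|/hA/(_ 0)] := eqVneq (A (jidx p q)) 0; first by rewrite !scaler0.
  by rewrite jidx_r => /mono0 ->; case: eqP.
have hpos : pos_r (cross_free (c 0) N l) by exact: cross_free_pos.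
have hMfs := Mv_fs l hl; rewrite Mv_cross_free in hMfs.
have TE : peval w (cross_free (c 0) N l) 0 = Dop N (prs (enum 'I_m)) T.
  apply/funext => p; rewrite /peval (@fsumE _ _ [fset 0]%fset).
    rewrite big_seq_fset1 tdeg1 ffunE eqxx mono0 ?ffunE// eqxx scale1r cross_freeE cl.
    congr (Dop N _ _ p); apply/funext => p'; congr (gr_proj V l (Wop _ _ _ p')).
    rewrite /Mv prs1 /=.
    have -> : enum 'I_1 = [:: 0] by apply: (inj_map val_inj); rewrite val_enum_ord.
    by rewrite /= ffunE row_mxEr mxE oppr0 sub0r (va_creation v).1.
  move=> q; rewrite inE => q0; case: (tdeg q =P 0) => [|_]; last by rewrite scale0r.
  rewrite tdeg1 => qz; case/negP: q0; apply/eqP/ffunP => j; rewrite ord1 qz ffunE.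
  by [].
have main cs : (forall k, fs (peval w (Dop 1 (pairs_lr cs) (cross_free (c 0) N l)) k)) ->
    (forall k, fs (peval w (cross_free (c 0) N l) k)) /\
    ev (z 0) (peval w (Dop 1 (pairs_lr cs) (cross_free (c 0) N l)) 0) =
    \prod_(c <- cs) z 0 c.1 *: ev (z 0) (peval w (cross_free (c 0) N l) 0).
  elim: cs => [|x cs IH] h; first by rewrite big_nil scale1r.
  have hp : pos_r (Dop 1 (pairs_lr cs) (cross_free (c 0) N l)) by exact: pos_r_Dop.
  have [h1 h2] := peval_div hp z0 h.
  have [h3 h4] := IH h1; split=> //.
  by rewrite [LHS]h2 /w scale0r subr0 h4 scalerA big_cons.
have [S hS] := hMfs.
have [h1 h2] := main (crossN m 1 N) (fun k => (ev_peval (z 0) w k hS).1).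
split; first by rewrite -TE.
have Pn0 : \prod_(c <- crossN m 1 N) z 0 c.1 != 0.
  by rewrite prodf_seq_neq0; apply/allP => x _; exact: z0.
apply: (scalerI Pn0); rewrite -TE -h2.
have := mu_rational Hmu l hl hz.
rewrite DD_blocks Mv_cross_free ev_join// zl zr.
have -> : DD N (prs (enum 'I_1)) w = 1 by rewrite prs1 /DD big_nil.
rewrite mulr1 scalerA mulrC.
have -> : \prod_(c <- crossN m 1 N) (row_mx z (0 : 'rV_1) 0 (lshift 1 c.1)
    - row_mx z (0 : 'rV_1) 0 (rshift m c.2)) = \prod_(c <- crossN m 1 N) z 0 c.1.
  by apply: eq_bigr => x _; rewrite row_mxEl row_mxEr mxE subr0.
rewrite mulrC => ->; apply: eq_fsum => p; rewrite evw0//.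
exact: pos_r_Dop.
Qed.

Lemma gr_inj_projK k (v : V) : (forall k', k' != k -> gr_proj V k' v = 0) ->
  gr_inj V k (gr_proj V k v) = v.
Proof.
move=> h; have [s hs] := gr_sum v; rewrite [in RHS]hs.
have [ks|ks] := boolP (k \in s).
  rewrite (big_fsetD1 k)//= big_seq big1 ?addr0// => j; rewrite !inE => /andP[jk _].
  by rewrite h// linear0.
rewrite [RHS]big_seq big1 => [|j js]; last first.
  by rewrite h ?linear0//; apply: contraNneq ks => <-.
have -> : gr_proj V k v = 0; last by rewrite linear0.
rewrite hs linear_sum big_seq big1// => j js; apply: gr_proj0.
by apply: contraNneq ks => ->.
Qed.

(** For homogeneous entries the degree of a coefficient of the numerator is fixed by its total
    exponent, so [p_k] selects the exponents of total degree [kap]. *)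
Lemma mu_homogeneous n (b : 'rV[V]_n) (d : 'I_n -> int) N k (w : 'rV[R[i]]_n) :
  (forall i j, loc N (b 0 i) (b 0 j)) -> (forall j, homogeneous (d j) (b 0 j)) ->
  ~ fat_diagonal w ->
  let kap := k - \sum_j d j + (N * size (prs (enum 'I_n)))%:Z in
  let G q := (if tdeg q == kap then mono (w 0) q else 0) *: Mv (b 0) N q in
  fs G /\ DD N (prs (enum 'I_n)) (w 0) *: gr_inj V k (mu b w k) = fsum G.
Proof.
move=> hl hd hw kap G.
have GE q : G q = mono (w 0) q *: gr_inj V k (gr_proj V k (Mv (b 0) N q)).
  rewrite /G; case: eqP => hq.
    rewrite gr_inj_projK// => k' k'k; apply: (Mv_homogeneous hd).
    by rewrite hq /kap; apply: contra k'k => /eqP ->; apply/eqP; ring.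
  rewrite (Mv_homogeneous hd) ?linear0 ?scaler0 ?scale0r//.
  by apply/eqP => e; apply: hq; rewrite /kap e; ring.
have hG : fs G.
  have [S hS] := Mv_fs k hl.
  by exists S => q /hS h; rewrite GE h linear0 scaler0.
split=> //; rewrite -linearZ /= (mu_rational Hmu)// /ev (fsum_morph (f := fun x => gr_inj V k x));
  [ | exact: linear0 | exact: linearD | exact/fs_mono/Mv_fs].
by apply: eq_fsum => q; rewrite GE linearZ.
Qed.

(* The case [z_(m+1) = 0]: up to the factor that clears denominators, the terms are the
   components, homogeneous in [w], of the expansion of [1 / (z_i - w_j)] in [w_j / z_i]. *)
Lemma origin_formula m n (a : 'rV[V]_m) (b : 'rV[V]_n) (d : 'I_n -> int) N l
    (S : {fset {ffun 'I_(m + n) -> int}}) :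
  let c := row_mx a b in
  (forall i j, loc N (c 0 i) (c 0 j)) -> (forall j, homogeneous (d j) (b 0 j)) ->
  (forall P, P \notin S -> gr_proj V l (Mv (c 0) N P) = 0) ->
  forall k (z : 'rV[R[i]]_m) (w : 'rV[R[i]]_n),
  ~ fat_diagonal (row_mx z (0 : 'rV_1)) -> ~ fat_diagonal w ->
  (DD N (prs (enum 'I_m)) (z 0) * DD N (prs (enum 'I_n)) (w 0)) *:
    mu (row_mx a (const_mx (gr_inj V k (mu b w k)) : 'rV_1)) (row_mx z (0 : 'rV_1)) l =
  \prod_(x <- crossN m n N) (z 0 x.1)^-1 *: \sum_(P : S)
    hsymz (catrev [seq w 0 x.2 / z 0 x.1 | x <- crossN m n N] [::])
      (k - \sum_j d j + (N * size (prs (enum 'I_n)))%:Z - tdeg (rpart (val P))) *: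
    ((mono (z 0) (lpart (val P)) * mono (w 0) (rpart (val P))) *:
      gr_proj V l (Mv (c 0) N (val P))).
Proof.
move=> c hl hd hS k z w hz hw; have [z0 zf] := not_fat_row0 hz.
have cl : (fun i => c 0 (lshift n i)) = a 0 by apply/funext => i; rewrite row_mxEl.
have cr : (fun j => c 0 (rshift m j)) = b 0 by apply/funext => j; rewrite row_mxEr.
have hlb i j : loc N (b 0 i) (b 0 j) by have := hl (rshift m i) (rshift m j); rewrite !row_mxEr.
set v := gr_inj V k _; set kap := k - _ + _.
have [hG hv] := mu_homogeneous k hlb hd hw.
have hpos : pos_r (cross_free (c 0) N l) by exact: cross_free_pos.
have rpos : pos_r (right_free (c 0) N l) by exact: right_free_pos.
set Dw := DD N _ (w 0) in hv *.
(* The part of degree [kap] in [w] is the product of the fields of [a] applied to the inserted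
   vector, up to the denominator [Dw]. *)
have rE : peval (w 0) (right_free (c 0) N l) kap =
    fun p => gr_proj V l (Wop (a 0) (enum 'I_m) (Dw *: v) p).
  apply/funext => p; rewrite hv (fsum_morph (f := fun u => gr_proj V l (Wop (a 0) (enum 'I_m) u p))) //.
  - apply: eq_fsum => q; rewrite right_freeE cl cr -/kap.
    by rewrite WopZ linearZ.
  - by rewrite Wop0 linear0.
  - by move=> x y; rewrite WopD linearD.
have hM P : P \notin S -> Dop 1 (pairs_lr (crossN m n N)) (cross_free (c 0) N l) P = 0.
  by move=> /hS h; rewrite -Mv_cross_free.
pose x (P : S) := (mono (z 0) (lpart (val P)) * mono (w 0) (rpart (val P))) *:
  Dop 1 (pairs_lr (crossN m n N)) (cross_free (c 0) N l) (val P).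
have xd P : x P != 0 -> 0 <= tdeg (rpart (val P)).
  move=> xP; apply: sumr_ge0 => j _; rewrite ffunE.
  have hp : pos_r (Dop 1 (pairs_lr (crossN m n N)) (cross_free (c 0) N l)) by exact: pos_r_Dop.
  by apply: hp; apply: contraNneq xP => h; rewrite /x h scaler0.
have xE k' : ev (z 0) (peval (w 0) (Dop 1 (pairs_lr (crossN m n N)) (cross_free (c 0) N l)) k') =
    1 *: \sum_(P : S) hsymz [::] (k' - tdeg (rpart (val P))) *: x P.
  by rewrite scale1r (ev_peval (z 0) (w 0) k' hM).2; apply: eq_bigr => P _; rewrite hsymz_nil.
have [h1 h2] := peval_divs hpos z0 xd (fun k => (ev_peval (z 0) (w 0) k hM).1) xE.
have -> : \sum_(P : S) hsymz (catrev [seq w 0 y.2 / z 0 y.1 | y <- crossN m n N] [::])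
      (kap - tdeg (rpart (val P))) *: ((mono (z 0) (lpart (val P)) * mono (w 0) (rpart (val P))) *:
      gr_proj V l (Mv (c 0) N (val P))) =
    \sum_(P : S) hsymz (catrev [seq w 0 y.2 / z 0 y.1 | y <- crossN m n N] [::])
      (kap - tdeg (rpart (val P))) *: x P.
  by apply: eq_bigr => P _; rewrite /x -Mv_cross_free.
rewrite -[\prod_(y <- _) _]mulr1 -h2.
pose c' := row_mx a (const_mx v : 'rV_1).
have [N1 hN1] := loc_row c'.
(* The exponent required by [mu_slice] depends on [v], hence on [k] and [w]. The identity is proved
   after multiplication by the surplus power [N' - N] of the Vandermonde product in [z], which is
   nonzero and cancels; the result involves [N] alone. *)
pose N' := maxn N N1.
have [k1 k2] := mu_slice l (hN1 N' (leq_maxr _ _)) hz.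
have NN : (N' = (N' - N) + N)%N by rewrite subnK// leq_maxl.
apply: (scalerI (DD_neq0_fat (N' - N) zf)).
rewrite scalerA mulrA -DD_addn -NN mulrC -scalerA k2.
set T := fun p => gr_proj V l _.
have -> : Dw *: ev (z 0) (Dop N' (prs (enum 'I_m)) T) =
   ev (z 0) (Dop N' (prs (enum 'I_m)) (peval (w 0) (right_free (c 0) N l) kap)).
  rewrite /ev (fsum_morph (f := fun u => Dw *: u)); [ | by rewrite scaler0
    | by move=> x' y; rewrite scalerDr | exact: fs_mono].
  apply: eq_fsum => p; rewrite scalerA mulrC -scalerA; congr (_ *: _).
  rewrite rE -(Dop_morph (f := fun u => Dw *: u)); last by move=> u u'; rewrite scalerBr.
  by congr (Dop N' _ _ p); apply/funext => p'; rewrite WopZ linearZ.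
rewrite NN DopD.
have -> : Dop N (prs (enum 'I_m)) (peval (w 0) (right_free (c 0) N l) kap) =
    peval (w 0) (cross_free (c 0) N l) kap.
  by apply/funext => p; rewrite /cross_free peval_Dop_l.
have [_ _ ->] := @ev_Dop R _ _ (z 0) _ (N' - N) (prs (enum 'I_m)) (h1 kap)
  (fun p _ => ok_exp_neq0 p z0).
by rewrite addnK.
Qed.

End Slices.

(** * Convergence *)

Section ShiftedSums.
Variable R : realType.
Implicit Types (M : nat -> R) (e B : R).

Definition zext (X : zmodType) (g : nat -> X) (k : int) : X := if k is Posz n then g n else 0.

Lemma ler_sum_fsub (T : choiceType) (A A' : {fset T}) (f : T -> R) :
  (forall t, 0 <= f t) -> (A `<=` A')%fset -> \sum_(t <- A) f t <= \sum_(t <- A') f t.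
Proof.
move=> f0 AA'; pose f' t := if t \in A then f t else 0.
have -> : \sum_(t <- A) f t = \sum_(t <- A) f' t.
  by rewrite big_seq [RHS]big_seq; apply: eq_bigr => t tA; rewrite /f' tA.
rewrite (big_fset_incl _ AA') => [|t _ /negbTE tA]; last by rewrite /f' tA.
by apply: ler_sum => t _; rewrite /f'; case: ifP.
Qed.

Definition ishift (k0 : int) (n : nat) : {fset int} :=
  seq_fset tt [seq k0 + i%:Z | i <- iota 0 n].

Lemma sum_ishift (X : zmodType) (g : nat -> X) k0 n :
  \sum_(k <- ishift k0 n) zext g (k - k0) = \sum_(i < n) g i.
Proof.
rewrite (perm_big [seq k0 + i%:Z | i <- iota 0 n]); last first.
  rewrite (perm_trans (seq_fset_perm _ _))// undup_id// map_inj_uniq ?iota_uniq//.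
  by move=> i j /addrI [].
rewrite big_map -(big_mkord xpredT) /index_iota subn0; apply: eq_bigr => i _.
by rewrite addrC addKr.
Qed.

Lemma mem_ishift k0 n (k : int) : (k \in ishift k0 n) = (k0 <= k) && (k < k0 + n%:Z).
Proof.
rewrite seq_fsetE; apply/mapP/andP => [[j jn ->] | [h1 h2]].
  by move: jn; rewrite mem_iota add0n /= => jn; split; lia.
by exists `|k - k0|%N; rewrite ?mem_iota; lia.
Qed.

Lemma zext_ge0 M k : (forall i, 0 <= M i) -> 0 <= zext M k.
Proof. by move=> h; case: k => // n; exact: h. Qed.

Lemma fset_ishift k0 (A : {fset int}) : exists n, forall k, k \in A -> k < k0 + n%:Z.
Proof.
exists (\sum_(k <- A) `|k - k0|).+1 => k kA.
have : (`|k - k0| <= \sum_(k <- A) `|k - k0|)%N by rewrite (big_fsetD1 k)//= leq_addr.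
by move: (\sum_(_ <- _) _)%N => s; lia.
Qed.

Lemma shifted_sum_le M B k0 (A : {fset int}) : (forall i, 0 <= M i) ->
  (forall n, \sum_(i < n) M i <= B) -> \sum_(k <- A) zext M (k - k0) <= B.
Proof.
move=> M0 hB; have [n hn] := fset_ishift k0 A.
apply: le_trans (hB n); rewrite -(sum_ishift M k0).
pose A' := [fset k in A | k0 <= k]%fset.
have -> : \sum_(k <- A) zext M (k - k0) = \sum_(k <- A') zext M (k - k0).
  rewrite [RHS](@big_fset_incl _ _ _ _ A' A)//; first exact: fset_sub.
  move=> k kA; rewrite !inE kA /= -ltNge => kk0.
  by case E : (k - k0) => [j|j] //; move: E kk0; lia.
apply: ler_sum_fsub => [k|]; first exact: zext_ge0.
by apply/fsubsetP => k; rewrite !inE mem_ishift => /andP[/hn -> ->].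
Qed.

(** The partial sums approach their supremum, and indices outside the initial window can add at most
    the remaining deficit. [n0] is independent of the shift [k0]. *)
Lemma shifted_tail M B : (forall i, 0 <= M i) -> (forall n, \sum_(i < n) M i <= B) ->
  forall e, 0 < e -> exists n0, forall n k0 (A : {fset int}), (n0 <= n)%N ->
    (forall k, k \in ishift k0 n -> k \notin A) -> \sum_(k <- A) zext M (k - k0) <= e.
Proof.
move=> M0 hB e e0; pose S := [set \sum_(i < n) M i | n in setT].
have hS : has_sup S.
  by split; [exists (\sum_(i < 0) M i), 0%N | exists B => _ [n _ <-]].
have [_ [n0 _ <-] hn0] := sup_adherent e0 hS.
exists n0 => n k0 A nn hA.
have hle : sup S - e <= \sum_(i < n) M i.
  apply: (le_trans (ltW hn0)); rewrite -(subnKC nn) big_split_ord /= lerDl.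
  by apply: sumr_ge0.
have : \sum_(k <- (ishift k0 n `|` A)%fset) zext M (k - k0) <= sup S.
  apply: shifted_sum_le => // N; apply: ub_le_sup; first by case: hS.
  by exists N.
have -> : \sum_(k <- (ishift k0 n `|` A)%fset) zext M (k - k0) =
   \sum_(k <- ishift k0 n) zext M (k - k0) + \sum_(k <- A) zext M (k - k0).
  rewrite (big_fsetID _ (mem (ishift k0 n))); congr (_ + _); apply: eq_fbigl => k.
    by rewrite !inE /=; case: (k \in ishift k0 n); rewrite ?andbF.
  rewrite !inE /=; case kn: (k \in ishift k0 n); rewrite /= ?andbT//.
  by rewrite (negbTE (hA k kn)).
by rewrite sum_ishift; lra.
Qed.

Definition ssum (g : int -> R[i]) (s : R[i]) : Prop := forall e, 0 < e ->
  exists A0 : {fset int}, forall A : {fset int}, (A0 `<=` A)%fset ->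
    cmod (\sum_(k <- A) g k - s) <= e.

Definition slim (T : nat -> R[i]) (s : R[i]) : Prop := forall e, 0 < e ->
  exists n0, forall n, (n0 <= n)%N -> cmod (T n - s) <= e.

(** A summable majorant turns the limit along initial segments into an unordered sum over the
    integers. *)
Lemma ssum_dominated (g : nat -> R[i]) M B s k0 : (forall i, cmod (g i) <= M i) ->
  (forall n, \sum_(i < n) M i <= B) -> slim (fun n => \sum_(i < n) g i) s ->
  ssum (fun k => zext g (k - k0)) s.
Proof.
move=> gM hB hs e e0; have M0 i : 0 <= M i by apply: le_trans (gM i); exact: cmod_ge0.
have e20 : 0 < e / 2 by lra.
have [n1 h1] := hs _ e20; have [n2 h2] := shifted_tail M0 hB e20.
pose n := maxn n1 n2; exists (ishift k0 n) => A hA.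
have -> : \sum_(k <- A) zext g (k - k0) - s =
   (\sum_(i < n) g i - s) + \sum_(k <- (A `\` ishift k0 n)%fset) zext g (k - k0).
  rewrite -(sum_ishift g k0) addrAC; congr (_ - _).
  rewrite (big_fsetID _ (mem (ishift k0 n))); congr (_ + _); apply: eq_fbigl => k.
    by rewrite !inE /= andb_idl// => /(fsubsetP hA).
  by rewrite !inE /= andbC.
apply: le_trans (cmodD _ _) _; rewrite (splitr e) lerD//.
  by apply: h1; exact: leq_maxl.
apply: (le_trans (cmod_sum _ _ _)).
apply: (@le_trans _ _ (\sum_(k <- (A `\` ishift k0 n)%fset) zext M (k - k0))).
  by apply: ler_sum => k _; rewrite /zext; case: (k - k0) => j; [exact: gM|rewrite cmod0].
apply: (h2 n); first exact: leq_maxr.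
by move=> k kn; rewrite !inE kn.
Qed.

Lemma ssumZ g s c : ssum g s -> ssum (fun k => c * g k) (c * s).
Proof.
move=> h e e0; have D0 : 0 < cmod c + 1 by rewrite ltr_wpDl ?cmod_ge0.
have [A0 hA0] := h _ (divr_gt0 e0 D0); exists A0 => A /hA0 hA.
rewrite -mulr_sumr -mulrBr cmodM; apply: le_trans (ler_wpM2l (cmod_ge0 c) hA) _.
by rewrite mulrA ler_pdivrMr// mulrC ler_wpM2l ?(ltW e0)// lerDl.
Qed.

Lemma hsymz_zext us : hsymz us = zext (@hsym R[i] us).
Proof. by []. Qed.

Lemma hsym_ge0 (us : seq R) k : (forall u, u \in us -> 0 <= u) -> 0 <= hsym us k.
Proof.
elim: us k => [|u us IH] k h; first by rewrite hsym_nil ler0n.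
have hus j : 0 <= hsym us j by apply: IH => v vu; apply: h; rewrite inE vu orbT.
elim: k => [|k IHk]; first by rewrite hsym0.
by rewrite hsymS addr_ge0// mulr_ge0// h// mem_head.
Qed.

Lemma cmod_hsym (us : seq R[i]) (r : R) k : (forall u, u \in us -> cmod u <= r) ->
  cmod (hsym us k) <= hsym (nseq (size us) r) k.
Proof.
elim: us k => [|u us IH] k h; first by rewrite !hsym_nil cmod_nat.
have hus j : cmod (hsym us j) <= hsym (nseq (size us) r) j.
  by apply: IH => v vu; apply: h; rewrite inE vu orbT.
have ur : cmod u <= r by rewrite h// mem_head.
elim: k => [|k IHk]; first by rewrite [nseq _ _]/= !hsym0.
rewrite [nseq _ _]/= !hsymS (le_trans (cmodD _ _))// lerD// cmodM.
by rewrite ler_pM ?cmod_ge0.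
Qed.

Lemma sum_hsym_nil (F : comPzRingType) n : \sum_(k < n.+1) hsym [::] k = 1 :> F.
Proof.
by rewrite big_ord_recl hsym_nil big1 ?addr0// => k _; rewrite hsym_nil.
Qed.

(** Multiplication by [1 - u X] removes the argument [u]; for partial sums a boundary term remains.
    Over nonnegative reals it is dropped to obtain a bound, and in [hsym_slim] it tends to [0]. *)
Lemma hsym_partial (F : comPzRingType) (u : F) us n :
  (1 - u) * \sum_(k < n.+1) hsym (u :: us) k =
  \sum_(k < n.+1) hsym us k - u * hsym (u :: us) n.
Proof.
elim: n => [|n IH]; first by rewrite !big_ord1 !hsym0; ring.
rewrite big_ord_recr /= mulrDr IH [in RHS]big_ord_recr /= hsymS; ring.
Qed.

Lemma hsym_sum_le (r : R) N n : 0 <= r < 1 ->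
  \sum_(k < n) hsym (nseq N r) k <= (1 - r) ^- N.
Proof.
move=> /andP[r0 r1]; have r10 : 0 < 1 - r by rewrite subr_gt0.
have H0 N' k : 0 <= hsym (nseq N' r) k by apply: hsym_ge0 => u; rewrite mem_nseq => /andP[_ /eqP ->].
elim: N n => [|N IH] n.
  rewrite expr0 invr1; case: n => [|n]; first by rewrite big_ord0 ler01.
  by rewrite sum_hsym_nil.
case: n => [|n]; first by rewrite big_ord0 invr_ge0 exprn_ge0// ltW.
rewrite -(ler_pM2l r10) exprS invfM mulVKf ?gt_eqF//.
have := hsym_partial r (nseq N r) n; rewrite -[r :: nseq N r]/(nseq N.+1 r) => ->.
by apply: le_trans (IH n.+1); rewrite gerBl mulr_ge0.
Qed.

Lemma cmod_lt1_bound (us : seq R[i]) : (forall u, u \in us -> cmod u < 1) ->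
  exists2 r : R, 0 <= r < 1 & forall u, u \in us -> cmod u <= r.
Proof.
elim: us => [|v vs IH] h; first by exists 0; rewrite ?lexx ?ltr01.
have [|r /andP[r0 r1] hr] := IH; first by move=> y yv; apply: h; rewrite inE yv orbT.
exists (Num.max r (cmod v)); first by rewrite le_max r0 gt_max r1 h// mem_head.
by move=> y; rewrite inE le_max => /predU1P[->|/hr ->]; rewrite ?lexx ?orbT.
Qed.

Lemma hsym_slim (us : seq R[i]) : (forall u, u \in us -> cmod u < 1) ->
  slim (fun n => \sum_(k < n) hsym us k) (\prod_(u <- us) (1 - u)^-1).
Proof.
elim: us => [|u us IH] h.
  move=> e e0; exists 1%N => -[//|n] _.
  by rewrite sum_hsym_nil big_nil subrr cmod0 ltW.
have hus v : v \in us -> cmod v < 1 by move=> vu; apply: h; rewrite inE vu orbT.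
have [r /andP[r0 r1] hr] := cmod_lt1_bound h.
have u1 : 1 - u != 0.
  by rewrite subr_eq0; apply/eqP => u1; have := h u (mem_head _ _); rewrite -u1 cmod1 ltxx.
have tail := shifted_tail (fun i => @hsym_ge0 (nseq (size (u :: us)) r) i _)
  (fun n => hsym_sum_le (size (u :: us)) n (introT andP (conj r0 r1))).
move=> e e0.
have c0 : 0 < cmod (1 - u) by rewrite cmod_gt0.
have e20 : 0 < e * cmod (1 - u) / 2 by rewrite divr_gt0// mulr_gt0.
have [n1 h1] := IH hus _ e20.
have [|n2 h2] := tail _ _ e20.
  by move=> y; rewrite mem_nseq => /andP[_ /eqP ->].
exists (maxn n1 n2).+1 => -[//|n]; rewrite ltnS geq_max => /andP[n1n n2n].
rewrite -(ler_pM2l c0) -cmodM mulrBr hsym_partial big_cons mulVKf//.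
have -> : \sum_(k < n.+1) hsym us k - u * hsym (u :: us) n - \prod_(v <- us) (1 - v)^-1 =
  (\sum_(k < n.+1) hsym us k - \prod_(v <- us) (1 - v)^-1) - u * hsym (u :: us) n by ring.
apply: le_trans (cmodB _ _) _; rewrite [cmod (1 - u) * e]mulrC (splitr (e * _)) lerD//.
  by apply: h1; exact: leqW.
rewrite cmodM; apply: (@le_trans _ _ (hsym (nseq (size (u :: us)) r) n)).
  rewrite -[leRHS]mul1r ler_pM ?cmod_ge0 ?cmod_hsym//.
  by rewrite ltW// h// mem_head.
(* The boundary term is controlled as a tail with the single index [n], just outside the window
   [ishift 0 n]. *)
have := h2 n 0 [fset n%:Z]%fset n2n; rewrite big_seq_fset1 subr0; apply.
move=> k; rewrite mem_ishift add0r inE => /andP[_ kn].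
by rewrite lt_eqF.
Qed.

Lemma hsymz_sum (us : seq R[i]) k0 : (forall u, u \in us -> cmod u < 1) ->
  ssum (fun k => hsymz us (k - k0)) (\prod_(u <- us) (1 - u)^-1).
Proof.
move=> h; have [r r01 hr] := cmod_lt1_bound h.
apply: ssum_dominated (hsym_slim h); first by move=> i; exact: cmod_hsym hr.
by move=> n; exact: hsym_sum_le.
Qed.

End ShiftedSums.

(** * Normally convergent expansions in finite families of vectors *)

Section Expansions.
Variables (R : realType) (E : normedModType R[i]) (X : lmodType R[i]).

(* A criterion for normal convergence that is stable under finite sums. *)
Definition expands (U : set E) (f : int -> E -> X) (F : E -> X) : Prop :=
  exists (J : finType) (e : J -> X) (c : int -> J -> E -> R[i]^o) (s : J -> E -> R[i]),
  [/\ forall k j x, U x -> differentiable (c k j) x,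
      forall k x, U x -> f k x = \sum_j c k j x *: e j,
      forall x, U x -> F x = \sum_j s j x *: e j,
      forall K, compact K -> K `<=` U -> forall j, exists (M : int -> R) (B : R),
        [/\ forall k, 0 <= M k, forall k x, K x -> cmod (c k j x) <= M k
          & forall A : {fset int}, \sum_(k <- A) M k <= B]
    & forall x, U x -> forall j, ssum (fun k => c k j x) (s j x)].

Lemma expandsD U f f' F F' : expands U f F -> expands U f' F' ->
  expands U (fun k x => f k x + f' k x) (fun x => F x + F' x).
Proof.
move=> [J [e [c [s [h1 h2 h3 h4 h5]]]]] [J' [e' [c' [s' [h1' h2' h3' h4' h5']]]]].
exists (J + J')%type, (fun j => match j with inl i => e i | inr i => e' i end),
  (fun k j => match j with inl i => c k i | inr i => c' k i end),
  (fun j => match j with inl i => s i | inr i => s' i end); split.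
- by move=> k [j|j] x Ux; [exact: h1|exact: h1'].
- by move=> k x Ux; rewrite big_sumType /= h2// h2'.
- by move=> x Ux; rewrite big_sumType /= h3// h3'.
- by move=> K cK KU [j|j]; [exact: h4|exact: h4'].
- by move=> x Ux [j|j]; [exact: h5|exact: h5'].
Qed.

Lemma expands_eq U f f' F F' : (forall k x, U x -> f k x = f' k x) ->
  (forall x, U x -> F x = F' x) -> expands U f F -> expands U f' F'.
Proof.
move=> ff FF [J [e [c [s [h1 h2 h3 h4 h5]]]]]; exists J, e, c, s; split=> //.
- by move=> k x Ux; rewrite -ff// h2.
- by move=> x Ux; rewrite -FF// h3.
Qed.

(** The sum of the moduli of the coordinates in a basis of the span; the weights [w] absorb the
    change from the spanning family to the basis. *)
Lemma span_norm (J : finType) (e : J -> X) : exists (Y : set X) (nu : X -> R),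
  [/\ findim_subspace Y, norm_on Y nu, forall c : J -> R[i], Y (\sum_j c j *: e j)
    & exists2 w : J -> R, forall j, 0 <= w j & forall c : J -> R[i],
        nu (\sum_j c j *: e j) <= \sum_j cmod (c j) * w j].
Proof.
have [d [b [A [hb hA]]]] := spanning_basis e.
have /choice[co hco] : forall v, exists c : 'I_d -> R[i], lin_span b v -> v = \sum_i c i *: b i.
  move=> v; have [[c hc]|h] := pselect (lin_span b v); first by exists c.
  by exists (fun=> 0).
have uniq_co c c' : \sum_i c i *: b i = \sum_i c' i *: b i -> forall i, c i = c' i.
  move=> h i; apply/eqP; rewrite -subr_eq0; apply/eqP.
  apply: (hb (fun i => c i - c' i)); under eq_bigr do rewrite scalerBl.
  by rewrite sumrB h subrr.
have coE c i : co (\sum_i c i *: b i) i = c i.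
  by apply/esym/uniq_co/hco; exists c.
have sumE (c : J -> R[i]) : \sum_j c j *: e j = \sum_i (\sum_j c j * A j i) *: b i.
  under eq_bigr do rewrite hA scaler_sumr.
  rewrite exchange_big; apply: eq_bigr => i _; rewrite scaler_suml.
  by apply: eq_bigr => j _; rewrite scalerA.
exists (lin_span b), (fun v => \sum_i cmod (co v i)); split.
- by exists d, b.
- split.
  + by move=> v _; apply: sumr_ge0 => i _; exact: cmod_ge0.
  + move=> v hv h0; rewrite (hco v hv) big1// => i _.
    have /eqP := psumr_eq0P (fun i _ => cmod_ge0 (co v i)) h0 (i := i) isT.
    by rewrite cmod_eq0 => /eqP ->; rewrite scale0r.
  + move=> c v [f ->].
    have -> : c *: \sum_i f i *: b i = \sum_i (c * f i) *: b i.
      by rewrite scaler_sumr; apply: eq_bigr => i _; rewrite scalerA.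
    by rewrite mulr_sumr; apply: eq_bigr => i _; rewrite !coE cmodM.
  + move=> u v [f ->] [g ->].
    have -> : \sum_i f i *: b i + \sum_i g i *: b i = \sum_i (f i + g i) *: b i.
      by rewrite -big_split; apply: eq_bigr => i _; rewrite scalerDl.
    rewrite -big_split /=; apply: ler_sum => i _; rewrite !coE; exact: cmodD.
- by move=> c; rewrite sumE; eexists.
exists (fun j => \sum_i cmod (A j i)) => [j|c]; first by apply: sumr_ge0 => i _; exact: cmod_ge0.
rewrite sumE; under eq_bigr do rewrite coE.
under [leRHS]eq_bigr do rewrite mulr_sumr.
rewrite exchange_big /=; apply: ler_sum => i _; apply: (le_trans (cmod_sum _ _ _)).
by apply: ler_sum => j _; rewrite cmodM.
Qed.

Lemma expands_sums_normally (U : set E) f F : open U -> expands U f F ->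
  sums_normally_to U f F.
Proof.
move=> oU [J [e [c [s [h1 h2 h3 h4 h5]]]]].
have [Y [nu [hY hnu Ysum [w w0 hw]]]] := span_norm e.
split; first split.
- move=> k; apply: holo_span_holomorphic => p Up; exists U; split=> //.
  exists J, e, (c k); split=> [j x|x] Ux; [exact: h1|exact: h2].
- move=> K cK KU; exists Y, nu; split=> //; first by move=> k x /KU Ux; rewrite h2.
  have /choice[M hM] : forall j, exists M : int -> R, exists B : R,
     [/\ forall k, 0 <= M k, forall k x, K x -> cmod (c k j x) <= M k
       & forall A : {fset int}, \sum_(k <- A) M k <= B].
    by move=> j; exact: h4.
  have /choice[B hB] := hM.
  apply: (@le_lt_trans _ _ (\sum_j B j * w j)%:E); last exact: ltry.
  apply: ge_ereal_sup => _ [A [finA _] <-]; rewrite fsbig_finite//=.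
  apply: (@le_trans _ _ (\sum_(k <- fset_set A) (\sum_j M j k * w j)%:E)%E).
    apply: lee_sum => k _; apply: ge_ereal_sup => _ [x Kx <-]; rewrite lee_fin.
    rewrite h2; last exact: KU.
    apply: (le_trans (hw _)); apply: ler_sum => j _; rewrite ler_wpM2r//.
    by have [_ h _] := hB j; exact: h.
  rewrite sumEFin lee_fin exchange_big; apply: ler_sum => j _ /=.
  rewrite -mulr_suml ler_wpM2r//.
  by have [_ _ h] := hB j; exact: h.
move=> x Ux; exists Y, nu; split=> //.
- by move=> k; rewrite h2.
- by rewrite h3.
have FT : Filter (@summability.totally int) by exact: summability.totally_filter.
apply/cvgrPdist_le => d d0.
have W0 : 0 < \sum_j w j + 1 by rewrite ltr_wpDl ?sumr_ge0.
have /choice[A0 hA0] : forall j, exists A0 : {fset int}, forall A : {fset int}, (A0 `<=` A)%fset ->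
    cmod (\sum_(k <- A) c k j x - s j x) <= d / (\sum_j w j + 1).
  by move=> j; apply: h5 => //; rewrite divr_gt0.
pose A1 := seq_fset tt (flatten [seq enum_fset (A0 j) | j <- enum J]).
exists A1 => // A hA /=; rewrite sub0r normrN /summability.partial_sum.
rewrite -(big_seq_fsetE _ A predT (f ^~ x)) h3//.
have -> : \sum_(k <- A) f k x - \sum_j s j x *: e j =
   \sum_j (\sum_(k <- A) c k j x - s j x) *: e j.
  under eq_bigr do rewrite h2//; rewrite exchange_big -sumrB /=; apply: eq_bigr => j _.
  by rewrite scalerBl scaler_suml.
have [n0 _ _ _] := hnu.
rewrite ger0_norm ?n0//; apply: (le_trans (hw _)).
apply: (@le_trans _ _ (\sum_j (d / (\sum_j w j + 1)) * w j)).
  apply: ler_sum => j _; rewrite ler_wpM2r// hA0//; apply: fsubset_trans hA.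
  apply/fsubsetP => k kA; rewrite seq_fsetE; apply/flattenP; exists (enum_fset (A0 j)) => //.
  by apply: map_f; rewrite mem_enum.
rewrite -mulr_sumr mulrAC ler_pdivrMr// ler_wpM2l ?(ltW d0)//.
by rewrite lerDl.
Qed.

End Expansions.

(** * Uniform bounds on compact sets *)

Section CompactBounds.
Variables (R : realType) (E : normedModType R[i]).
Implicit Types (f g : E -> R[i]^o).

Lemma differentiable_cmod f x : differentiable f x ->
  {for x, continuous (fun y => cmod (f y))}.
Proof.
move=> /differentiable_continuous hf; apply/cvgrPdist_le => e e0.
have eC : 0 < e%:C by rewrite ltcR.
move/cvgrPdist_le: hf => /(_ _ eC); apply: filterS => y.
by rewrite normr_cmod lecR; apply: le_trans; exact: ler_cmod_dist.
Qed.

Lemma compact_cmod_max f (K : set E) : compact K -> (forall x, K x -> differentiable f x) ->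
  K !=set0 -> exists2 x, K x & forall y, K y -> cmod (f y) <= cmod (f x).
Proof.
move=> cK hf K0.
have [|x /set_mem Kx hx] := @compact_EVT_max E R (fun y => cmod (f y)) K K0 cK.
  by apply: continuous_in_subspaceT => y /set_mem /hf; exact: differentiable_cmod.
by exists x => // y /mem_set; exact: hx.
Qed.

Lemma compact_cmod_le f (K : set E) : compact K -> (forall x, K x -> differentiable f x) ->
  exists2 G : R, 0 <= G & forall x, K x -> cmod (f x) <= G.
Proof.
move=> cK hf; have [/(compact_cmod_max cK hf)[x _ hx]|/set0P/negP/negPn/eqP ->] := pselect (K !=set0).
  by exists (cmod (f x)); [exact: cmod_ge0 | exact: hx].
by exists 0.
Qed.

Lemma compact_cmod_lt1 f (K : set E) : compact K -> (forall x, K x -> differentiable f x) ->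
  (forall x, K x -> cmod (f x) < 1) ->
  exists2 r : R, 0 <= r < 1 & forall x, K x -> cmod (f x) <= r.
Proof.
move=> cK hf h1; have [/(compact_cmod_max cK hf)[x Kx hx]|/set0P/negP/negPn/eqP ->] := pselect (K !=set0).
  by exists (cmod (f x)); [rewrite cmod_ge0 h1 | exact: hx].
by exists 0; rewrite ?lexx ?ltr01.
Qed.

Lemma compact_cmod_lt1_seq (fs : seq (E -> R[i]^o)) (K : set E) : compact K ->
  (forall k, (k < size fs)%N -> forall x, K x -> differentiable (nth (cst 0) fs k) x) ->
  (forall k, (k < size fs)%N -> forall x, K x -> cmod (nth (cst 0) fs k x) < 1) ->
  exists2 r : R, 0 <= r < 1 & forall x, K x -> forall u, u \in [seq f x | f <- fs] -> cmod u <= r.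
Proof.
move=> cK; elim: fs => [|f fs IH] hd h1; first by exists 0; rewrite ?lexx ?ltr01.
have [r /andP[r0 r1] hr] := IH (fun k => hd k.+1) (fun k => h1 k.+1).
have [r' /andP[r'0 r'1] hr'] := compact_cmod_lt1 cK (hd 0%N isT) (h1 0%N isT).
exists (Num.max r r'); first by rewrite le_max r0 gt_max r1.
by move=> x Kx u; rewrite inE le_max => /predU1P[->|/(hr _ Kx) ->]; rewrite ?hr' ?orbT.
Qed.

Lemma differentiable_hsym (fs : seq (E -> R[i]^o)) k x :
  (forall j, (j < size fs)%N -> differentiable (nth (cst 0) fs j) x) ->
  differentiable (fun y => hsym [seq f y | f <- fs] k : R[i]^o) x.
Proof.
elim: fs k => [|f fs IH] k h; first exact: differentiable_cst.
have IH' j := IH j (fun i => h i.+1); have hf := h 0%N isT.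
elim: k => [|k IHk] /=.
  have -> : (fun y => hsym [seq f y | f <- f :: fs] 0 : R[i]^o) = fun y => hsym [seq f y | f <- fs] 0.
    by apply/funext => y /=; rewrite hsym0.
  exact: IH'.
have -> : (fun y => hsym [seq f y | f <- f :: fs] k.+1 : R[i]^o) =
   (fun y => hsym [seq f y | f <- fs] k.+1 : R[i]^o) +
   (fun y => f y * hsym [seq f y | f <- f :: fs] k : R[i]^o).
  by apply/funext => y /=; rewrite hsymS.
by apply: differentiableD => //; exact: differentiable_mul.
Qed.

Lemma differentiable_hsymz (fs : seq (E -> R[i]^o)) (k : int) x :
  (forall j, (j < size fs)%N -> differentiable (nth (cst 0) fs j) x) ->
  differentiable (fun y => hsymz [seq f y | f <- fs] k : R[i]^o) x.
Proof.
by case: k => k h; [exact: differentiable_hsym | exact: differentiable_cst].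
Qed.

End CompactBounds.

(** * Associativity *)

Section AssociativityDomain.
Variables (R : realType) (m n : nat).
Local Notation E := ('rV[R[i]]_(m + 1) * 'rV[R[i]]_n)%type.

Definition base_pt (p : E) : R[i] := p.1 0 (rshift m 0).
Definition rel_pt (p : E) (i : 'I_m) : R[i] := p.1 0 (lshift 1 i) - base_pt p.

Lemma differentiable_fst_entry i x : differentiable (fun p : E => p.1 0 i : R[i]^o) x.
Proof.
apply: (@differentiable_comp _ _ _ _ (fst : E -> 'rV[R[i]]_(m + 1)) (fun z => z 0 i : R[i]^o)).
  apply: (@linear_differentiable _ _ _ (fst : {linear E -> 'rV[R[i]]_(m + 1)})) => y.
  exact: cvg_fst.
exact: differentiable_entry.
Qed.

Lemma differentiable_snd_entry j x : differentiable (fun p : E => p.2 0 j : R[i]^o) x.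
Proof.
apply: (@differentiable_comp _ _ _ _ (snd : E -> 'rV[R[i]]_n) (fun z => z 0 j : R[i]^o)).
  apply: (@linear_differentiable _ _ _ (snd : {linear E -> 'rV[R[i]]_n})) => y.
  exact: cvg_snd.
exact: differentiable_entry.
Qed.

Lemma differentiable_base_pt x : differentiable (base_pt : E -> R[i]^o) x.
Proof. exact: differentiable_fst_entry. Qed.

Lemma differentiable_rel_pt i x : differentiable ((fun p => rel_pt p i) : E -> R[i]^o) x.
Proof. by apply: differentiable_sub; exact: differentiable_fst_entry. Qed.

Lemma open_assoc_domain : @open (E : normedModType R[i]) (assoc_domain R m n).
Proof.
rewrite openE => p [h1 h2 h3].
have k1 : \forall q \near p, ~ fat_diagonal q.1.
  have : open_nbhs p.1 (~` @fat_diagonal R (m + 1)) by split; [exact: open_not_fat|].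
  by move=> /open_nbhs_nbhs; exact: cvg_fst.
have k2 : \forall q \near p, ~ fat_diagonal q.2.
  have : open_nbhs p.2 (~` @fat_diagonal R n) by split; [exact: open_not_fat|].
  by move=> /open_nbhs_nbhs; exact: cvg_snd.
pose P (ij : 'I_n * 'I_m) (q : E) :=
  `|q.2 0 ij.1| < `|q.1 0 (lshift 1 ij.2) - q.1 0 (rshift m 0)|.
have k3 : \forall q \near p, forall ij, P ij q.
  apply: (@filter_forall _ _ P _ (nbhs_filter p)) => -[i j]; rewrite /P /=.
  have hc : (fun q : E => cmod (rel_pt q j) - cmod (q.2 0 i)) @ p -->
      cmod (rel_pt p j) - cmod (p.2 0 i).
    apply: cvgB; first exact: (differentiable_cmod (@differentiable_rel_pt j p)).
    exact: (differentiable_cmod (@differentiable_snd_entry i p)).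
  have h0 : 0 < cmod (rel_pt p j) - cmod (p.2 0 i) by rewrite subr_gt0 -lt_cmod; exact: h3.
  have /(_ (nbhs_filter p)) := cvgr_gt _ hc _ h0; apply: (@filterS _ _ (nbhs_filter p)) => q.
  by rewrite subr_gt0 lt_cmod.
suff : nbhs p (assoc_domain R m n) by [].
apply: (@filterS _ _ (nbhs_filter p) _ _ _ (@filterI _ _ (nbhs_filter p) _ _ k1
  (@filterI _ _ (nbhs_filter p) _ _ k2 k3))) => q [q1 [q2 q3]].
by split=> // i j; exact: (q3 (i, j)).
Qed.

End AssociativityDomain.

Section Associativity.
Variables (R : realType) (V : vertexAlgebra R).
Variable mu : forall m : nat, 'rV[V]_m -> 'rV[R[i]]_m -> completion V.
Hypothesis Hmu : is_multiplication mu.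

(** Both arguments of [mu] are translates by [z_(m+1)] of configurations based at [0]. The
    inequality [|w_j| < |z_i|] keeps the two groups of points apart. *)
Lemma assoc_domain_points m n (p : 'rV[R[i]]_(m + 1) * 'rV[R[i]]_n) : assoc_domain R m n p ->
  let z := \row_i rel_pt p i in let x := base_pt p in
  [/\ p.1 = row_mx z (0 : 'rV_1) + const_mx x, ~ fat_diagonal (row_mx z (0 : 'rV_1)),
      row_mx (lsubmx p.1) (p.2 + const_mx x) = row_mx z p.2 + const_mx x,
      ~ fat_diagonal (row_mx z p.2)
    & forall i j, cmod (p.2 0 j) < cmod (z 0 i)].
Proof.
move=> [/not_fat_diagonalP h1 /not_fat_diagonalP h2 h3] z x.
have lt i j : cmod (p.2 0 j) < cmod (z 0 i) by rewrite mxE -lt_cmod; exact: h3.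
split=> //.
- apply/rowP => k; case: (split_ordP k) => i ->; rewrite !mxE.
    by rewrite (unsplitK (inl i)) mxE /rel_pt subrK.
  by rewrite (unsplitK (inr i)) mxE add0r (ord1 i).
- apply/not_fat_diagonalP => k k'; case: (split_ordP k) => i ->; case: (split_ordP k') => i' ->;
    rewrite ?row_mxEl ?row_mxEr !mxE.
  + rewrite (inj_eq (@lshift_inj _ _)) => ii; rewrite (inj_eq (addIr _)); apply: h1.
    by rewrite (inj_eq (@lshift_inj _ _)).
  + by move=> _; rewrite subr_eq0; apply: h1; rewrite eq_lrshift.
  + by move=> _; rewrite eq_sym subr_eq0; apply: h1; rewrite eq_lrshift.
  + by rewrite (ord1 i) (ord1 i') eqxx.
- apply/rowP => k; case: (split_ordP k) => i ->; rewrite !mxE ?(unsplitK (inl i)) ?(unsplitK (inr i)) !mxE//.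
  by rewrite /rel_pt subrK.
- apply/not_fat_diagonalP => k k'; case: (split_ordP k) => i ->; case: (split_ordP k') => i' ->;
    rewrite ?row_mxEl ?row_mxEr.
  + rewrite (inj_eq (@lshift_inj _ _)) => ii; rewrite !mxE (inj_eq (addIr _)); apply: h1.
    by rewrite (inj_eq (@lshift_inj _ _)).
  + by move=> _; apply/eqP => e; have := lt i i'; rewrite e ltxx.
  + by move=> _; apply/eqP => e; have := lt i' i; rewrite e ltxx.
  + by rewrite (inj_eq (@rshift_inj _ _)); exact: h2.
Qed.

Local Notation Pts m n := ('rV[R[i]]_(m + 1) * 'rV[R[i]]_n)%type.

(** [T^r] as a map between homogeneous components. Its values lie in degree [l], so the projection
    loses nothing. *)
Definition Tproj (l : int) (r : nat) (y : gr_comp V (l - r%:Z)) : gr_comp V l :=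
  gr_proj V l (iter r (va_T V) (gr_inj V (l - r%:Z) y)).

Lemma iter_va_T_sum r (J : finType) (c : J -> R[i]) (x : J -> V) :
  iter r (va_T V) (\sum_j c j *: x j) = \sum_j c j *: iter r (va_T V) (x j).
Proof.
elim: r => //= r ->; rewrite linear_sum.
by apply: eq_bigr => j _; rewrite linearZ.
Qed.

Lemma Tproj_sum l r (J : finType) (c : J -> R[i]) (y : J -> gr_comp V (l - r%:Z)) :
  Tproj (\sum_j c j *: y j) = \sum_j c j *: Tproj (y j).
Proof.
rewrite /Tproj linear_sum; under eq_bigr do rewrite linearZ.
rewrite iter_va_T_sum linear_sum.
by apply: eq_bigr => j _; rewrite linearZ.
Qed.

(** Both sides are expanded in one finite family, indexed by a power [r] of [T] from the translation
    and a monomial [P] of the numerator of [a, b]. The coefficients share the factor [G]; what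
    remains is [hsymz] for the terms and its sum over [k] for the limit. *)
Lemma homogeneous_expands m n (a : 'rV[V]_m) (b : 'rV[V]_n) (d : 'I_n -> int) l :
  (forall j, homogeneous (d j) (b 0 j)) ->
  expands (assoc_domain R m n)
    (fun (k : int) (p : Pts m n) =>
       mu (row_mx a (const_mx (gr_inj V k (mu b p.2 k)) : 'rV_1)) p.1 l)
    (fun p : 'rV[R[i]]_(m + 1) * 'rV[R[i]]_n =>
       mu (row_mx a b) (row_mx (lsubmx p.1) (p.2 + const_mx (p.1 0 (rshift m 0)))) l).
Proof.
move=> hd; pose c := row_mx a b.
have [N /(_ N (leqnn N)) hl] := loc_row c.
have [bd hbd] := Mv_support hl.
have [R0 hR0] := mu_translation Hmu c l.
(* Large enough for the translation formula of [a, b] and for the numerator to have no component of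
   degree [l - r] when [r >= R1]. *)
pose R1 := maxn R0 `|l - bd|.+1.
have [S [Spos hS]] := nonneg_box 'I_(m + n) (l - bd).
have MS l' P : l' <= l -> P \notin S -> gr_proj V l' (Mv (c 0) N P) = 0.
  move=> ll PS; apply/eqP; apply: contraNT PS => /hbd[h1 h2]; apply: hS => //.
  by apply: (le_trans h2); rewrite lerD2r.
have Mvanish r P : (R1 <= r)%N -> gr_proj V (l - r%:Z) (Mv (c 0) N P) = 0.
  rewrite geq_max => /andP[_ hr]; apply/eqP; apply: contraT => /hbd[h1 h2].
  have : 0 <= tdeg P by apply: sumr_ge0.
  by move: (tdeg P) h2 => t; lia.
pose fs : seq ((Pts m n) -> R[i]^o) :=
  catrev [seq (fun p : (Pts m n) => p.2 0 y.2 / rel_pt p y.1) | y <- crossN m n N] [::].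
pose Dzw (p : (Pts m n)) : R[i] := DD N (prs (enum 'I_m)) (rel_pt p) * DD N (prs (enum 'I_n)) (p.2 0).
pose Pi (p : (Pts m n)) : R[i] := \prod_(y <- crossN m n N) (rel_pt p y.1)^-1.
pose Q (P : {ffun 'I_(m + n) -> int}) (p : (Pts m n)) : R[i] :=
  nmono (rel_pt p) (lpart P) * nmono (p.2 0) (rpart P).
pose G (j : 'I_R1 * S) (p : (Pts m n)) : R[i] :=
  base_pt p ^+ j.1 / (j.1)`!%:R * ((Dzw p)^-1 * Pi p * Q (val j.2) p).
pose k0 (j : 'I_R1 * S) : int :=
  \sum_i d i - (N * size (prs (enum 'I_n)))%:Z + tdeg (rpart (val j.2)).
pose e (j : 'I_R1 * S) : gr_comp V l := Tproj (gr_proj V (l - (j.1)%:Z) (Mv (c 0) N (val j.2))).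
have relE (p : (Pts m n)) : (\row_i rel_pt p i) 0 = rel_pt p by apply/funext => i; rewrite mxE.
have fsE (p : (Pts m n)) : [seq f p | f <- fs] =
    catrev [seq p.2 0 y.2 / rel_pt p y.1 | y <- crossN m n N] [::].
  by rewrite /fs -!/(rev _) map_rev -map_comp.
have QE P (p : (Pts m n)) : P \in S -> mono (rel_pt p) (lpart P) * mono (p.2 0) (rpart P) = Q P p.
  move=> PS; rewrite /Q !nmonoE// => i; rewrite ffunE; exact: Spos.
have Dzw0 (p : (Pts m n)) : assoc_domain R m n p -> Dzw p != 0.
  move=> Up; have [_ hz _ hzw _] := assoc_domain_points Up.
  have [_ /(DD_neq0_fat N)] := not_fat_row0 hz; rewrite relE => h1.
  have [_ h2 _] := Up; by rewrite mulf_neq0//; exact: DD_neq0_fat.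
have fs_nth k : (k < size fs)%N -> exists y : 'I_m * 'I_n,
    nth (cst 0) fs k = (fun p : (Pts m n) => p.2 0 y.2 / rel_pt p y.1).
  move=> kf; have : nth (cst 0) fs k \in ([seq (fun p : (Pts m n) => p.2 0 y.2 / rel_pt p y.1) | y <- crossN m n N] : seq ((Pts m n) -> R[i]^o)).
    by rewrite -mem_rev; exact: mem_nth.
  by move=> /mapP[y _ ->]; exists y.
have fs_diff k (p : (Pts m n : normedModType R[i])) : assoc_domain R m n p -> (k < size fs)%N -> differentiable (nth (cst 0) fs k) p.
  move=> Up /fs_nth[y ->]; have [_ hz _ _ _] := assoc_domain_points Up.
  have [/(_ y.1) z0 _] := not_fat_row0 hz; rewrite mxE in z0.
  apply: differentiable_mul; first exact: differentiable_snd_entry.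
  by apply: differentiable_inv => //; exact: differentiable_rel_pt.
have fs_lt1 k p : assoc_domain R m n p -> (k < size fs)%N -> cmod (nth (cst 0) fs k p) < 1.
  move=> Up /fs_nth[y ->]; have [_ hz _ _ /(_ y.1 y.2)] := assoc_domain_points Up.
  have [/(_ y.1) z0 _] := not_fat_row0 hz; rewrite mxE in z0.
  by rewrite mxE cmodM cmodV ltr_pdivrMr ?cmod_gt0// mul1r.
have rel0 p y : assoc_domain R m n p -> rel_pt p y != 0.
  move=> Up; have [_ hz _ _ _] := assoc_domain_points Up.
  by have [/(_ y) z0 _] := not_fat_row0 hz; rewrite mxE in z0.
have Gdiff j (p : (Pts m n : normedModType R[i])) : assoc_domain R m n p -> differentiable (G j : (Pts m n) -> R[i]^o) p.
  move=> Up; have hr y : differentiable ((fun p => rel_pt p y) : (Pts m n) -> R[i]^o) p by exact: differentiable_rel_pt.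
  have hw y : differentiable ((fun p : (Pts m n) => p.2 0 y) : (Pts m n) -> R[i]^o) p by exact: differentiable_snd_entry.
  apply: differentiable_mul.
    apply: differentiable_mul; last exact: differentiable_cst.
    by apply: differentiable_pow; exact: differentiable_base_pt.
  apply: differentiable_mul; last first.
    by apply: differentiable_mul; exact: differentiable_nmono.
  apply: differentiable_mul.
    apply: differentiable_inv; last exact: Dzw0.
    by apply: differentiable_mul; exact: differentiable_DD.
  by apply: differentiable_prod => y; apply: differentiable_inv => //; exact: rel0.
exists ('I_R1 * S)%type, e, (fun k j p => G j p * hsymz [seq f p | f <- fs] (k - k0 j)),
  (fun j p => G j p * \prod_(u <- [seq f p | f <- fs]) (1 - u)^-1); split.
- move=> k j p Up; apply: differentiable_mul; first exact: Gdiff.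
  by apply: differentiable_hsymz => i; exact: fs_diff.
- move=> k p Up; have [pE hz _ _ _] := assoc_domain_points Up.
  set v := gr_inj V k _; pose c' := row_mx a (const_mx v : 'rV_1).
  have [R0' hR0'] := mu_translation Hmu c' l.
  (* [R0'] depends on [k] and [w] through [v], but the terms from [R1] on vanish by [Mvanish], so
     the index set ['I_R1 * S] serves all [k]. *)
  rewrite {1}pE (hR0' (maxn R1 R0'))//; last exact: leq_maxr.
  have term r : mu c' (row_mx (\row_i rel_pt p i) (0 : 'rV_1)) (l - r%:Z) =
      \sum_(P : S) ((Dzw p)^-1 * Pi p * Q (val P) p *
        hsymz [seq f p | f <- fs] (k - (\sum_i d i - (N * size (prs (enum 'I_n)))%:Z + tdeg (rpart (val P))))) *:
        gr_proj V (l - r%:Z) (Mv (c 0) N (val P)).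
    apply: (scalerI (Dzw0 p Up)); have [_ h2 _] := Up.
    have lr : l - r%:Z <= l by rewrite gerBl.
    have := @origin_formula _ _ _ Hmu _ _ a b d N (l - r%:Z) S hl hd (fun P => @MS _ P lr) k _ p.2 hz h2.
    rewrite relE => h; apply: (etrans h) => {h}.
    rewrite !scaler_sumr; apply: eq_bigr => P _; rewrite !scalerA QE ?(valP P)// fsE.
    have -> : k - \sum_j d j + (N * size (prs (enum 'I_n)))%:Z - tdeg (rpart (val P)) =
      k - (\sum_i d i - (N * size (prs (enum 'I_n)))%:Z + tdeg (rpart (val P))) by ring.
    rewrite -/(Pi p) -/c.
    congr (_ *: _); have := Dzw0 p Up; move: (Dzw p) (Pi p) (Q _ p) (hsymz _ _) => D A B C D0.
    by field.
  pose T (r : nat) := \sum_(P : S)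
     (base_pt p ^+ r / r`!%:R * ((Dzw p)^-1 * Pi p * Q (val P) p) *
        hsymz [seq f p | f <- fs] (k - (\sum_i d i - (N * size (prs (enum 'I_n)))%:Z + tdeg (rpart (val P))))) *:
        Tproj (gr_proj V (l - r%:Z) (Mv (c 0) N (val P))).
  transitivity (\sum_(r < maxn R1 R0') T r).
    apply: eq_bigr => r _; rewrite -/(Tproj _) term Tproj_sum scaler_sumr.
    by apply: eq_bigr => P _; rewrite scalerA mulrA.
  rewrite (@sum_trunc _ T R1); [ | exact: leq_maxl | ].
    by rewrite pair_bigA.
  move=> r Rr; rewrite /T big1// => P _; rewrite Mvanish//.
  by rewrite /Tproj linear0 iter_va_T0 linear0 scaler0.
- move=> p Up; have [_ _ -> hz _] := assoc_domain_points Up.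
  rewrite (hR0 R1)//; last exact: leq_maxl.
  have term r : mu c (row_mx (\row_i rel_pt p i) p.2) (l - r%:Z) =
      \sum_(P : S) ((Dzw p)^-1 * Pi p * Q (val P) p * \prod_(u <- [seq f p | f <- fs]) (1 - u)^-1) *:
        gr_proj V (l - r%:Z) (Mv (c 0) N (val P)).
    have DD0 := DD_neq0_fat N hz.
    apply: (scalerI DD0); rewrite (mu_rational Hmu)// /ev (@fsumE _ _ S); last first.
      by move=> P PS; rewrite MS ?scaler0// gerBl.
    rewrite big_seq_fsetE scaler_sumr; apply: eq_bigr => P _; rewrite scalerA.
    congr (_ *: _).
    have yl : (fun i => row_mx (\row_i rel_pt p i) p.2 0 (lshift n i)) = rel_pt p.
      by apply/funext => i; rewrite row_mxEl mxE.
    have yr : (fun j => row_mx (\row_i rel_pt p i) p.2 0 (rshift m j)) = p.2 0.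
      by apply/funext => j; rewrite row_mxEr.
    rewrite -[X in mono _ X]jidx_parts mono_join yl yr QE ?(valP P)// DD_blocks yl yr.
    rewrite fsE -/(rev _) (perm_big _ (permEl (perm_rev _))) big_map /=.
    (* Here the mixed factors stay in the denominator: [1 / (z_i - w_j)] is [z_i^-1] times
       [(1 - w_j / z_i)^-1], the sum of the corresponding geometric series. *)
    have -> : \prod_(c0 <- crossN m n N) (row_mx (\row_i rel_pt p i) p.2 0 (lshift n c0.1) -
        row_mx (\row_i rel_pt p i) p.2 0 (rshift m c0.2)) =
       \prod_(y <- crossN m n N) (rel_pt p y.1 * (1 - p.2 0 y.2 / rel_pt p y.1)).
      apply: eq_bigr => y _; rewrite row_mxEl row_mxEr mxE.
      by have := rel0 p y.1 Up; move: (rel_pt _ _) (p.2 _ _) => u w u0; field.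
    rewrite big_split /=.
    have hA : \prod_(y <- crossN m n N) rel_pt p y.1 != 0.
      by rewrite prodf_seq_neq0; apply/allP => y _; exact: rel0.
    have hB : \prod_(y <- crossN m n N) (1 - p.2 0 y.2 / rel_pt p y.1) != 0.
      rewrite prodf_seq_neq0; apply/allP => y _ /=; rewrite subr_eq0; apply/eqP => h.
      have [_ _ _ _ /(_ y.1 y.2)] := assoc_domain_points Up; rewrite mxE.
      by rewrite -[X in _ < cmod X](mulr1) h mulrC divfK ?rel0// ltxx.
    rewrite /Pi !prodfV; have := Dzw0 p Up; rewrite /Dzw mulf_eq0 negb_or => /andP[].
    move: (DD _ _ _) (DD _ _ _) (Q _ _) (\prod_(_ <- _) _) (\prod_(_ <- _) _) hA hB.
    by move=> D1 D2 q A B A0 B0 h1 h2; field; rewrite A0 B0 h1 h2.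
  transitivity (\sum_(r < R1) \sum_(P : S)
     (base_pt p ^+ r / r`!%:R * ((Dzw p)^-1 * Pi p * Q (val P) p) *
        \prod_(u <- [seq f p | f <- fs]) (1 - u)^-1) *:
        Tproj (gr_proj V (l - r%:Z) (Mv (c 0) N (val P)))).
    apply: eq_bigr => r _; rewrite -/(Tproj _) term Tproj_sum scaler_sumr.
    by apply: eq_bigr => P _; rewrite scalerA mulrA.
  by rewrite pair_bigA.
- move=> K cK KU j.
  have [Gb Gb0 hG] := compact_cmod_le cK (fun p Kp => Gdiff j p (KU p Kp)).
  have [r /andP[r0 r1] hr] := compact_cmod_lt1_seq cK
    (fun k hk p Kp => fs_diff k p (KU p Kp) hk) (fun k hk p Kp => fs_lt1 k p (KU p Kp) hk).
  have H0 k : 0 <= hsym (nseq (size fs) r) k.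
    by apply: hsym_ge0 => u; rewrite mem_nseq => /andP[_ /eqP ->].
  (* On [K] all ratios [w_j / z_i] are bounded in modulus by one [r < 1]; replacing each of them by
     [r] gives the majorant. *)
  exists (fun k => Gb * zext (hsym (nseq (size fs) r)) (k - k0 j)), (Gb * (1 - r) ^- size fs); split.
  + by move=> k; rewrite mulr_ge0// zext_ge0.
  + move=> k p Kp; rewrite cmodM ler_pM ?cmod_ge0 ?hG// hsymz_zext.
    case: (k - k0 j) => i; last by rewrite /zext cmod0.
    by rewrite -(size_map (fun f : (Pts m n) -> R[i]^o => f p) fs); apply: cmod_hsym; exact: hr.
  + move=> A; rewrite -mulr_sumr ler_wpM2l//; apply: shifted_sum_le => // i.
    by apply: hsym_sum_le; rewrite r0.
- move=> p Up j; apply: ssumZ; apply: hsymz_sum => u /mapP[f /(nthP (cst 0))[i hi <-] ->].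
  exact: fs_lt1.
Qed.

End Associativity.

(** * Reduction to homogeneous entries *)

Section Reduction.
Variables (R : realType) (V : vertexAlgebra R).
Variable mu : forall m : nat, 'rV[V]_m -> 'rV[R[i]]_m -> completion V.
Hypothesis Hmu : is_multiplication mu.
Variables (m n : nat) (a : 'rV[V]_m) (l : int).
Local Notation Pts := ('rV[R[i]]_(m + 1) * 'rV[R[i]]_n)%type.

(** Phrased with [expands] because adding two instances of [sums_normally_to] would require merging
    different subspaces and norms. *)
Definition associative_at (b : 'rV[V]_n) : Prop :=
  expands (assoc_domain R m n)
    (fun (k : int) (p : Pts) =>
       mu (row_mx a (const_mx (gr_inj V k (mu b p.2 k)) : 'rV_1)) p.1 l)
    (fun p : Pts =>
       mu (row_mx a b) (row_mx (lsubmx p.1) (p.2 + const_mx (p.1 0 (rshift m 0)))) l).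

Definition with_entry (b : 'rV[V]_n) (s : 'I_n) (v : V) : 'rV[V]_n :=
  \row_j if j == s then v else b 0 j.

Lemma associative_at_add b s u v : associative_at (with_entry b s u) ->
  associative_at (with_entry b s v) -> associative_at (with_entry b s (u + v)).
Proof.
move=> hu hv; apply: expands_eq (expandsD hu hv) => [k p|p] Up; have [h1 h2 _] := Up.
  have -> : mu (with_entry b s (u + v)) p.2 k =
      mu (with_entry b s u) p.2 k + mu (with_entry b s v) p.2 k.
    rewrite -[X in _ = X + _]scale1r; apply: (mu_linear Hmu _ (s := s)) => // [i /negbTE si|].
      by rewrite !mxE si.
    by rewrite !mxE eqxx scale1r.
  rewrite linearD -[X in X + _ = _]scale1r; apply/esym.
  apply: (mu_linear Hmu _ (s := rshift m 0)) => // [i|]; last by rewrite !row_mxEr !mxE scale1r.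
  by case: (split_ordP i) => j ->; rewrite ?row_mxEl// (ord1 j) eqxx.
rewrite -[X in X + _ = _]scale1r; apply/esym.
apply: (mu_linear Hmu _ (s := rshift m s)) => [|i|].
- have [_ _ -> hz _] := assoc_domain_points Up; exact: not_fat_translate.
- case: (split_ordP i) => j ->; rewrite ?row_mxEl// !row_mxEr (inj_eq (@rshift_inj _ _)) !mxE.
  by move=> /negbTE ->.
- by rewrite !row_mxEr !mxE eqxx scale1r.
Qed.

(** Induction on the number [t] of leading entries not yet known to be homogeneous; the last of
    these is split into its homogeneous components. *)
Lemma associative_at_homogeneous_from t (b : 'rV[V]_n) :
  (forall j : 'I_n, (t <= j)%N -> exists d, homogeneous d (b 0 j)) -> associative_at b.
Proof.
elim: t b => [|t IH] b hb.
  have /choice[d hd] : forall j, exists d, homogeneous d (b 0 j) by move=> j; exact: hb.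
  exact: homogeneous_expands hd.
have [tn|nt] := ltnP t n; last first.
  by apply: IH => j tj; have := leq_trans (leq_trans (ltn_ord j) nt) tj; rewrite ltnn.
pose s := Ordinal tn; have [A hA] := gr_sum (b 0 s).
have -> : b = with_entry b s (\sum_(k <- A) gr_inj V k (gr_proj V k (b 0 s))).
  by apply/rowP => j; rewrite mxE; case: eqP => // ->.
have hom k x : associative_at (with_entry b s (gr_inj V k x)).
  apply: IH => j tj; rewrite mxE; case: eqP => [_|/eqP js]; first by exists k, x.
  by apply: hb; rewrite ltn_neqAle tj andbT eq_sym; apply: contra js => /eqP e; apply/eqP/val_inj.
elim: (A : seq int) => [|k A' IHA]; last by rewrite big_cons; exact: associative_at_add.
(* An empty decomposition means that the entry is [0], which is homogeneous of degree [0]. *)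
by rewrite big_nil -(linear0 (gr_inj V 0)).
Qed.

End Reduction.

Theorem proposition6p5 (R : realType) (V : vertexAlgebra R)
    (mu : forall m : nat, 'rV[V]_m -> 'rV[R[i]]_m -> completion V)
    (Hmu : is_multiplication mu)
    (m n : nat) (a : 'rV[V]_m) (b : 'rV[V]_n) (l : int) :
  sums_normally_to (assoc_domain R m n)
    (fun (k : int) (p : 'rV[R[i]]_(m + 1) * 'rV[R[i]]_n) =>
       mu (m + 1)%N
          (row_mx a (const_mx (gr_inj V k (mu n b p.2 k)) : 'rV[V]_1))
          p.1 l)
    (fun p : 'rV[R[i]]_(m + 1) * 'rV[R[i]]_n =>
       mu (m + n)%N (row_mx a b)
          (row_mx (lsubmx p.1) (p.2 + const_mx (p.1 0 (rshift m 0)))) l).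
Proof.
(* With [t = n] the homogeneity hypothesis concerns no entry. *)
by apply: (expands_sums_normally (@open_assoc_domain R m n)); apply: (@associative_at_homogeneous_from _ _ _ Hmu _ _ _ _ n) => j; rewrite leqNgt ltn_ord.
Qed.
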